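(* For every $\lambda_0\in(0,1/e)$ and every $\lambda\in\mathbb{C}\setminus\{0\}$ there exist constants $K_1,K_2>0$, where $K_1=\log 2/\log\beta_{\lambda_0}$, with the following property. Let $h(t)=t^2g(t)$ be a gauge function. (a) If $$\liminf_{t\to0}\frac{\log g(t)}{\log\Phi_{\lambda_0}(1/t)}>K_1,$$ then $\mathcal{H}^h(I(E_\lambda))=\infty$; moreover, the measure $\mathcal{H}^h$ is not even $\sigma$-finite on $I(E_\lambda)$. (b) If $$\limsup_{t\to0}\frac{\log g(t)}{\log\Phi_{\lambda_0}(1/t)}<K_2,$$ then $\mathcal{H}^h(I(E_\lambda))=0$.
   Context: For $\lambda\in\mathbb{C}\setminus\{0\}$, $E_\lambda(z):=\lambda e^z$, and $E_\lambda^n$ is its $n$-th iterate. The escaping set $I(E_\lambda)$ is the set of all $z\in\mathbb{C}$ such that $E_\lambda^n(z)\to\infty$ as $n\to\infty$. A gauge function is a monotonically increasing function $h:[0,\varepsilon)\to\mathbb{R}_{\ge0}$ (for some $\varepsilon>0$) which is continuous from the right and satisfies $h(0)=0$. The Hausdorff measure of $A\subset\mathbb{C}$ with respect to $h$ is $$\mathcal{H}^h(A):=\lim_{\delta\to0}\inf\Big\{\sum_{i=1}^\infty h(\operatorname{diam}A_i)\ \Big|\ \bigcup_{i=1}^\infty A_i\supset A,\ \operatorname{diam}A_i<\delta\text{ for every }i\Big\}.$$ For $0<\lambda<1/e$, $E_\lambda$ has exactly two real fixed points $\alpha_\lambda<\beta_\lambda$, with $\alpha_\lambda$ attracting ($E_\lambda'(\alpha_\lambda)<1$)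 and $\beta_\lambda$ repelling ($E_\lambda'(\beta_\lambda)=\beta_\lambda>1$). By Koenigs' theorem there is a holomorphic function $\Phi_\lambda$ on a neighborhood $V$ of $\beta_\lambda$ with $\Phi_\lambda(\beta_\lambda)=0$, $\Phi_\lambda'(\beta_\lambda)=1$ and $\Phi_\lambda(E_\lambda(z))=\beta_\lambda\Phi_\lambda(z)$ whenever $z,E_\lambda(z)\in V$. It is real on the real axis, and via this functional equation it is continued to a real-valued function $\Phi_\lambda$ on $[\beta_\lambda,\infty)$ satisfying $\Phi_\lambda(E_\lambda(x))=\beta_\lambda\Phi_\lambda(x)$ for all $x\ge\beta_\lambda$; one has $\Phi_\lambda(x)\to\infty$ as $x\to\infty$. *)

(* Defs.v *)
From mathcomp Require Import all_boot all_order all_algebra.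
From mathcomp Require Import all_classical all_reals all_analysis.
From mathcomp Require Import complex.

Set Implicit Arguments.
Unset Strict Implicit.
Unset Printing Implicit Defensive.

Import Order.TTheory GRing.Theory Num.Theory.
Import numFieldNormedType.Exports.
Import ComplexField.Normc.

Local Open Scope classical_set_scope.
Local Open Scope ring_scope.
Local Open Scope complex_scope.

(* [R[i]^o] is [R[i]] as a normed space over itself, so that [derivable] and
   [derive1] on it are complex differentiability and the complex derivative;
   the real-valued modulus is [normc]. *)

Definition cexp (R : realType) (z : R[i]) : R[i] :=
  (expR (complex.Re z))%:C * (cos (complex.Im z) +i* sin (complex.Im z)).

Definition cE (R : realType) (lam : R[i]) (z : R[i]) : R[i] := lam * cexp z.

Definition rE (R : realType) (lam : R) (x : R) : R := lam * expR x.

Definition escaping_set (R : realType) (lam : R[i]) : set R[i] :=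
  [set z | normc (iter n (cE lam) z) @[n --> \oo] --> +oo].

(* Only the values of [h] on [0, eps) are relevant. *)
Definition gauge_function (R : realType) (eps : R) (h : R -> R) : Prop :=
  [/\ 0 < eps, h 0 = 0,
      (forall t, 0 <= t < eps -> 0 <= h t),
      (forall s t, 0 <= s -> s <= t -> t < eps -> h s <= h t) &
      (forall t, 0 <= t < eps -> h x @[x --> t^'+] --> h t)].

(* The [maxe 0] is there for the empty set, whose diameter is 0. *)
Definition diam (R : realType) (A : set R[i]) : \bar R :=
  maxe 0%E (ereal_sup [set (normc (p.1 - p.2))%:E | p in A `*` A]).

Definition hausdorff_content (R : realType) (h : R -> R) (delta : R)
    (A : set R[i]) : \bar R :=
  ereal_inf [set (\sum_(i <oo) (h (fine (diam (F i))))%:E)%E |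
    F in [set F : nat -> set R[i] |
      A `<=` \bigcup_i F i /\ forall i, (diam (F i) < delta%:E)%E]].

Definition hausdorff_measure (R : realType) (h : R -> R) (A : set R[i]) :
    \bar R :=
  lim (hausdorff_content h delta A @[delta --> 0^'+]).

(* The pieces are not required to be measurable, which makes the negation of
   this property formally stronger. *)
Definition hausdorff_sigma_finite (R : realType) (h : R -> R)
    (A : set R[i]) : Prop :=
  exists F : nat -> set R[i],
    A = \bigcup_i F i /\ forall i, (hausdorff_measure h (F i) < +oo)%E.

(* [b] is the larger of exactly two real fixed points of [rE lam]. *)
Definition larger_fixed_point (R : realType) (lam b : R) : Prop :=
  exists a : R, a < b /\ forall x : R, rE lam x = x <-> x = a \/ x = b.

Definition koenigs_function (R : realType) (lam b : R) (V : set R[i]^o)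
    (phi : R[i]^o -> R[i]^o) : Prop :=
  [/\ open V, V b%:C,
      (forall z, V z -> derivable phi z 1),
      phi b%:C = 0 /\ derive1 phi b%:C = 1 &
      (forall z, V z -> V (cE lam%:C z) -> phi (cE lam%:C z) = b%:C * phi z)].

(* The conditions determine [Phi] on [b, +oo): near [b] it is the (unique)
   Koenigs function, and every x >= b is of the form rE^n y with y >= b
   arbitrarily close to [b]. Values of [Phi] left of [b] are irrelevant. *)
Definition koenigs_extension (R : realType) (lam b : R) (Phi : R -> R) : Prop :=
  (exists (V : set R[i]^o) (phi : R[i]^o -> R[i]^o),
     koenigs_function lam b V phi /\
     forall x, b <= x -> V x%:C -> phi x%:C = (Phi x)%:C) /\
  (forall x, b <= x -> Phi (rE lam x) = b * Phi x).

(* If the gauge t^2 g(t) vanishes near 0, the convention [ln 0 = 0] makes this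
   0 where -oo is meant. This is harmless: either way the ratio is not eventually
   above a positive constant, and the Hausdorff measure is then 0. *)
Definition log_ratio (R : realType) (g Phi : R -> R) (t : R) : \bar R :=
  (ln (g t) / ln (Phi t^-1))%:E.

(* Main.v *)
(** E_lam maps a box { x <= Re z <= x + q, |Im z - y| <= th } onto a sector of an
    annulus of inner radius r = |lam| e^x, and only the part of the annulus in the
    right half plane, half of the area, can be sent far to the right again. So
    passing from boxes to the boxes of the next generation inside them divides the
    area by about 2, while the diameters are divided by r; since an escaping orbit
    grows like an orbit of E_lam0, this multiplies Phi (1 / diameter) by beta.

    (a) For beta^s > 2 the boxes can be given gaps and at least r^2 / beta^s
    children each, up to the factor e^(2q). If a cover has a small sum of
    d^2 Phi (1/d)^s, one can choose nested boxes so that the expected number of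
    sets of the cover met by a random descendant stays below 1; the point they
    define escapes and is not covered. Comparing h with such a gauge for s
    slightly above K1 shows that the measure of h is not sigma-finite, hence
    infinite, on the escaping set.

    (b) Points whose orbit stays far to the right are covered at level n by
    sets whose squared diameters add up to O((97/100)^n), and on which
    Phi (1 / diameter) = O(beta^n). This gives measure 0 if
    beta^K2 * 97/100 < 1, and null sets are stable under preimages by E_lam. *)
Require Import Defs.
From mathcomp Require Import all_boot all_order all_algebra.
From mathcomp Require Import all_classical all_reals all_analysis.
From mathcomp Require Import complex ring lra.

Set Implicit Arguments.
Unset Strict Implicit.
Unset Printing Implicit Defensive.

Import Order.TTheory GRing.Theory Num.Theory.
Import numFieldNormedType.Exports.

Local Open Scope classical_set_scope.
Local Open Scope ring_scope.

Local Notation normc := ComplexField.Normc.normc.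

(** * The Koenigs function on the real axis *)

(** No measure is built in (a). A box has finitely many children, so an average of a potential over
    them already yields one good child, and compactness then gives the point. What has to be carried
    along is the scale of each set of the cover: its images grow with the orbit while the gauge
    refers to its original diameter. Hence a quantity T of the order of the original inverse
    diameter is kept fixed during the whole descent. The maps E_lam and E_lam0 are compared only
    through the positions of boxes. Constants such as |lam| against lam0 are absorbed by a change of
    argument, [Phi (x - C0)] in (a) and [Phi (3 * x + b)] in (b), because one application of E_lam0
    beats every polynomial loss in its argument and costs Phi just a factor beta. In (a) the factor
    2 must be nearly attained, which forces thin boxes and small parameters. In (b) any ratio below
    1 will do: the ideal value is near 1/2, and 97/100 is what fixed boxes of width ln (11/10) give
    with crude estimates. *)

Lemma expR_superlinear (R : realType) (K : R) :
  \forall x \near +oo, K * x <= expR x.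
Proof.
near=> x.
have x0 : 0 <= x by near: x; apply: nbhs_pinfty_ge; rewrite num_real.
have xK : 2 * K <= x by near: x; apply: nbhs_pinfty_ge; rewrite num_real.
apply: (le_trans _ (expR_ge1Dxn 1 x0)).
have -> : (2`!%:R = 2 :> R) by [].
nra.
Unshelve. all: by end_near. Qed.

(** The function lam0 e^x - x is negative at 1, which is lam0 < 1/e, and nonnegative far to the
    right. The intermediate value theorem gives a fixed point above 1, and b is at least that
    one. *)
Lemma larger_fixed_point_gt1 (R : realType) (lam0 b : R) :
  0 < lam0 -> lam0 < (expR 1)^-1 -> larger_fixed_point lam0 b -> 1 < b.
Proof.
move=> l0 le [a [ab fixE]].
have f1 : lam0 * expR 1 - 1 < 0.
  by rewrite subr_lt0 -ltr_pdivlMr ?expR_gt0// mul1r.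
have [X [X1 fX]] : exists X : R, 1 <= X /\ 0 <= lam0 * expR X - X.
  have : \forall x \near +oo, 1 <= x /\ 0 <= lam0 * expR x - x.
    near=> x; split; first by near: x; apply: nbhs_pinfty_ge; rewrite num_real.
    rewrite subr_ge0 mulrC -ler_pdivrMr// mulrC.
    by near: x; exact: expR_superlinear.
  by move=> /filter_ex.
have cf : {within `[1, X], continuous (fun x => lam0 * expR x - x)}.
  apply: continuous_subspaceT => x.
  apply: cvgB; last exact: cvg_id.
  by apply: cvgM; [exact: cvg_cst | exact: continuous_expR].
have [|c] := IVT X1 cf (v := 0).
  by rewrite ge_min le_max (ltW f1) fX orbT.
rewrite in_itv/= => /andP[c1 _] /eqP; rewrite subr_eq0 => /eqP /fixE c_ab.
have {}c1 : 1 < c.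
  rewrite lt_neqAle c1 andbT; apply/eqP => c1E.
  by move/fixE: c_ab; rewrite -c1E /rE => /eqP; rewrite -subr_eq0 lt_eqF.
by case: c_ab => [ca|<-//]; apply: lt_trans ab; rewrite -ca.
Unshelve. all: by end_near. Qed.

(** Convexity: the graph lies above its tangent at b, of slope b. So E_lam0 expands distances to b
    by at least b on the whole half line, not only near b. *)
Lemma rE_fixed_ge (R : realType) (lam0 b x : R) :
  rE lam0 b = b -> 1 < b -> b <= x -> b * (x - b) <= rE lam0 x - b.
Proof.
move=> fixb b1 bx.
have -> : rE lam0 x = b * expR (x - b).
  by rewrite -{1}fixb /rE -mulrA -expRD addrC subrK.
have := expR_ge1Dx (x - b); nra.
Qed.

(** The derivative of phi at b is 1; reading its difference quotients along real increments gives
    the two bounds. *)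
Lemma koenigs_asymptotic (R : realType) (lam0 b : R) (Phi : R -> R) (e : R) :
  koenigs_extension lam0 b Phi -> 0 < e ->
  exists2 d, 0 < d & forall y, b < y -> y < b + d ->
    (1 - e) * (y - b) <= Phi y <= (1 + e) * (y - b).
Proof.
move=> [[V [phi [[oV Vb dphi [phib dphib] _] PhiE]]] _] e0.
have := dphi _ Vb; rewrite /derivable -/(derive phi b%:C%C 1) => /cvg_ex[l hl].
have lE : l = 1.
  rewrite -dphib derive1E /derive; exact/esym/cvg_lim.
rewrite {}lE in hl.
have ec : (0 : R[i]^o) < (e%:C)%C by rewrite ltcR.
move/cvgrPdist_le : hl => /(_ _ ec).
rewrite /dnbhs /= => -[/= d' d'0 hd].
have := oV; rewrite openE => /(_ _ Vb) [/= r' r'0 hr].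
(* The radii of complex neighbourhoods are positive elements of [R[i]], hence real numbers. *)
have [d d0 dE] : exists2 d, 0 < d & (d%:C)%C <= d'.
  case: d' d'0 {hd} => p q; rewrite ltcE/= => /andP[/eqP -> p0].
  by exists p.
have [r r0 rE_] : exists2 r, 0 < r & (r%:C)%C <= r'.
  case: r' r'0 {hr} => p q; rewrite ltcE/= => /andP[/eqP -> p0].
  by exists p.
have normC (t : R) : 0 <= t -> `|t%:C%C : R[i]| = (t%:C)%C.
  by move=> t0; rewrite ger0_norm// ler0c.
exists (Num.min d r); first by rewrite lt_min d0.
move=> y bY; rewrite -ltrBlDl lt_min => /andP[yd yr].
have yb0 : 0 < y - b by rewrite subr_gt0.
have Vy : V (y%:C)%C.
  apply: hr; rewrite /ball_/= -raddfB/= -opprB raddfN/= normrN normC ?ltW//.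
  by apply: lt_le_trans rE_; rewrite ltcR.
have Pb : Phi b = 0.
  by have := PhiE _ (lexx b) Vb; rewrite phib => -[].
have yd' : (`|0 - ((y - b)%:C)%C : R[i]| < d').
  rewrite sub0r normrN normC ?ltW//.
  by apply: lt_le_trans dE; rewrite ltcR.
have ybn0 : ((y - b)%:C)%C != 0 :> R[i].
  by rewrite eq_complex/= eqxx andbT gt_eqF.
have := hd _ yd' ybn0; rewrite /=.
have -> : ((y - b)%:C%C *: (1 : R[i]^o) + b%:C%C = (y%:C)%C).
  by rewrite /GRing.scale/= mulr1 -raddfD/= subrK.
rewrite phib subr0 PhiE ?(ltW bY)//.
have -> : (((y - b)%:C)%C^-1 *: ((Phi y)%:C%C : R[i]^o)) = ((Phi y / (y - b))%:C)%C.
  by rewrite /GRing.scale/= rmorphM/= fmorphV mulrC.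
have -> : 1 - ((Phi y / (y - b))%:C)%C = ((1 - Phi y / (y - b))%:C)%C :> R[i]^o.
  by rewrite raddfB.
rewrite (_ : `| _ | = ((`|1 - Phi y / (y - b)|)%:C)%C); last first.
  by rewrite normc_def/= expr0n/= addr0 sqrtr_sqr.
rewrite lecR ler_norml => /andP[].
set u := Phi y / (y - b).
have -> : Phi y = u * (y - b) by rewrite /u divfK// gt_eqF.
by move=> h1 h2; apply/andP; split; rewrite ler_pM2r//; lra.
Qed.

Section KoenigsExtension.
Variables (R : realType) (lam0 b : R) (Phi : R -> R).
Hypotheses (lam0_gt0 : 0 < lam0) (b_gt1 : 1 < b) (fixb : rE lam0 b = b).
Hypothesis PhiK : koenigs_extension lam0 b Phi.

Let rEi (x : R) := ln (x / lam0).

Let rEiK x : 0 < x -> rE lam0 (rEi x) = x.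
Proof.
by move=> x0; rewrite /rE lnK ?posrE ?divr_gt0// mulrC divfK// gt_eqF.
Qed.

Let rEi_le x y : 0 < x -> x <= y -> rEi x <= rEi y.
Proof.
move=> x0 xy; have y0 := lt_le_trans x0 xy.
by rewrite ler_ln ?posrE ?divr_gt0// ler_pM2r// invr_gt0.
Qed.

Let rEi_gt x : b < x -> b < rEi x.
Proof.
move=> bx; have b0 : 0 < b by move: b_gt1; lra.
have bE : b = rEi b.
  by rewrite /rEi -{2}fixb /rE mulrAC divff ?gt_eqF// mul1r expRK.
rewrite {1}bE ltr_ln ?posrE ?divr_gt0//; last (move: b_gt1; lra).
by rewrite ltr_pM2r// invr_gt0.
Qed.

Lemma rE_ge x : b <= x -> b <= rE lam0 x.
Proof.
move=> bx; rewrite -subr_ge0; apply: le_trans (rE_fixed_ge fixb b_gt1 bx).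
by rewrite mulr_ge0//; move: b_gt1; lra.
Qed.

Lemma iter_rE_ge n x : b <= x -> b <= iter n (rE lam0) x.
Proof. by move=> bx; elim: n => //= n; exact: rE_ge. Qed.

Lemma koenigs_iter n x :
  b <= x -> Phi (iter n (rE lam0) x) = b ^+ n * Phi x.
Proof.
move=> bx; elim: n => [|n ih]; first by rewrite mul1r.
by rewrite iterS PhiK.2 ?iter_rE_ge// ih exprS mulrA.
Qed.

Let iter_gt n x : b < x -> b < iter n rEi x.
Proof. by move=> bx; elim: n => //= n; exact: rEi_gt. Qed.

Let iter_le n x y : b < x -> x <= y -> iter n rEi x <= iter n rEi y.
Proof.
move=> bx xy; elim: n => //= n; apply: rEi_le.
by have := iter_gt n bx; move: b_gt1; lra.
Qed.

Let iterK n x : b < x -> iter n (rE lam0) (iter n rEi x) = x.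
Proof.
move=> bx; elim: n => //= n ih; rewrite -iterS iterSr rEiK//.
by have := iter_gt n bx; move: b_gt1; lra.
Qed.

Let iter_near x (d : R) : b < x -> 0 < d ->
  exists N, forall n, (N <= n)%N -> iter n rEi x < b + d.
Proof.
move=> bx d0.
(* Each application of the inverse branch divides the distance to b by at least b > 1. *)
have geo n : b ^+ n * (iter n rEi x - b) <= x - b.
  elim: n => [|n]; first by rewrite mul1r.
  apply: le_trans; rewrite exprSr -mulrA ler_pM2l ?exprn_gt0//; last (move: b_gt1; lra).
  rewrite iterS; apply: le_trans (rE_fixed_ge fixb b_gt1 _) _.
    by rewrite ltW// rEi_gt// iter_gt.
  by rewrite rEiK//; have := iter_gt n bx; move: b_gt1; lra.
have cv : (x - b) * b^-1 ^+ n @[n --> \oo] --> 0.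
  rewrite -[X in _ --> X](mulr0 (x - b)).
  apply: cvgM; first exact: cvg_cst.
  by apply: cvg_expr; rewrite ger0_norm ?invr_ge0 ?invf_lt1//; move: b_gt1; lra.
move/cvgrPdist_lt : cv => /(_ _ d0)[N _ hN].
exists N => n /hN /=; rewrite sub0r normrN ger0_norm; last first.
  by rewrite mulr_ge0 ?exprn_ge0 ?invr_ge0//; move: b_gt1; lra.
rewrite exprVn ltr_pdivrMr ?exprn_gt0//; last (move: b_gt1; lra).
move=> h; rewrite -ltrBlDl -(ltr_pM2l (x := b ^+ n)) ?exprn_gt0//; last (move: b_gt1; lra).
by rewrite [ltRHS]mulrC; exact: le_lt_trans h.
Qed.

Lemma koenigs_fixed_point : Phi b = 0.
Proof. by have := PhiK.2 b (lexx _); rewrite fixb; move: b_gt1; nra. Qed.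

(** Pulled back close to b, Phi is at least half the distance to b; the functional equation carries
    positivity forward. *)
Lemma koenigs_gt0 x : b < x -> 0 < Phi x.
Proof.
move=> bx; have h0 : 0 < 2^-1 :> R by move: b_gt1; lra.
have [d d0 hd] := koenigs_asymptotic PhiK h0.
have [N hN] := iter_near bx d0.
have /andP[h2 _] := hd _ (iter_gt N bx) (hN _ (leqnn _)).
have h1 := iter_gt N bx; rewrite -(iterK N bx) koenigs_iter; last exact: ltW.
apply: mulr_gt0; first by apply: exprn_gt0; move: b_gt1; lra.
by apply: lt_le_trans h2; apply: mulr_gt0; lra.
Qed.

Lemma koenigs_ge0 x : b <= x -> 0 <= Phi x.
Proof.
by rewrite le_eqVlt => /orP[/eqP<-|/koenigs_gt0/ltW//]; rewrite koenigs_fixed_point.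
Qed.

(* Pulling x <= y back towards b, the ratio Phi x / Phi y becomes that of the
   distances to b up to a factor close to 1; continuity of Phi' is not needed. *)
Lemma koenigs_le x y : b <= x -> x <= y -> Phi x <= Phi y.
Proof.
rewrite le_eqVlt => /orP[/eqP<- by_|bx xy].
  by rewrite koenigs_fixed_point koenigs_ge0.
have by_ : b < y by apply: lt_le_trans xy.
have py := koenigs_gt0 by_; have px := koenigs_gt0 bx.
have key e : 0 < e -> e < 1 -> (1 - e) * Phi x <= (1 + e) * Phi y.
  move=> e0 e1; have [d d0 hd] := koenigs_asymptotic PhiK e0.
  have [N hN] := iter_near by_ d0.
  have yd := hN _ (leqnn N); have xd := le_lt_trans (iter_le N bx xy) yd.
  have /andP[_ h1] := hd _ (iter_gt N bx) xd.
  have /andP[h2 _] := hd _ (iter_gt N by_) yd.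
  have h3 := iter_le N bx xy.
  rewrite -(iterK N bx) -(iterK N by_) !koenigs_iter; try by apply/ltW/iter_gt.
  rewrite (mulrCA (1 - e)) (mulrCA (1 + e)) ler_pM2l; last first.
    by apply: exprn_gt0; move: b_gt1; lra.
  have e1' : 0 < 1 - e by lra.
  have e2' : 0 < 1 + e by lra.
  apply: (@le_trans _ _ ((1 - e) * ((1 + e) * (iter N rEi x - b)))).
    by rewrite ler_pM2l.
  apply: (@le_trans _ _ ((1 + e) * ((1 - e) * (iter N rEi y - b)))).
    by rewrite mulrCA ler_pM2l// ler_pM2l// lerD2r.
  by rewrite ler_pM2l.
rewrite leNgt; apply/negP => yx.
(* With e = u, [key] says that Phi x - Phi y is at most u (Phi x + Phi y), which is half of
   itself. *)
pose u := (Phi x - Phi y) / (Phi x + Phi y) / 2.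
have s0 : 0 < Phi x + Phi y by lra.
have d0 : 0 < Phi x - Phi y by lra.
have u0 : 0 < u by rewrite !divr_gt0.
have uE : u * (Phi x + Phi y) * 2 = Phi x - Phi y.
  by rewrite /u; field; rewrite gt_eqF.
have u1 : u < 1.
  rewrite ltr_pdivrMr//; rewrite ltr_pdivrMr; lra.
by have := key u u0 u1; lra.
Qed.

(** Along the orbit of b + 1 the values grow geometrically; monotonicity covers the points in
    between. *)
Lemma koenigs_cvgy A : \forall x \near +oo, A <= Phi x.
Proof.
pose x0 := b + 1; have bx0 : b < x0 by rewrite /x0; move: b_gt1; lra.
have p0 := koenigs_gt0 bx0.
have [N hN] : exists N, A <= b ^+ N * Phi x0.
  have bern n : n%:R * (b - 1) <= b ^+ n.
    elim: n => [|n ih]; first by rewrite mul0r.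
    have : 1 <= b ^+ n by rewrite exprn_ege1// ltW.
    by rewrite exprS -natr1; move: b_gt1; nra.
  exists (Num.truncn (A / Phi x0 / (b - 1))).+1.
  rewrite -ler_pdivrMr//; apply: le_trans (bern _).
  by rewrite -ler_pdivrMr ?subr_gt0// ltW// truncnS_gt.
near=> x; apply: (le_trans hN); rewrite -koenigs_iter; last exact: ltW.
apply: koenigs_le; first by apply: iter_rE_ge; exact: ltW.
by near: x; apply: nbhs_pinfty_ge; rewrite num_real.
Unshelve. all: by end_near. Qed.

End KoenigsExtension.

(** * The complex exponential *)

Section Sine.
Variable R : realType.
Implicit Types a b t : R.

(** Mean value theorem, with cos decreasing on [0, pi]. Read backwards, it also gives the chord
    bounds for asin. *)
Lemma sin_chord a b : 0 <= a -> a <= b -> b <= pi ->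
  (b - a) * cos b <= sin b - sin a <= (b - a) * cos a.
Proof.
move=> a0 ab bpi.
have [c] := @MVT_segment R sin cos a b ab
  (fun x _ => is_derive_sin x) (continuous_subspaceT (@continuous_sin R)).
rewrite in_itv/= => /andP[ac cb] ->; rewrite ![(b - a) * _]mulrC.
have mono (u v : R) : 0 <= u -> u <= v -> v <= pi -> cos v <= cos u :> R.
  move=> u0 uv vpi; rewrite leNgt ltr_cos -?leNgt// in_itv/=; lra.
have ba : 0 <= b - a by rewrite subr_ge0.
apply/andP; split; rewrite ler_wpM2r//; apply: mono => //; lra.
Qed.

Lemma sin_le_id t : 0 <= t -> t <= pi -> sin t <= t.
Proof.
by move=> t0 tpi; have := sin_chord (lexx 0) t0 tpi; rewrite sin0 cos0; lra.
Qed.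

Lemma norm_sin_le t : `|sin t| <= `|t|.
Proof.
have h (u : R) : 0 <= u -> `|sin u| <= u.
  move=> u0; have [upi|pu] := lerP u pi.
    by rewrite ger0_norm; [exact: (sin_le_id u0)|rewrite sin_ge0_pi// u0].
  by apply: le_trans (sin_max _) _; have := pi_ge2 R; lra.
have [t0|t0] := lerP 0 t; first by rewrite (ger0_norm t0) h.
by rewrite -normrN -sinN (ltr0_norm t0) h//; lra.
Qed.

(** sin t = 2 sin (t/2) cos (t/2) >= t cos^2 (t/2) = t (1 + cos t) / 2, and cos t >= 0. *)
Lemma sin_ge_half t : 0 <= t -> t <= pi / 2 -> t / 2 <= sin t.
Proof.
move=> t0 tpi.
have /andP[h _] := @sin_chord 0 (t / 2) (lexx 0)
  (ltac:(lra)) (ltac:(have := pi_ge2 R; lra)).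
have ct : 0 <= cos t by apply: cos_ge0_pihalf; have := pi_ge2 R; lra.
have c2 : 0 <= cos (t / 2) by apply: cos_ge0_pihalf; have := pi_ge2 R; lra.
have -> : t = (t / 2) *+ 2 by lra.
rewrite sin_mulr2n.
have : cos t = cos (t / 2) ^+2 *+ 2 - 1.
  by rewrite -cos_mulr2n; congr cos; lra.
move: h; rewrite sin0 !subr0; nra.
Qed.

Lemma cos_ge_1B t : 0 <= t -> 1 - t <= cos t.
Proof.
move=> t0; have [t2|t2] := lerP t 2; last by have := cos_geN1 t; lra.
have -> : cos t = 1 - 2 * sin (t / 2) ^+ 2.
  rewrite [in LHS](_ : t = (t / 2) *+ 2); last by lra.
  by rewrite cos_mulr2n cos2sin2; ring.
have : `|sin (t / 2)| <= t / 2.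
  by apply: le_trans (norm_sin_le _) _; rewrite ger0_norm//; lra.
rewrite ler_norml => /andP[]; nra.
Qed.

(** The smallness assumption is on sin t because distances between images are what is known later.
    [sin_ge_half] turns it into t <= e / (1 + e), and then sin t >= t cos t >= t (1 - t) >= t / (1 +
    e). *)
Lemma sin_ge_near0 e t : 0 < e -> 0 <= t -> t <= pi / 2 ->
  2 * sin t <= e / (1 + e) -> t <= (1 + e) * sin t.
Proof.
move=> e0 t0 tpi st.
have h1 := sin_ge_half t0 tpi.
have ee : e / (1 + e) * (1 + e) = e by rewrite divfK//; lra.
have te : t * (1 + e) <= e by rewrite -[leRHS]ee ler_wpM2r//; lra.
have /andP[h _] := @sin_chord 0 t (lexx 0) t0
  (ltac:(have := pi_ge2 R; lra)).
have := cos_ge_1B t0; move: h; rewrite sin0 !subr0 => h hc.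
have c1 : 1 <= (1 + e) * cos t by nra.
apply: (@le_trans _ _ ((1 + e) * (t * cos t))); first nra.
by rewrite ler_wpM2l//; lra.
Qed.

End Sine.

Section ComplexExp.
Variable R : realType.
Implicit Types (z u v lam : R[i]) (a b X : R).

Lemma normc_ge0 z : 0 <= normc z.
Proof. by case: z => a b; rewrite sqrtr_ge0. Qed.

Lemma sqr_normcE z : normc z ^+ 2 =
  complex.Re z ^+ 2 + complex.Im z ^+ 2.
Proof. by case: z => a b; rewrite /= sqr_sqrtr// addr_ge0// sqr_ge0. Qed.

Lemma normc_Re z : `|complex.Re z| <= normc z.
Proof.
rewrite -ler_sqr ?nnegrE ?normc_ge0// sqr_normcE real_normK ?num_real//.
by rewrite lerDl sqr_ge0.
Qed.

Lemma normc_Im z : `|complex.Im z| <= normc z.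
Proof.
rewrite -ler_sqr ?nnegrE ?normc_ge0// sqr_normcE real_normK ?num_real//.
by rewrite lerDr sqr_ge0.
Qed.

Lemma normc_gt0 z : z != 0 -> 0 < normc z.
Proof.
move=> z0; rewrite lt_neqAle normc_ge0 andbT eq_sym; apply/eqP.
by move/ComplexField.Normc.eq0_normc => zE; rewrite zE eqxx in z0.
Qed.

(** The argument is normalised to [-2 pi, 0] so that both values of [row_offset] lie in
    [0, 2 pi]. *)
Lemma polar_decomposition lam : lam != 0 -> exists al : R,
  [/\ - (pi *+ 2) <= al, al <= 0,
     complex.Re lam = normc lam * cos al &
     complex.Im lam = normc lam * sin al].
Proof.
move=> /normc_gt0; set L := normc lam => L0.
pose c := complex.Re lam / L; pose s := complex.Im lam / L.
have cE_ : complex.Re lam = L * c by rewrite /c mulrC divfK// gt_eqF.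
have sE_ : complex.Im lam = L * s by rewrite /s mulrC divfK// gt_eqF.
have cs : c ^+ 2 + s ^+ 2 = 1.
  by rewrite !expr_div_n -mulrDl -sqr_normcE divff// sqrf_eq0 gt_eqF.
have c1 : -1 <= c <= 1.
  by rewrite -ler_norml -(@expr_le1 _ 2)// real_normK ?num_real// -cs lerDl sqr_ge0.
have ac0 := acos_ge0 c1; have acpi := acos_lepi c1.
have ci : c \in `[(-1), 1] by rewrite in_itv.
have sE2 : 1 - c ^+ 2 = s ^+ 2 by rewrite -cs; ring.
rewrite cE_ sE_; have [s0|s0] := lerP s 0.
  exists (- acos c); split; rewrite ?cosN ?sinN ?acosK ?sin_acos//; try lra.
  by rewrite sE2 sqrtr_sqr ler0_norm// opprK.
exists (acos c - pi *+ 2); split; try lra.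
  by rewrite -[in RHS](cosD2pi (acos c - _)) subrK acosK.
rewrite -[in RHS](sinD2pi (acos c - _)) subrK sin_acos//.
by rewrite sE2 sqrtr_sqr gtr0_norm.
Qed.

Section Polar.
Variables (lam : R[i]) (al : R).
Hypothesis Re_lam : complex.Re lam = normc lam * cos al.
Hypothesis Im_lam : complex.Im lam = normc lam * sin al.
Let L := normc lam.

Lemma Re_cE z : complex.Re (cE lam z) =
  L * expR (complex.Re z) * cos (complex.Im z + al).
Proof.
rewrite cosD; have -> : complex.Re (cE lam z) =
    complex.Re lam * complex.Re (cexp z) - complex.Im lam * complex.Im (cexp z).
  by rewrite /cE; case: lam (cexp z) => a b [].
by rewrite Re_lam Im_lam -/L /cexp/=; ring.
Qed.

Lemma Im_cE z : complex.Im (cE lam z) =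
  L * expR (complex.Re z) * sin (complex.Im z + al).
Proof.
rewrite sinD; have -> : complex.Im (cE lam z) =
    complex.Re lam * complex.Im (cexp z) + complex.Im lam * complex.Re (cexp z).
  by rewrite /cE; case: lam (cexp z) => a b [].
by rewrite Re_lam Im_lam -/L /cexp/=; ring.
Qed.

End Polar.

Lemma normc_cE lam z : normc (cE lam z) =
  normc lam * expR (complex.Re z).
Proof.
rewrite /cE ComplexField.Normc.normcM; congr (_ * _).
rewrite /cexp ComplexField.Normc.normcM /= cos2Dsin2 sqrtr1 mulr1.
by rewrite expr0n/= addr0 sqrtr_sqr ger0_norm// expR_ge0.
Qed.

(** Law of cosines, with the radial and the angular part separated: the upper and the lower distance
    estimates then both follow termwise. *)
Lemma sqr_normc_cEB lam u v :
  normc (cE lam u - cE lam v) ^+ 2 =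
  normc lam ^+ 2 *
  ((expR (complex.Re u) - expR (complex.Re v)) ^+ 2 +
   4 * (expR (complex.Re u) * expR (complex.Re v)) *
     sin ((complex.Im u - complex.Im v) / 2) ^+ 2).
Proof.
rewrite /cE -mulrBr ComplexField.Normc.normcM exprMn; congr (_ * _).
rewrite sqr_normcE; case: u => a b; case: v => c d /=.
set A := expR a; set C := expR c.
have h : 2 * sin ((b - d) / 2) ^+ 2 = 1 - (cos b * cos d + sin b * sin d).
  rewrite -cosB [in RHS](_ : b - d = ((b - d) / 2) *+ 2); last first.
    by lra.
  by rewrite cos_mulr2n sin2cos2; ring.
rewrite (_ : 4 * (A * C) * sin ((b - d) / 2) ^+ 2 =
  2 * A * C * (2 * sin ((b - d) / 2) ^+ 2)); last by ring.
rewrite h.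
have hb := cos2Dsin2 b; have hd := cos2Dsin2 d.
transitivity (A ^+ 2 * (cos b ^+ 2 + sin b ^+ 2) +
  C ^+ 2 * (cos d ^+ 2 + sin d ^+ 2) - 2 * A * C * (cos b * cos d + sin b * sin d)).
  by ring.
by rewrite hb hd; ring.
Qed.

Lemma expR_dist_le a b X : a <= X -> b <= X ->
  `|expR a - expR b| <= expR X * `|a - b|.
Proof.
wlog ab : a b / a <= b => [H aX bX|].
  have [ab|ba] := orP (le_total a b); first exact: H.
  by rewrite distrC (distrC a); exact: H.
move=> aX bX; rewrite !ler0_norm ?subr_le0 ?ler_expR// !opprB.
have -> : expR b - expR a = expR b * (1 - expR (a - b)).
  by rewrite mulrBr mulr1 -expRD (addrC b) subrK.
have h := expR_ge1Dx (a - b); have hX : expR b <= expR X by rewrite ler_expR.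
have := expR_gt0 b; nra.
Qed.

Lemma expR_dist_ge a b X : X <= a -> X <= b ->
  expR X * `|a - b| <= `|expR a - expR b|.
Proof.
wlog ab : a b / a <= b => [H aX bX|].
  have [ab|ba] := orP (le_total a b); first exact: H.
  by rewrite distrC [leRHS]distrC; exact: H.
move=> aX bX; rewrite !ler0_norm ?subr_le0 ?ler_expR// !opprB.
have -> : expR b = expR a * expR (b - a).
  by rewrite -expRD (addrC a) subrK.
have h := expR_ge1Dx (b - a); have hX : expR X <= expR a by rewrite ler_expR.
have := expR_gt0 X; nra.
Qed.

Lemma cE_dist_le lam u v X : complex.Re u <= X -> complex.Re v <= X ->
  normc (cE lam u - cE lam v) <=
  normc lam * expR X * normc (u - v).
Proof.
move=> uX vX; rewrite -ler_sqr ?nnegrE ?normc_ge0 ?mulr_ge0 ?normc_ge0 ?expR_ge0//.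
rewrite sqr_normc_cEB !exprMn -[leRHS]mulrA ler_wpM2l ?sqr_ge0// sqr_normcE.
have -> : complex.Re (u - v) = complex.Re u - complex.Re v by rewrite raddfB.
have -> : complex.Im (u - v) = complex.Im u - complex.Im v by rewrite raddfB.
rewrite mulrDr lerD//.
  rewrite -exprMn -[leLHS]real_normK ?num_real// -[leRHS]real_normK ?num_real// ler_sqr ?nnegrE//.
  by rewrite normrM (ger0_norm (expR_ge0 _)) expR_dist_le.
set t := complex.Im u - complex.Im v.
have h : 4 * sin (t / 2) ^+ 2 <= t ^+ 2.
  have : sin (t / 2) ^+ 2 <= (t / 2) ^+ 2.
    rewrite -[leLHS]real_normK ?num_real// -[leRHS]real_normK ?num_real//.
    by rewrite ler_sqr ?nnegrE// norm_sin_le.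
  by rewrite expr_div_n; lra.
rewrite mulrAC mulrC ler_pM//.
  by apply: mulr_ge0 => //; exact: sqr_ge0.
by rewrite expr2 ler_pM ?expR_ge0// ler_expR.
Qed.

Lemma cE_dist_ge lam u v X : X <= complex.Re u -> X <= complex.Re v ->
  (normc lam * expR X) ^+ 2 *
  ((complex.Re u - complex.Re v) ^+ 2 +
   (2 * sin (`|complex.Im u - complex.Im v| / 2)) ^+ 2)
  <= normc (cE lam u - cE lam v) ^+ 2.
Proof.
move=> uX vX; rewrite sqr_normc_cEB exprMn -[leLHS]mulrA ler_wpM2l ?sqr_ge0//.
rewrite mulrDr lerD//.
  rewrite -exprMn -[leLHS]real_normK ?num_real// -[leRHS]real_normK ?num_real// ler_sqr ?nnegrE//.
  by rewrite normrM (ger0_norm (expR_ge0 _)) expR_dist_ge.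
set t := complex.Im u - complex.Im v.
have -> : (2 * sin (`|t| / 2)) ^+ 2 = (2 * sin (t / 2)) ^+ 2.
  have [t0|t0] := leP 0 t; first by rewrite ger0_norm.
  by rewrite ltr0_norm// mulNr sinN mulrN sqrrN.
rewrite (_ : (2 * sin (t / 2)) ^+ 2 = 4 * sin (t / 2) ^+ 2); last by ring.
rewrite [leLHS]mulrA ler_wpM2r ?sqr_ge0// [leLHS]mulrC ler_wpM2l//.
by rewrite expr2 ler_pM ?expR_ge0// ler_expR.
Qed.

End ComplexExp.

(** * Boxes and their images *)

Section Boxes.
Variable R : realType.
Implicit Types (x y q th al : R) (z w lam : R[i]) (B : R * R).

(* [B.2] is meant to satisfy [cos (B.2 + al) = 1], where al is an argument of
   lam: then cE lam maps the box onto a sector of an annulus around 0, symmetric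
   with respect to the positive real axis. *)
Definition box q th B : set R[i] :=
  [set z | B.1 <= complex.Re z <= B.1 + q /\ `|complex.Im z - B.2| <= th].

Lemma cos_eq1_dist t : cos t = 1 -> t != 0 -> 2 * pi <= `|t| :> R.
Proof.
rewrite -cos_norm -normr_gt0; set u := `|t| => cu u0; rewrite leNgt.
apply/negP => u2.
have : 0 < sin (u / 2) by apply: sin_gt0_pi; lra.
suff : sin (u / 2) ^+ 2 = 0 by move/eqP; rewrite sqrf_eq0 => /eqP->; rewrite ltxx.
have : cos u = 1 - 2 * sin (u / 2) ^+ 2.
  rewrite [in LHS](_ : u = (u / 2) *+ 2); last by lra.
  by rewrite cos_mulr2n cos2sin2; ring.
by rewrite cu; lra.
Qed.

Lemma cos_eq1_sin t : cos t = 1 -> sin t = 0 :> R.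
Proof. by move=> ct; apply: cos1sin0; rewrite ct normr1. Qed.

Lemma cos_row al y t : cos (y + al) = 1 -> cos (t + al) = cos (t - y).
Proof.
move=> h; have -> : t + al = t - y + (y + al) by ring.
by rewrite cosD h (cos_eq1_sin h); ring.
Qed.

Lemma sin_row al y t : cos (y + al) = 1 -> sin (t + al) = sin (t - y).
Proof.
move=> h; have -> : t + al = t - y + (y + al) by ring.
by rewrite sinD h (cos_eq1_sin h); ring.
Qed.

Lemma row_dist al y1 y2 : cos (y1 + al) = 1 -> cos (y2 + al) = 1 ->
  y1 != y2 -> 2 * pi <= `|y1 - y2|.
Proof.
by move=> h1 h2 ne; apply: cos_eq1_dist; rewrite -?(cos_row _ h2)// subr_eq0.
Qed.

Section Sector.
Variables (lam : R[i]) (al q th : R).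
Hypothesis lam_neq0 : lam != 0.
Hypothesis Re_lam : complex.Re lam = normc lam * cos al.
Hypothesis Im_lam : complex.Im lam = normc lam * sin al.
Hypotheses (th_gt0 : 0 < th) (th_lt : th < pi / 2).

(** The preimage is ln (|w| / |lam|) + i (B.2 + psi) with psi = asin (Im w / |w|), which is the
    argument of w because Re w > 0. *)
Lemma cE_box_onto B w : cos (B.2 + al) = 1 ->
  0 < complex.Re w -> `|complex.Im w| * cos th <= complex.Re w * sin th ->
  normc lam * expR B.1 <= normc w <= normc lam * expR (B.1 + q) ->
  exists2 z, box q th B z & cE lam z = w.
Proof.
move=> row; case: w => u v; set r := normc (Complex u v) => u0 uv rb.
rewrite /= in u0 uv.
have L0 := normc_gt0 lam_neq0.
have r0 : 0 < r by have /andP[rb1 _] := rb; apply: lt_le_trans rb1; rewrite mulr_gt0 ?expR_gt0.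
have rE_ : r ^+ 2 = u ^+ 2 + v ^+ 2 by rewrite sqr_normcE.
have vr : -1 <= v / r <= 1.
  rewrite ler_pdivlMr// ler_pdivrMr//; apply/andP; split; nra.
have svr : sin (asin (v / r)) = v / r by rewrite asinK// in_itv.
have cvr : cos (asin (v / r)) = u / r.
  rewrite cos_asin// (_ : 1 - (v / r) ^+ 2 = (u / r) ^+ 2); last first.
    have -> : 1 = r ^+ 2 / r ^+ 2 :> R by rewrite divff// sqrf_eq0 gt_eqF.
    by rewrite !expr_div_n -mulrBl rE_; congr (_ / _); ring.
  by rewrite sqrtr_sqr ger0_norm// divr_ge0 ?ltW.
set psi := asin (v / r) in svr cvr.
have p1 : - (pi / 2) <= psi by exact: asin_geNpi2.
have p2 : psi <= pi / 2 by exact: asin_lepi2.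
have ru : r * cos psi = u by rewrite cvr mulrC divfK// gt_eqF.
have rv : r * sin psi = v by rewrite svr mulrC divfK// gt_eqF.
have st : 0 < sin th by apply: sin_gt0_pihalf; rewrite th_gt0.
have ct : 0 < cos th by apply: cos_gt0_pihalf; move: th_gt0 th_lt; lra.
have pth : `|psi| <= th.
  (* The sector condition on w reads sin |psi| cos th <= cos |psi| sin th, that is sin (|psi| - th)
     <= 0. *)
  have key t : 0 <= t -> t <= pi / 2 -> sin t * cos th <= cos t * sin th -> t <= th.
    move=> t0 t2 h; rewrite leNgt; apply/negP => tht.
    have : 0 < sin (t - th) by apply: sin_gt0_pihalf; move: th_gt0; lra.
    by rewrite sinB; lra.
  apply: key; first exact: normr_ge0.
    by rewrite ler_norml p1.
  have -> : cos `|psi| = cos psi by rewrite cos_norm.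
  have -> : sin `|psi| = `|sin psi|.
    have [p0|p0] := leP 0 psi.
      by rewrite !ger0_norm// sin_ge0_pi//; move: p2; have := pi_ge2 R; lra.
    rewrite (ltr0_norm p0) sinN ltr0_norm//.
    by rewrite -oppr_gt0 -sinN sin_gt0_pi//; move: p1; have := pi_ge2 R; lra.
  rewrite -(ler_pM2l r0) !mulrA ru.
  by rewrite -{1}(gtr0_norm r0) -normrM rv.
exists (Complex (ln (r / normc lam)) (B.2 + psi)).
  split => /=; last by rewrite addrC addKr.
  have le1 t : (t <= ln (r / normc lam)) = (normc lam * expR t <= r).
    rewrite -ler_expR lnK ?posrE ?divr_gt0//.
    by rewrite ler_pdivlMr// mulrC.
  have le2 t : (ln (r / normc lam) <= t) = (r <= normc lam * expR t).
    rewrite -ler_expR lnK ?posrE ?divr_gt0//.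
    by rewrite ler_pdivrMr// mulrC.
  by rewrite le1 le2.
apply/eqP; rewrite eq_complex (Re_cE Re_lam Im_lam) (Im_cE Re_lam Im_lam)/=.
rewrite (cos_row _ row) (sin_row _ row) addrC addKr lnK ?posrE ?divr_gt0//.
have -> : normc lam * (r / normc lam) = r by field; rewrite gt_eqF.
by rewrite ru rv !eqxx.
Qed.

Lemma box_chain_pullback (B : nat -> R * R) n w :
  (forall k, box q th (B k.+1) `<=` cE lam @` box q th (B k)) ->
  box q th (B n) w ->
  exists2 z, iter n (cE lam) z = w &
    forall k, (k <= n)%N -> box q th (B k) (iter k (cE lam) z).
Proof.
move=> hB; elim: n w => [|n ih] w Bw.
  by exists w => // k; rewrite leqn0 => /eqP->.
have [v Bv vw] := hB _ _ Bw; have [z zv hz] := ih _ Bv.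
exists z; first by rewrite iterS zv.
move=> k; rewrite leq_eqVlt => /orP[/eqP->|]; last by rewrite ltnS; exact: hz.
by rewrite iterS zv vw.
Qed.

Lemma continuous_iter_cE n :
  continuous (fun p : R * R => complex.Re (iter n (cE lam) (Complex p.1 p.2))) /\
  continuous (fun p : R * R => complex.Im (iter n (cE lam) (Complex p.1 p.2))).
Proof.
elim: n => [|n [ihR ihI]]; first by split => p; [exact: cvg_fst|exact: cvg_snd].
have cst (c : R) (f : R * R -> R) : continuous f -> continuous (fun p => c * f p).
  by move=> cf p; apply: cvgM; [exact: cvg_cst|exact: cf].
have cL : continuous (fun p : R * R =>
    normc lam * expR (complex.Re (iter n (cE lam) (Complex p.1 p.2)))).
  apply: cst => p; apply: (continuous_comp (ihR p)); exact: continuous_expR.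
have cA : continuous (fun p : R * R => complex.Im (iter n (cE lam) (Complex p.1 p.2)) + al).
  by move=> p; apply: cvgD; [exact: ihI|exact: cvg_cst].
split => p /=.
  under eq_fun do rewrite (Re_cE Re_lam Im_lam).
  apply: cvgM; first exact: cL.
  exact: (continuous_comp (cA p) (@continuous_cos _ _)).
under eq_fun do rewrite (Im_cE Re_lam Im_lam).
apply: cvgM; first exact: cL.
exact: (continuous_comp (cA p) (@continuous_sin _ _)).
Qed.

(** Finite chains are pulled back to points of box 0; a cluster point of these lies in every closed
    set [C k]. Working in [R * R] makes box 0 a product of segments, hence compact. *)
Lemma box_chain_point (B : nat -> R * R) : 0 <= q ->
  (forall k, box q th (B k.+1) `<=` cE lam @` box q th (B k)) ->
  exists z, forall k, box q th (B k) (iter k (cE lam) z).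
Proof.
move=> q0 hB.
have Bc n : box q th (B n) (Complex (B n).1 (B n).2).
  by split => /=; [rewrite lexx lerDl|rewrite subrr normr0 ltW].
pose C k : set (R * R) :=
  [set p | box q th (B k) (iter k (cE lam) (Complex p.1 p.2))].
have closedC k : closed (C k).
  have [cR cI] := continuous_iter_cE k.
  have -> : C k =
     (fun p : R * R => complex.Re (iter k (cE lam) (Complex p.1 p.2))) @^-1`
       `[(B k).1, (B k).1 + q] `&`
     (fun p : R * R => complex.Im (iter k (cE lam) (Complex p.1 p.2))) @^-1`
       `[(B k).2 - th, (B k).2 + th].
    apply/seteqP; split => p; rewrite /C /box /= !in_itv/=.
      by case=> -> + ; rewrite ler_norml => h; split => //; lra.
    by case=> -> h; split => //; rewrite ler_norml; lra.
  apply: closedI; apply: closed_comp.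
  - by move=> p _; exact: cR.
  - exact: interval_closed.
  - by move=> p _; exact: cI.
  - exact: interval_closed.
have /choice[p hp] n : exists p : R * R, forall k, (k <= n)%N -> C k p.
  have [z _ hz] := box_chain_pullback hB (Bc n).
  by exists (complex.Re z, complex.Im z); case: z hz.
have compactC : compact (C 0%N).
  apply: (@subclosed_compact _ _ (`[(B 0%N).1, (B 0%N).1 + q] `*`
     `[(B 0%N).2 - th, (B 0%N).2 + th])) => //.
    by apply: compact_setX; exact: segment_compact.
  move=> [a b] []/= h1 h2; split => /=; rewrite in_itv//=.
  by move: h2; rewrite ler_norml; lra.
have FC k : (p @ \oo) (C k).
  by exists k => // n /= kn; exact: hp.
have [[a b] [_ clab]] := compactC (p @ \oo) _ (FC 0%N).
exists (Complex a b) => k; change (C k (a, b)).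
have /closure_id -> := closedC k; move: clab; rewrite clusterE; apply.
exact: FC.
Qed.

End Sector.
End Boxes.

(** * Counting boxes in a sector *)

Section RowBoxes.
Variables (R : realType) (T : eqType) (L : T -> nat).
Variables (X : T -> nat -> R) (Y : T -> R).

Definition row_boxes (I : seq T) : seq (R * R) :=
  flatten [seq [seq (X r k, Y r) | k <- iota 0 (L r)] | r <- I].

Lemma row_boxesP I B : reflect
  (exists r k, [/\ r \in I, (k < L r)%N & B = (X r k, Y r)])
  (B \in row_boxes I).
Proof.
apply: (iffP flatten_mapP) => [[r rI /mapP[k kL ->]]|[r [k [rI kL ->]]]].
  by exists r, k; split => //; move: kL; rewrite mem_iota.
by exists r => //; apply/mapP; exists k => //; rewrite mem_iota.
Qed.

Lemma size_row_boxes I : size (row_boxes I) = (\sum_(r <- I) L r)%N.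
Proof.
elim: I => [|r I ih]; first by rewrite big_nil.
by rewrite big_cons /row_boxes/= size_cat size_map size_iota ih.
Qed.

Lemma uniq_row_boxes I : uniq [seq Y r | r <- I] ->
  (forall r, injective (X r)) -> uniq (row_boxes I).
Proof.
move=> + Xinj; elim: I => [//|r I ih] /=/andP[rI uI].
rewrite /row_boxes/= cat_uniq ih// andbT.
rewrite map_inj_uniq ?iota_uniq/=; last by move=> k l [/Xinj].
apply/hasPn => B /row_boxesP[r' [k [r'I _ ->]]].
apply: contra rI => /mapP[l _ [_ rr']].
by rewrite -rr'; apply: map_f.
Qed.

End RowBoxes.

(** * Riemann sums for the arcsine *)

Section ArcsineSums.
Variable R : realType.
Implicit Types (u v h : R).

Lemma asin_chord u v : 0 <= u -> u <= v -> v <= 1 ->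
  (asin v - asin u) * Num.sqrt (1 - v ^+ 2) <= v - u
    <= (asin v - asin u) * Num.sqrt (1 - u ^+ 2).
Proof.
move=> u0 uv v1.
have ui : -1 <= u <= 1 by lra.
have vi : -1 <= v <= 1 by lra.
rewrite -(cos_asin ui) -(cos_asin vi).
rewrite -[X in _ <= X - _ <= _](asinK (x := v)) ?in_itv//.
rewrite -[X in _ <= _ - X <= _](asinK (x := u)) ?in_itv//.
apply: sin_chord.
- rewrite leNgt; apply/negP => a0.
  have := sin_gt0_pi (x := - asin u); rewrite oppr_gt0 a0/= sinN asinK ?in_itv//.
  by have := asin_geNpi2 ui; have := pi_gt0 R; lra.
- rewrite leNgt; apply/negP => vu.
  have : sin (asin v) < sin (asin u).
    rewrite ltr_sin// in_itv/=; first by rewrite asin_geNpi2 ?asin_lepi2.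
    by rewrite asin_geNpi2 ?asin_lepi2.
  by rewrite !asinK ?in_itv//; lra.
- by have := asin_lepi2 vi; have := pi_gt0 R; lra.
Qed.

(** A Riemann sum of 1 / sqrt (1 - x^2) at the right ends of the intervals. Telescoping the chord
    bounds replaces the integral; [asin_sum_le] does the same at the left ends. *)
Lemma asin_sum_ge u h n : 0 <= u -> 0 <= h -> u + n%:R * h < 1 ->
  asin (u + n%:R * h) - asin u <=
  \sum_(0 <= i < n) h / Num.sqrt (1 - (u + i.+1%:R * h) ^+ 2).
Proof.
move=> u0 h0; elim: n => [|n ih] n1.
  by rewrite big_geq// mul0r addr0 subrr.
have n0 : 0 <= n%:R * h by rewrite mulr_ge0.
move: n1 ih; rewrite -natr1 mulrDl mul1r addrA; set v := u + _ => n1 ih.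
rewrite big_nat_recr//= -natr1 mulrDl mul1r addrA -/v.
apply: (@le_trans _ _ (asin v - asin u + (asin (v + h) - asin v))); first by lra.
apply: lerD; first by apply: ih; lra.
have s0 : 0 < Num.sqrt (1 - (v + h) ^+ 2).
  by rewrite sqrtr_gt0 subr_gt0 expr_lt1//; rewrite /v in n1 *; lra.
rewrite ler_pdivlMr//.
have /andP[+ _] := @asin_chord v (v + h) (ltac:(rewrite /v; lra))
   (ltac:(lra)) (ltac:(lra)).
by lra.
Qed.

Lemma asin_sum_le u h n : 0 <= u -> 0 <= h -> u + n%:R * h < 1 ->
  \sum_(0 <= i < n) h / Num.sqrt (1 - (u + i%:R * h) ^+ 2) <=
  asin (u + n%:R * h) - asin u.
Proof.
move=> u0 h0; elim: n => [|n ih] n1.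
  by rewrite big_geq// mul0r addr0 subrr.
have n0 : 0 <= n%:R * h by rewrite mulr_ge0.
move: n1 ih; rewrite -natr1 mulrDl mul1r addrA; set v := u + _ => n1 ih.
rewrite big_nat_recr//= -/v.
apply: (@le_trans _ _ (asin v - asin u + (asin (v + h) - asin v))); last by lra.
apply: lerD; first by apply: ih; lra.
have s0 : 0 < Num.sqrt (1 - v ^+ 2).
  by rewrite sqrtr_gt0 subr_gt0 expr_lt1//; rewrite /v in n1 *; lra.
rewrite ler_pdivrMr//.
have /andP[_ +] := @asin_chord v (v + h) (ltac:(rewrite /v; lra))
   (ltac:(lra)) (ltac:(lra)).
by lra.
Qed.

End ArcsineSums.

(** * The rows of boxes: heights at which E_lam takes positive real values *)

Section Rows.
Variables (R : realType) (al : R).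
Hypotheses (al_ge : - (pi *+ 2) <= al) (al_le0 : al <= 0).

(** These are the heights 2 pi k - al for all integers k: k = i for [true], nonnegative, and k = -(i
    + 1) for [false], nonpositive. Within each half the absolute values form an arithmetic
    progression from [row_offset], the form required by the arcsine sums. *)
Definition row_height (r : bool * nat) : R :=
  if r.1 then 2 * pi * r.2%:R - al else - (2 * pi * r.2%:R + 2 * pi + al).

Definition row_offset (s : bool) : R := if s then - al else 2 * pi + al.

Definition row_indices n : seq (bool * nat) :=
  [seq (true, i) | i <- iota 0 n] ++ [seq (false, i) | i <- iota 0 n].

Lemma cos_rowE r : cos (row_height r + al) = 1.
Proof.
have c0 n : cos (2 * pi * n%:R) = 1 :> R.
  have := periodicn (@cosD2pi R) n 0; rewrite cos0 add0r => h; rewrite -[RHS]h; congr cos.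
  by rewrite -[RHS]mulr_natr; ring.
case: r => [[] n]; rewrite /row_height /=; first by rewrite subrK.
rewrite opprD addrNK cosN -[RHS](c0 n.+1) -[n.+1]addn1 natrD; congr cos; ring.
Qed.

Lemma row_offset_itv s : 0 <= row_offset s <= 2 * pi.
Proof. by rewrite /row_offset; move: al_ge al_le0; case: s; lra. Qed.

Lemma norm_row s i : `|row_height (s, i)| = row_offset s + i%:R * (2 * pi).
Proof.
have := row_offset_itv s; have : 0 <= i%:R * (2 * pi) :> R.
  by rewrite mulr_ge0// mulr_ge0// pi_ge0.
rewrite /row_height /row_offset; case: s => /= h1 h2.
  by rewrite ger0_norm; lra.
by rewrite normrN ger0_norm; lra.
Qed.

Lemma uniq_rows n : uniq [seq row_height r | r <- row_indices n].
Proof.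
have p0 : 0 < 2 * pi :> R by rewrite mulr_gt0 ?pi_gt0.
rewrite map_inj_uniq.
  rewrite /row_indices cat_uniq !map_inj_uniq ?iota_uniq//=; try by move=> i j [].
  by rewrite andbT; apply/hasPn => _ /mapP[i _ ->]; apply/mapP => -[].
move=> [s i] [s' i'] rr.
have nn (k : nat) : 0 <= 2 * pi * k%:R :> R by rewrite mulr_ge0// ltW.
have hi := nn i; have hi' := nn i'.
have inj (a c : nat) : 2 * pi * a%:R = 2 * pi * c%:R :> R -> a = c.
  by move/(mulfI (lt0r_neq0 p0))/eqP; rewrite eqr_nat => /eqP.
move: rr; rewrite /row_height; move: al_ge al_le0; case: s; case: s' => /= *.
- by congr pair; apply: inj; lra.
- exfalso; lra.
- exfalso; lra.
- by congr pair; apply: inj; lra.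
Qed.

Lemma sum_rows (F : bool * nat -> nat) n : (\sum_(r <- row_indices n) F r =
  \sum_(0 <= i < n) F (true, i) + \sum_(0 <= i < n) F (false, i))%N.
Proof. by rewrite /row_indices big_cat !big_map /index_iota subn0. Qed.

End Rows.

Section AsinOrder.
Variable R : realType.
Implicit Types (t x : R).

Lemma asin_ge t x : - (pi / 2) <= t <= pi / 2 -> -1 <= x <= 1 ->
  sin t <= x -> t <= asin x.
Proof.
move=> ti xi tx; rewrite leNgt; apply/negP => xt.
have : sin (asin x) < sin t.
  by rewrite ltr_sin// in_itv//= asin_geNpi2 ?asin_lepi2.
by rewrite asinK ?in_itv//; lra.
Qed.

Lemma asin_le t x : - (pi / 2) <= t <= pi / 2 -> -1 <= x <= 1 ->
  x <= sin t -> asin x <= t.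
Proof.
move=> ti xi tx; rewrite leNgt; apply/negP => xt.
have : sin t < sin (asin x).
  by rewrite ltr_sin// in_itv//= asin_geNpi2 ?asin_lepi2.
by rewrite asinK ?in_itv//; lra.
Qed.

End AsinOrder.

(* A point at height about r * s is in the annulus of radii r and r * exp q as
   soon as its real part is well inside [r * c, r * c + r * b / c],
   where (c, s) is on the unit circle. *)
Lemma in_sector (R : realType) (r c s c0 b q th C u v : R) :
  0 < c0 -> c0 <= c -> 0 <= s -> c ^+ 2 + s ^+ 2 = 1 -> C = 3 / c0 ->
  0 < b -> 2 * b + b ^+ 2 / c0 ^+ 2 <= 2 * q -> 0 < th -> th < pi / 2 ->
  0 < r -> 4 + C ^+ 2 <= 2 * r -> 2 <= r * (c * sin th - s * cos th) ->
  r * c + C <= u -> u <= r * c + r * b / c - C -> `| `|v| - r * s | <= 2 ->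
  [/\ 0 < u, `|v| * cos th <= u * sin th & r <= normc (Complex u v) <= r * expR q].
Proof.
move=> c00 cc0 s0 cs CE b0 bq th0 th1 r0 rC rth u1 u2 vs.
have c1 : 0 < c by lra.
have C0 : 0 < C by rewrite CE divr_gt0.
have Cc : 3 <= C * c.
  have -> : 3 = C * c0 :> R by rewrite CE divfK// gt_eqF.
  by rewrite ler_pM2l.
have s1 : s <= 1 by nra.
have uc : 0 < u by apply: lt_le_trans u1; rewrite addr_gt0// mulr_gt0.
have [v1 v2] : (`|v| <= r * s + 2) /\ (r * s - 2 <= `|v|).
  by move: vs; rewrite ler_norml => /andP[]; lra.
have st : 0 < sin th by apply: sin_gt0_pihalf; rewrite th0.
have ct : 0 < cos th by apply: cos_gt0_pihalf; lra.
have ct1 := cos_le1 th.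
have nE : normc (Complex u v) ^+ 2 = u ^+ 2 + `|v| ^+ 2.
  by rewrite sqr_normcE /= real_normK ?num_real.
have v0 := normr_ge0 v; set w := `|v| in v0 v1 v2 nE *.
have rs0 : 0 <= r * s by rewrite mulr_ge0// ltW.
have rrs : r * s <= r by rewrite ger_pMr.
have rE2 : (r * c) ^+ 2 + (r * s) ^+ 2 = r ^+ 2.
  by rewrite !exprMn -mulrDr cs mulr1.
split=> //.
  apply: (@le_trans _ _ ((r * s + 2) * cos th)); first by rewrite ler_pM2r.
  apply: (@le_trans _ _ (r * c * sin th)); first by nra.
  by rewrite ler_pM2r//; lra.
apply/andP; split.
  rewrite -ler_sqr ?nnegrE ?normc_ge0//; last exact: ltW.
  rewrite nE -rE2.
  (* C c >= 3 makes the margin C worth 6 r, more than the 4 r s lost through the vertical error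
     2. *)
  have h1 : (r * c) ^+ 2 + 6 * r <= u ^+ 2.
    apply: (@le_trans _ _ ((r * c + C) ^+ 2)); last first.
      by rewrite ler_sqr ?nnegrE//; [rewrite addr_ge0 ?mulr_ge0// ltW | exact: ltW].
    have : r * 3 <= r * (C * c) by rewrite ler_pM2l.
    have := sqr_ge0 C; lra.
  have h2 : (r * s) ^+ 2 - 4 * (r * s) <= w ^+ 2.
    have [h|h] := leP 2 (r * s); last first.
      by apply: (@le_trans _ _ 0); [nra|exact: sqr_ge0].
    apply: (@le_trans _ _ ((r * s - 2) ^+ 2)); first by clear; lra.
    by rewrite ler_sqr ?nnegrE// subr_ge0.
  lra.
rewrite -ler_sqr ?nnegrE ?normc_ge0 ?mulr_ge0 ?expR_ge0//; last exact: ltW.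
rewrite nE exprMn.
set m := r * c + r * b / c in u2 *.
have mE : m ^+ 2 = (r * c) ^+ 2 + r ^+ 2 * (2 * b + b ^+ 2 / c ^+ 2).
  by rewrite /m; field; rewrite gt_eqF.
have bc : b ^+ 2 / c ^+ 2 <= b ^+ 2 / c0 ^+ 2.
  rewrite ler_wpM2l ?sqr_ge0// lef_pV2 ?posrE ?exprn_gt0//.
  by rewrite ler_sqr ?nnegrE ?(ltW c00) ?(ltW c1).
(* On the outer side 6 r is gained again and 4 r + 4 lost; the remaining 2 r pays for 4 + C^2. *)
have h1 : u ^+ 2 <= m ^+ 2 - 6 * r + C ^+ 2.
  apply: (@le_trans _ _ ((m - C) ^+ 2)).
    by rewrite ler_sqr ?nnegrE// ?ltW//; exact: lt_le_trans u2.
  have rc : r * c <= m.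
    by rewrite /m lerDl; apply: divr_ge0; [apply: mulr_ge0|]; exact: ltW.
  have : 3 * r <= C * m.
    apply: (@le_trans _ _ (C * (r * c))); last by rewrite ler_pM2l.
    have : r * 3 <= r * (C * c) by rewrite ler_pM2l.
    by clear; lra.
  by clear; lra.
have h2 : w ^+ 2 <= (r * s) ^+ 2 + 4 * r + 4.
  apply: (@le_trans _ _ ((r * s + 2) ^+ 2)); last by clear -rrs; lra.
  by rewrite ler_sqr ?nnegrE// addr_ge0.
apply: (@le_trans _ _ (r ^+ 2 * (1 + (2 * b + b ^+ 2 / c ^+ 2)))).
  by clear -h1 h2 mE rE2 rC; lra.
rewrite ler_pM2l ?exprn_gt0//.
have -> : expR q ^+ 2 = expR (2 * q) by rewrite expr2 -expRD; congr expR; ring.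
by apply: le_trans (expR_ge1Dx _); clear -bc bq; lra.
Qed.

Lemma nbhs_pinfty_le_real (R : realType) (K : R) : \forall r \near +oo, K <= r.
Proof. by apply: nbhs_pinfty_ge; rewrite num_real. Qed.

(* asin_sum_ge with step 2 pi / r: the rows of height at most r * sin th1 meet an
   annulus of radii r, r * (1 + b) in horizontal segments of length about
   r * b / sqrt (1 - (y / r) ^ 2), which add up to the area over 2 pi. *)
Lemma row_lengths_ge (R : realType) (r p a b C th1 th2 e : R) (n : nat)
    (L : nat -> nat) :
  0 <= p <= 2 * pi -> 0 < a -> 0 < b -> 0 < C ->
  - (pi / 2) <= th2 <= pi / 2 -> 0 <= e <= pi / 2 -> 0 < r ->
  0 < sin th1 -> 0 < cos th1 ->
  2 * pi <= r * sin th1 ->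
  4 * pi <= r * (sin th1 - sin th2) -> 2 * pi <= r * sin e ->
  n = Num.truncn (r * sin th1 / (2 * pi)) ->
  (forall i, L i = Num.truncn ((r * b /
     Num.sqrt (1 - ((p + i%:R * (2 * pi)) / r) ^+ 2) - 2 * C) / a)) ->
  r * b / a * (r / (2 * pi)) * (th2 - e) - r * (2 * C / a + 1) <=
  (\sum_(0 <= i < n) L i)%N%:R.
Proof.
move=> /andP[p0 p1] a0 b0 C0 th2I eI r0 s10 c10 rn r2 re nE LE.
have pi0 := pi_gt0 R; have pi2 := pi_ge2 R.
have tp : 0 < 2 * pi :> R by lra.
have x0 : 0 <= r * sin th1 / (2 * pi) by rewrite divr_ge0 ?mulr_ge0 ?ltW.
have n1 : (0 < n)%N by rewrite nE truncn_gt0 ler_pdivlMr// mul1r.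
have nr : n%:R * (2 * pi) <= r * sin th1.
  by rewrite -ler_pdivlMr// nE truncn_le.
have nr' : r * sin th1 < (n%:R + 1) * (2 * pi).
  by rewrite -ltr_pdivrMr// natr1 nE truncnS_gt.
have s11 := sin_le1 th1.
pose u i := (p + i%:R * (2 * pi)) / r.
have uE i : u i = p / r + i%:R * (2 * pi / r) by rewrite /u; field; rewrite gt_eqF.
have u0 i : 0 <= u i.
  apply: divr_ge0; last exact: ltW.
  by apply: addr_ge0 => //; apply: mulr_ge0 => //; exact: ltW.
have us i : (i < n)%N -> u i <= sin th1.
  move=> iN; rewrite ler_pdivrMr// [leRHS]mulrC; apply: le_trans nr.
  have : (i%:R + 1) * (2 * pi) <= n%:R * (2 * pi) :> R.
    by rewrite ler_pM2r// natr1 ler_nat.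
  by lra.
have s1lt : sin th1 < 1.
  by have := sin2cos2 th1; have : 0 < cos th1 ^+ 2 by [exact: exprn_gt0]; nra.
have c0 i : (i < n)%N -> 0 < Num.sqrt (1 - u i ^+ 2).
  move=> iN; rewrite sqrtr_gt0 subr_gt0 expr_lt1//.
  exact: le_lt_trans (us _ iN) _.
have Lge i : r * b / a / Num.sqrt (1 - u i ^+ 2) - (2 * C / a + 1) <= (L i)%:R.
  pose t := (r * b / Num.sqrt (1 - u i ^+ 2) - 2 * C) / a.
  have : t < (L i)%:R + 1 by rewrite natr1 LE -/(u i) truncnS_gt.
  have -> : t = r * b / a / Num.sqrt (1 - u i ^+ 2) - 2 * C / a.
    by rewrite /t mulrBl; congr (_ - _); rewrite mulrAC.
  lra.
case: n n1 nr nr' us c0 nE => // m _ nr nr' us c0 _.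
have mr : m.+1%:R <= r.
  have : m.+1%:R * 1 <= m.+1%:R * (2 * pi) :> R by rewrite ler_wpM2l//; lra.
  have : r * sin th1 <= r * 1 by rewrite ler_pM2l.
  lra.
have um : u m < 1 by apply: le_lt_trans s1lt; exact: us.
have sumge : (r / (2 * pi)) * (th2 - e) <=
    \sum_(0 <= i < m.+1) (Num.sqrt (1 - u i ^+ 2))^-1.
  (* The lower Riemann sum evaluates at right ends, so the term i = 0 is dropped. *)
  rewrite big_nat_recl//=; apply: (@le_trans _ _
      (\sum_(0 <= i < m) (Num.sqrt (1 - u i.+1 ^+ 2))^-1)); last first.
    by rewrite lerDr invr_ge0 ltW// c0.
  have -> : \sum_(0 <= i < m) (Num.sqrt (1 - u i.+1 ^+ 2))^-1 =
    (r / (2 * pi)) * \sum_(0 <= i < m) (2 * pi / r) /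
      Num.sqrt (1 - (p / r + i.+1%:R * (2 * pi / r)) ^+ 2).
    rewrite big_distrr/=; apply: eq_bigr => i _; rewrite -uE.
    have -> : r / (2 * pi) * (2 * pi / r / Num.sqrt (1 - u i.+1 ^+ 2)) =
      r / (2 * pi) * (2 * pi / r) / Num.sqrt (1 - u i.+1 ^+ 2) by rewrite mulrA.
    have -> : r / (2 * pi) * (2 * pi / r) = 1.
      by rewrite mulrA divfK ?gt_eqF// divff// gt_eqF.
    by rewrite mul1r.
  rewrite ler_pM2l ?divr_gt0//.
  apply: le_trans (asin_sum_ge _ _ _) => //; last 3 first.
  - by apply: divr_ge0 => //; exact: ltW.
  - by apply: divr_ge0 => //; exact: ltW.
  - by rewrite -uE.
  rewrite -uE.
  have a1 : th2 <= asin (u m).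
    apply: asin_ge => //; first by have := u0 m; lra.
    rewrite ler_pdivlMr// [leLHS]mulrC; move: nr'; rewrite -natr1.
    by lra.
  have a2 : asin (p / r) <= e.
    have pe : p / r <= sin e.
      by rewrite ler_pdivrMr// [leRHS]mulrC; lra.
    have pr0 : 0 <= p / r by apply: divr_ge0 => //; exact: ltW.
    apply: asin_le => //; first by lra.
    by have := sin_le1 e; lra.
  lra.
rewrite natr_sum.
apply: (@le_trans _ _ (\sum_(0 <= i < m.+1)
   (r * b / a / Num.sqrt (1 - u i ^+ 2) - (2 * C / a + 1)))); last first.
  by apply: ler_sum => i _; exact: Lge.
rewrite sumrB -big_distrr/= sumr_const_nat subn0 -[_ *+ m.+1]mulr_natl.
apply: lerB.
  rewrite -mulrA; apply: ler_wpM2l sumge.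
  by apply: divr_ge0; [apply: mulr_ge0|]; exact: ltW.
apply: ler_wpM2r mr; apply: addr_ge0 => //; apply: divr_ge0; last exact: ltW.
by apply: mulr_ge0 => //; exact: ltW.
Qed.

Lemma uniq_map_inj_in (T1 T2 : eqType) (f : T1 -> T2) (s : seq T1) :
  uniq (map f s) -> {in s &, injective f}.
Proof.
elim: s => [//|x s ih] /=/andP[fx us] y z; rewrite !inE.
move=> /orP[/eqP->|ys] /orP[/eqP->|zs]// fE.
- by move: fx; rewrite fE map_f.
- by move: fx; rewrite -fE map_f.
- exact: ih.
Qed.

Lemma natr_dist_ge1 (R : realDomainType) (k l : nat) :
  k != l -> 1 <= `|k%:R - l%:R| :> R.
Proof.
wlog kl : k l / (k <= l)%N => [H|].
  by case/orP: (leq_total k l) => h ne; [|rewrite distrC]; apply: H => //; rewrite eq_sym.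
move=> ne; rewrite distrC -natrB// normr_nat (ler_nat _ 1) subn_gt0.
by rewrite ltn_neqAle ne.
Qed.

Lemma unit_circle_bounds (R : realType) (t u : R) :
  0 < sin t -> 0 < cos t -> 0 <= u -> u <= sin t ->
  Num.sqrt (1 - u ^+ 2) ^+ 2 + u ^+ 2 = 1 /\ cos t <= Num.sqrt (1 - u ^+ 2).
Proof.
move=> s0 c0 u0 us; have cs := cos2Dsin2 t.
have us2 : u ^+ 2 <= sin t ^+ 2 by rewrite ler_sqr ?nnegrE// ltW.
have u1 : 0 <= 1 - u ^+ 2 by have := sqr_ge0 (cos t); lra.
rewrite sqr_sqrtr// subrK; split=> //.
rewrite -ler_sqr ?nnegrE ?sqrtr_ge0//; last exact: ltW.
by rewrite sqr_sqrtr//; lra.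
Qed.

Lemma norm_row_le (R : realType) (al r m : R) n x :
  - (pi *+ 2) <= al -> al <= 0 -> 0 < r -> 0 <= m ->
  n = Num.truncn (r * m / (2 * pi)) -> x \in row_indices n ->
  `|row_height al x| / r <= m.
Proof.
move=> al1 al2 r0 m0 nE; have p0 : 0 < 2 * pi :> R by rewrite mulr_gt0 ?pi_gt0.
have key s i : (i < n)%N -> `|row_height al (s, i)| / r <= m.
  move=> iN; rewrite norm_row// ler_pdivrMr// [leRHS]mulrC.
  have nr : n%:R * (2 * pi) <= r * m.
    by rewrite -ler_pdivlMr// nE truncn_le; apply: divr_ge0; [apply: mulr_ge0|]; 
      rewrite // ltW.
  apply: le_trans nr.
  have : (i%:R + 1) * (2 * pi) <= n%:R * (2 * pi) :> R.
    by rewrite ler_pM2r// natr1 ler_nat.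
  by have := row_offset_itv al1 al2 s; lra.
rewrite mem_cat => /orP[] /mapP[i +] ->; rewrite mem_iota add0n => iN; exact: key.
Qed.

(** The losses added up: kappa / 2 >= 1 + 10 e and (1 - e)^2 (1 - 2 e) >= 1 - 4 e have a product at
    least 1 + 2 e. One e of this pays for the error linear in r, the other for e^(2q) <= 1 + e. *)
Lemma sector_count_arith (R : realType) (kappa e q r K S : R) :
  0 < e -> e <= 1 / 10 -> 2 + 20 * e <= kappa -> 0 < r ->
  q <= ln (1 + e) / 2 -> 2 * kappa * K <= r * e ->
  2 * (r ^+ 2 * ((1 - e) ^+ 2 * (1 - 2 * e) / 4) - r * K) <= S ->
  (expR q * r) ^+ 2 <= kappa * S.
Proof.
move=> e0 e1 ek r0 q2 rK hS.
have ee : expR q ^+ 2 <= 1 + e.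
  rewrite -(lnK (x := 1 + e)) ?posrE; last lra.
  rewrite expr2 -expRD ler_expR; lra.
rewrite exprMn.
apply: (@le_trans _ _ ((1 + e) * r ^+ 2)); first by rewrite ler_pM2r ?exprn_gt0.
have rK' : 2 * kappa * K * r <= e * r ^+ 2.
  have -> : e * r ^+ 2 = r * e * r by ring.
  by rewrite ler_pM2r.
have k0 : 0 < kappa by lra.
set t := r ^+ 2 * _ in hS.
apply: (@le_trans _ _ (kappa * (2 * (t - r * K)))); last by rewrite ler_pM2l.
have : (1 + 2 * e) * r ^+ 2 <= kappa * (2 * t).
  have -> : kappa * (2 * t) =
     (kappa / 2 * ((1 - e) ^+ 2 * (1 - 2 * e))) * r ^+ 2 by rewrite /t; field.
  rewrite ler_pM2r ?exprn_gt0//.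
  apply: (@le_trans _ _ ((1 + 10 * e) * (1 - 4 * e))); first by nra.
  apply: (@le_trans _ _ ((1 + 10 * e) * ((1 - e) ^+ 2 * (1 - 2 * e)))).
    rewrite ler_pM2l; last lra.
    nra.
  rewrite ler_wpM2r//; last lra.
  by rewrite mulr_ge0 ?sqr_ge0//; lra.
lra.
Qed.

(* The factor 2 = 2 pi / pi is the period of the rows over the height of the
   boxes; everything else is lost only by a factor close to 1. *)
Lemma sector_children (R : realType) (kappa : R) : 2 < kappa ->
  exists q a th delta : R, [/\ 0 < q, q < a, a <= 1, 0 < th < pi / 2 & 0 < delta /\
    forall al, - (pi *+ 2) <= al -> al <= 0 -> \forall r \near +oo,
    exists S : seq (R * R), [/\ uniq S,
      forall B, B \in S -> [/\ cos (B.2 + al) = 1, delta * r <= B.1 &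
        forall w, box q th B w -> [/\ 0 < complex.Re w,
          `|complex.Im w| * cos th <= complex.Re w * sin th &
          r <= normc w <= r * expR q]],
      forall B B', B \in S -> B' \in S -> B.2 = B'.2 -> B.1 != B'.1 ->
        a <= `|B.1 - B'.1| &
      (expR q * r) ^+ 2 <= kappa * (size S)%:R]].
Proof.
move=> k2; have pi2 := pi_ge2 R; have pi0 := pi_gt0 R.
have ph4 := pihalf_lt2 R.
pose e := Num.min (1 / 10) ((kappa - 2) / 20).
have e0 : 0 < e by rewrite lt_min; apply/andP; split; lra.
have e1 : e <= 1 / 10 by rewrite ge_min lexx.
have ek : 2 + 20 * e <= kappa.
  have : e <= (kappa - 2) / 20 by rewrite ge_min lexx orbT.
  lra.
(* Rows are used up to the angle th1. The larger th leaves room for the height of the boxes, while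
   th2 < th1 and e' absorb the truncation at the two ends of the arcsine sum; th2 - e' is still (pi
   / 2) (1 - 2 e). *)
pose th1 := pi / 2 * (1 - e); pose th := pi / 2 * (1 - e / 2).
pose th2 := pi / 2 * (1 - 3 * e / 2); pose e' := pi / 2 * (e / 2).
pose c0 := cos th1.
have t1 : 0 < th1 < pi / 2 by rewrite /th1; apply/andP; split; nra.
have t2 : 0 < th2 < th1 by rewrite /th1 /th2; apply/andP; split; nra.
have t3 : th1 < th < pi / 2 by rewrite /th1 /th; apply/andP; split; nra.
have t4 : 0 < e' < pi / 2 by rewrite /e'; apply/andP; split; nra.
have c00 : 0 < c0 by apply: cos_gt0_pihalf; lra.
have s10 : 0 < sin th1 by exact: sin_gt0_pihalf.
have se0 : 0 < sin e' by exact: sin_gt0_pihalf.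
have s12 : sin th2 < sin th1 by rewrite ltr_sin ?in_itv/=; lra.
have st : 0 < sin (th - th1) by apply: sin_gt0_pi; lra.
have ct : 0 < cos th by apply: cos_gt0_pihalf; lra.
have sth : 0 < sin th by apply: sin_gt0_pihalf; lra.
have l0 : 0 < ln (1 + e) by apply: ln_gt0; lra.
(* The three bounds serve, in order, the quadratic term of [in_sector], the estimate e^(2q) <= 1 +
   e, and a <= 1. *)
pose q := Num.min (2 * e * c0 ^+ 2) (Num.min (ln (1 + e) / 2) (1 / 2)).
have q0 : 0 < q by rewrite !lt_min !mulr_gt0 ?invr_gt0//; lra.
have q1 : q <= 2 * e * c0 ^+ 2 by rewrite ge_min lexx.
have q2 : q <= ln (1 + e) / 2 by rewrite !ge_min lexx !orbT.
have q3 : q <= 1 / 2 by rewrite !ge_min lexx !orbT.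
(* The period a exceeds the width q, which creates the gaps; b is the part of the radial width q
   that is safely usable. Each choice costs a factor 1 - e. *)
pose a := q / (1 - e); pose b := (1 - e) * q.
have aE : a * (1 - e) = q by rewrite /a divfK//; lra.
have a0 : 0 < a by rewrite divr_gt0//; lra.
have qa : q < a by nra.
have a1 : a <= 1 by nra.
have b0 : 0 < b by rewrite mulr_gt0//; lra.
have bq : 2 * b + b ^+ 2 / c0 ^+ 2 <= 2 * q.
  have : b ^+ 2 / c0 ^+ 2 <= q * (2 * e).
    rewrite ler_pdivrMr ?exprn_gt0//; have : b <= q by rewrite /b; nra.
    have := sqr_ge0 c0; nra.
  by rewrite /b; lra.
pose C := 3 / c0; have C0 : 0 < C by rewrite divr_gt0.
exists q, a, th, c0; split => //; first by clear -t1 t3; lra.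
split=> // al al1 al2.
have [th0 th2'] : 0 < th /\ th < pi / 2 by clear -t1 t3; split; lra.
have thl2 : th <= 2 by clear -th2' ph4; lra.
pose K1 := 2 * C / a + 1.
near=> r.
have r0 : 0 < r by near: r; apply: nbhs_pinfty_gt; rewrite num_real.
have rC : (4 + C ^+ 2) / 2 <= r by near: r; exact: nbhs_pinfty_le_real.
have rs : 2 / sin (th - th1) <= r by near: r; exact: nbhs_pinfty_le_real.
have r1 : 2 * pi / sin th1 <= r by near: r; exact: nbhs_pinfty_le_real.
have r2 : 4 * pi / (sin th1 - sin th2) <= r by near: r; exact: nbhs_pinfty_le_real.
have re : 2 * pi / sin e' <= r by near: r; exact: nbhs_pinfty_le_real.
have rK : 2 * kappa * K1 / e <= r by near: r; exact: nbhs_pinfty_le_real.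
pose n := Num.truncn (r * sin th1 / (2 * pi)).
pose u (x : bool * nat) := `|row_height al x| / r.
pose c x := Num.sqrt (1 - u x ^+ 2).
pose L x := Num.truncn ((r * b / c x - 2 * C) / a).
pose X x (k : nat) := r * c x + C + k%:R * a.
have u0 x : 0 <= u x by apply: divr_ge0; [exact: normr_ge0|exact: ltW].
have uth x : x \in row_indices n -> u x <= sin th1.
  by move=> xn; apply: (norm_row_le al1 al2 r0 _ _ xn) => //; exact: ltW.
have circ x : x \in row_indices n -> c x ^+ 2 + u x ^+ 2 = 1 /\ c0 <= c x.
  by move=> xn; apply: unit_circle_bounds => //; exact: uth.
have Xbox x k w : x \in row_indices n -> (k < L x)%N -> box q th (X x k, row_height al x) w ->
    [/\ 0 < complex.Re w, `|complex.Im w| * cos th <= complex.Re w * sin th &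
     r <= normc w <= r * expR q].
  move=> xn kL; case: w => v1 v2 [] /= /andP[h1 h2] h3.
  have [cux cx] := circ _ xn.
  have c1 : 0 < c x := lt_le_trans c00 cx.
  apply: (in_sector c00 cx (u0 x) cux (erefl C) b0 bq th0 th2' r0) => //.
  - by rewrite mulrC -ler_pdivrMr.
  - move: rs; rewrite ler_pdivrMr// sinB => rs; apply: le_trans rs _.
    rewrite ler_pM2l// [sin th * _]mulrC [cos th * _]mulrC lerB ?ler_pM2r//; exact: uth.
  - by apply: le_trans h1; rewrite lerDl mulr_ge0// ltW.
  - have t0 : 0 <= (r * b / c x - 2 * C) / a.
      rewrite leNgt; apply/negP => t0; move: kL; rewrite /L.
      by rewrite truncn_gt_nat => h; have := le_lt_trans h t0; rewrite ltrn0.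
    have : (k%:R + 1) * a <= r * b / c x - 2 * C.
      rewrite -ler_pdivlMr// natr1 -truncn_gt_nat; exact: kL.
    move: h2 qa; rewrite /X; clear; lra.
  - have -> : r * u x = `|row_height al x|.
      by rewrite /u mulrC; apply: divfK; exact: lt0r_neq0.
    apply: le_trans (ler_dist_dist _ _) _; exact: le_trans thl2.
exists (row_boxes L X (row_height al) (row_indices n)); split.
- apply: uniq_row_boxes; first exact: uniq_rows.
  move=> x k l /addrI /(mulIf _) kl; apply/eqP; rewrite -(eqr_nat R).
  by apply/eqP/kl; rewrite gt_eqF.
- move=> B /row_boxesP[x [k [xn kL ->]]] /=; split; first exact: cos_rowE.
    have : 0 <= k%:R * a by rewrite mulr_ge0// ltW.
    have : c0 * r <= r * c x.
      by rewrite mulrC ler_pM2l//; have [] := circ _ xn.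
    move: C0; rewrite /X; clear; lra.
  by move=> w; exact: Xbox.
- move=> B B' /row_boxesP[x [k [xn _ ->]]] /row_boxesP[x' [k' [xn' _ ->]]] /=.
  have inj := uniq_map_inj_in (uniq_rows al1 al2 n).
  move=> /(inj _ _ xn xn') <- XX; rewrite /X opprD addrACA subrr add0r -mulrBl.
  rewrite normrM (gtr0_norm a0) ler_peMl//; first exact: ltW.
  by apply: natr_dist_ge1; apply: contra_neq XX => ->.
- have Lsum s : r * b / a * (r / (2 * pi)) * (th2 - e') - r * K1 <=
      (\sum_(0 <= i < n) L (s, i))%N%:R.
    apply: (@row_lengths_ge _ r (row_offset al s) a b C th1 th2 e') => //.
    - exact: row_offset_itv.
    - by move: t2 t1; clear; lra.
    - by move: t4; clear; lra.
    - by move: r1; rewrite ler_pdivrMr.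
    - by move: r2; rewrite ler_pdivrMr// subr_gt0.
    - by move: re; rewrite ler_pdivrMr.
    - by move=> i; rewrite /L /c /u norm_row.
  rewrite size_row_boxes sum_rows natrD.
  have h1 := Lsum true; have h2 := Lsum false.
  set S := (X in kappa * X).
  have ab : r * b / a * (r / (2 * pi)) * (th2 - e') =
     r ^+ 2 * ((1 - e) ^+ 2 * (1 - 2 * e) / 4).
    have e1' : 1 - e != 0 by rewrite gt_eqF//; move: e1; clear; lra.
    have pn0 : pi != 0 :> R by rewrite gt_eqF.
    have qn0 : q != 0 by rewrite gt_eqF.
    have rn0 : r != 0 by rewrite gt_eqF.
    rewrite /a /b /th2 /e'; clearbody q; clear -e1' pn0 qn0 rn0.
    move: (@pi R) pn0 => P pn0; field.
    by rewrite pn0 e1' qn0.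
  apply: (sector_count_arith e0 e1 ek r0 q2 (K := K1)).
    by rewrite -ler_pdivrMr.
  by rewrite -ab /S; move: h1 h2; clear; lra.
Unshelve. all: by end_near. Qed.

(** * Escaping points outside a cover *)

Section BoxPacking.
Variables (R : realType) (al q a th : R) (S : seq (R * R)).
Hypotheses (q_gt0 : 0 < q) (qa : q < a) (a_le1 : a <= 1).
Hypothesis th_lt : th < pi / 2.
Hypothesis uniqS : uniq S.
Hypothesis rowS : forall B, B \in S -> cos (B.2 + al) = 1.
Hypothesis sepS : forall B B', B \in S -> B' \in S ->
  B.2 = B'.2 -> B.1 != B'.1 -> a <= `|B.1 - B'.1|.

Let meets (V : set R[i]) B := `[< box q th B `&` V !=set0 >].

Let meets_dist V r B B' : (forall u v, V u -> V v -> normc (u - v) <= r) ->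
  meets V B -> meets V B' ->
  `|B.1 - B'.1| <= r + q /\ `|B.2 - B'.2| <= r + 2 * th.
Proof.
move=> Vr /asboolP[u [[u1 u2] Vu]] /asboolP[v [[v1 v2] Vv]].
have uv := Vr _ _ Vu Vv.
have := le_trans (normc_Re _) uv; have := le_trans (normc_Im _) uv.
by rewrite !raddfB/= !ler_norml; move: u2 v2; rewrite !ler_norml; lra.
Qed.

(** Boxes of one row are separated by gaps of at least a - q; boxes of different rows by 2 pi - 2 th
    > pi, which is more than a - q. *)
Lemma boxes_meeting_small (V : set R[i]) r :
  (forall u v, V u -> V v -> normc (u - v) <= r) -> r < a - q ->
  forall B B', B \in S -> B' \in S -> meets V B -> meets V B' -> B = B'.
Proof.
move=> Vr ra B B' BS B'S mB mB'.
have [h1 h2] := meets_dist Vr mB mB'.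
have pi2 := pi_ge2 R.
have e2 : B.2 = B'.2.
  apply/eqP/negPn/negP => ne.
  by have := row_dist (rowS BS) (rowS B'S) ne; move: a_le1 q_gt0 th_lt; lra.
have e1 : B.1 = B'.1.
  by apply/eqP/negPn/negP => ne; have := sepS BS B'S e2 ne; lra.
by case: B B' e1 e2 {BS B'S mB mB' h1 h2} => [? ?] [? ?] /= -> ->.
Qed.

(** The boxes that are met go to cells of side a of a square grid. A cell receives at most one box,
    since base points are a apart in a row and rows are 2 pi apart. The 4 dominates both q and 2
    th. *)
Lemma boxes_meeting_count (V : set R[i]) r : 0 <= r ->
  (forall u v, V u -> V v -> normc (u - v) <= r) ->
  (count (meets V) S)%:R <= (2 * (r + 4) / a + 1) ^+ 2.
Proof.
move=> r0 Vr; have a0 := lt_trans q_gt0 qa.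
have ph := pihalf_lt2 R; have pi2 := pi_ge2 R.
have x0 : 0 <= 2 * (r + 4) / a.
  by rewrite divr_ge0 ?ltW//; lra.
rewrite -size_filter; set S' := [seq B <- S | meets V B].
have [->|S'0] := eqVneq S' [::]; first by rewrite sqr_ge0.
have [B0 B0S'] : exists B0, B0 \in S'.
  by case: S' S'0 => // B0 s _; exists B0; rewrite inE eqxx.
have dist0 B : B \in S' -> `|B.1 - B0.1| <= r + 4 /\ `|B.2 - B0.2| <= r + 4.
  move: B0S'; rewrite !mem_filter => /andP[m0 _] /andP[m1 _].
  by have := meets_dist Vr m1 m0; move: qa a_le1 th_lt; lra.
pose n := (Num.truncn (2 * (r + 4) / a)).+1.
pose f (B : R * R) := (Num.truncn ((B.1 - B0.1 + (r + 4)) / a),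
                       Num.truncn ((B.2 - B0.2 + (r + 4)) / a)).
have dist1 t : `|t| <= r + 4 ->
    0 <= (t + (r + 4)) / a /\ (Num.truncn ((t + (r + 4)) / a) < n)%N.
  rewrite ler_norml => /andP[t1 t2]; have ta : 0 <= (t + (r + 4)) / a.
    by apply: divr_ge0; [lra|exact: ltW].
  split=> //; rewrite truncn_lt_nat//; apply: le_lt_trans (truncnS_gt _).
  by rewrite ler_pM2r ?invr_gt0//; lra.
have trunc_inj (t t' : R) : 0 <= (t + (r + 4)) / a -> 0 <= (t' + (r + 4)) / a ->
    Num.truncn ((t + (r + 4)) / a) = Num.truncn ((t' + (r + 4)) / a) ->
    `|t - t'| < a.
  move=> t0 t'0 tt; have /andP[h1 h2] := truncn_itv t0.
  have /andP[h3 h4] := truncn_itv t'0.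
  rewrite tt in h1; rewrite tt -(natr1 (Num.truncn _)) in h2.
  rewrite -(natr1 (Num.truncn _)) in h4.
  have : `|(t + (r + 4)) / a - (t' + (r + 4)) / a| < 1.
    by rewrite ltr_norml; apply/andP; split; lra.
  have -> : (t + (r + 4)) / a - (t' + (r + 4)) / a = (t - t') / a.
    by rewrite -mulrBl; congr (_ / _); ring.
  by rewrite normrM normfV (gtr0_norm a0) ltr_pdivrMr// mul1r.
have finj : {in S' &, injective f}.
  move=> B B' BS' B'S' [] /trunc_inj t1 /trunc_inj t2.
  have [b1 b2] := dist0 _ BS'; have [b3 b4] := dist0 _ B'S'.
  have {}t1 := t1 (dist1 _ b1).1 (dist1 _ b3).1.
  have {}t2 := t2 (dist1 _ b2).1 (dist1 _ b4).1.
  have simp (x y z : R) : x - z - (y - z) = x - y by ring.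
  rewrite !simp in t1 t2.
  have BS : B \in S by move: BS'; rewrite mem_filter => /andP[].
  have B'S : B' \in S by move: B'S'; rewrite mem_filter => /andP[].
  have e2 : B.2 = B'.2.
    apply/eqP/negPn/negP => ne.
    have := row_dist (rowS BS) (rowS B'S) ne.
    by move: a_le1 t2; lra.
  have e1 : B.1 = B'.1.
    apply/eqP/negPn/negP => ne.
    by have := sepS BS B'S e2 ne; rewrite leNgt t1.
  by move: e1 e2; case: (B) (B') => [? ?] [? ?] /= -> ->.
have : (size S' <= n * n)%N.
  have <- : size [seq (i, j) | i <- iota 0 n, j <- iota 0 n] = (n * n)%N.
    by rewrite size_allpairs size_iota.
  rewrite -(size_map f); apply: uniq_leq_size.
    by rewrite map_inj_in_uniq// filter_uniq.
  move=> _ /mapP[B BS' ->]; have [b1 b2] := dist0 _ BS'.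
  apply/allpairsP; exists (f B); rewrite !mem_iota /f /=.
  by split => //; [exact: (dist1 _ b1).2|exact: (dist1 _ b2).2].
rewrite -(ler_nat R) => h; apply: le_trans h _.
rewrite natrM -expr2 ler_sqr ?nnegrE//; last by rewrite addr_ge0.
by rewrite /n -natr1 lerD2r truncn_le.
Qed.

End BoxPacking.

Lemma sum_single_le (R : realDomainType) (T : eqType) (S : seq T) (F : T -> R) c :
  uniq S -> 0 <= c -> (forall x, x \in S -> 0 <= F x <= c) ->
  {in S &, forall x y, F x != 0 -> F y != 0 -> x = y} ->
  \sum_(x <- S) F x <= c.
Proof.
move=> uS c0 Fc Fu.
have [/hasP[x xS Fx]|/hasPn F0] := boolP (has (fun x => F x != 0) S).
  rewrite (bigD1_seq x)//= big1_seq ?addr0; first by case/andP: (Fc _ xS).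
  move=> y /andP[yx yS]; apply/eqP/negPn/negP => Fy.
  by move/eqP: yx; apply; exact: Fu.
rewrite big1_seq// => x /andP[_ xS].
by apply/eqP; rewrite -[_ == _]negbK; exact: F0.
Qed.

Section Potential.
Variables (R : realType) (lam : R[i]) (al q a th M kappa delta : R) (G : R -> R).
Hypotheses (q_gt0 : 0 < q) (qa : q < a) (a_le1 : a <= 1).
Hypothesis th_lt : th < pi / 2.
Hypotheses (M_ge1 : 1 <= M) (kappa_gt0 : 0 < kappa) (lam_neq0 : lam != 0).
Hypothesis G_gt0 : forall x, M <= x -> 0 < G x.
Hypothesis G_le : forall x y, M <= x -> x <= y -> G x <= G y.
Hypothesis G_step : forall x y, M <= x ->
  delta * (normc lam * expR x) <= y -> M <= y /\ kappa * G x <= G y.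

(** Makes the bound of [boxes_meeting_count] homogeneous: for r >= a - q it is at most this constant
    times r^2. *)
Definition packing_const : R := (2 * (1 + 4 / (a - q)) / a + (a - q)^-1) ^+ 2.

(* An upper bound for the share of the mass of the box B (distributed equally
   among the children at every level) carried by the points of a set U of
   diameter d, where T is a lower bound for the inverse of the diameter of the
   set that U was at the level 0. *)
Definition potential (B : R * R) (U : set R[i]) (d T : R) : R :=
  if `[< box q th B `&` U !=set0 >] then
    if d < a - q then kappa * packing_const * d ^+ 2 * (G T / G B.1) else 1
  else 0.

Let gam_gt0 : 0 < a - q. Proof. by rewrite subr_gt0. Qed.
Let a_gt0 : 0 < a. Proof. exact: lt_trans qa. Qed.

Let packing_const_ge r : a - q <= r ->
  (2 * (r + 4) / a + 1) ^+ 2 <= packing_const * r ^+ 2.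
Proof.
move=> gr; have r0 : 0 < r := lt_le_trans gam_gt0 gr.
have ? := gam_gt0; have ? := a_gt0.
rewrite /packing_const -exprMn ler_sqr ?nnegrE.
- have h : 1 <= r / (a - q) by rewrite ler_pdivlMr// mul1r.
  have -> : (2 * (1 + 4 / (a - q)) / a + (a - q)^-1) * r =
    2 * (r + 4 * (r / (a - q))) / a + r / (a - q).
    by field; rewrite !gt_eqF.
  apply: lerD => //; rewrite ler_pM2r ?invr_gt0//; lra.
- by apply: addr_ge0 => //; apply: divr_ge0; [lra|exact: ltW].
- apply: mulr_ge0; last exact: ltW.
  apply: addr_ge0; last by rewrite invr_ge0 ltW.
  apply: divr_ge0; last exact: ltW.
  by apply: mulr_ge0 => //; apply: addr_ge0 => //; apply: divr_ge0 => //; exact: ltW.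
Qed.

Let packing_const_ge0 : 0 <= packing_const. Proof. exact: sqr_ge0. Qed.

Let pc_ge0 d : 0 <= kappa * packing_const * d ^+ 2.
Proof.
apply: mulr_ge0; last exact: sqr_ge0.
by apply: mulr_ge0 => //; exact: ltW.
Qed.

Lemma potential_ge0 B U d T : M <= B.1 -> M <= T -> 0 <= potential B U d T.
Proof.
move=> MB MT; rewrite /potential; case: ifP => // _; case: ifP => // _.
apply: mulr_ge0; first exact: pc_ge0.
by apply: divr_ge0; apply: ltW; exact: G_gt0.
Qed.

Section Step.
Variables (B : R * R) (S : seq (R * R)).
Let r := normc lam * expR B.1.
Hypotheses (MB : M <= B.1) (r_ge1 : 1 <= r) (uniqS : uniq S).
Hypothesis rowS : forall B, B \in S -> cos (B.2 + al) = 1.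
Hypothesis deltaS : forall B, B \in S -> delta * r <= B.1.
Hypothesis sepS : forall B B', B \in S -> B' \in S ->
  B.2 = B'.2 -> B.1 != B'.1 -> a <= `|B.1 - B'.1|.
Hypothesis sizeS : (expR q * r) ^+ 2 <= kappa * (size S)%:R.

(** The average over the children does not exceed the value at the parent. If d >= a - q, the parent
    has value 1 when it is met. If d' < a - q, at most one child is met, and d'^2 <= kappa |S| d^2
    is compensated by G B'.1 >= kappa G B.1. In the intermediate case the children met number at
    most [packing_const] d'^2, each with value 1, and G T >= G B.1 suffices. *)
Lemma potential_step (U : set R[i]) d T :
  (forall u v, U u -> U v -> normc (u - v) <= d) -> 0 < d ->
  M <= T -> (a - q) * B.1 <= T * d ->
  let d' := expR q * r * d in
  let V := cE lam @` (U `&` box q th B) in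
  (forall u v, V u -> V v -> normc (u - v) <= d') /\
  \sum_(B' <- S) potential B' V d' T <= (size S)%:R * potential B U d T.
Proof.
move=> Ud d0 MT Td d' V.
have L0 := normc_gt0 lam_neq0.
have r0 : 0 < r by rewrite mulr_gt0 ?expR_gt0.
have d'0 : 0 < d' by rewrite !mulr_gt0 ?expR_gt0.
have Vd' u v : V u -> V v -> normc (u - v) <= d'.
  move=> [z [Uz [/andP[_ z1] _]] <-] [w [Uw [/andP[_ w1] _]] <-].
  apply: le_trans (cE_dist_le _ z1 w1) _.
  rewrite expRD -/r mulrA -/r [r * _]mulrC ler_pM2l; last first.
    by rewrite mulr_gt0 ?expR_gt0.
  exact: Ud.
split=> //.
have [VU|VU] := boolP `[< box q th B `&` U !=set0 >]; last first.
  rewrite /potential (negbTE VU) mulr0 big1_seq// => B' _.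
  case: ifPn => // /asboolP[_ [_ [z [Uz Bz] _]]]; case/asboolP: VU.
  by exists z.
have MS B' : B' \in S -> M <= B'.1.
  by move=> B'S; case: (G_step MB (deltaS B'S)).
have GS B' : B' \in S -> kappa * G B.1 <= G B'.1.
  by move=> B'S; case: (G_step MB (deltaS B'S)).
have PS B' : B' \in S -> 0 <= potential B' V d' T.
  by move=> B'S; apply: potential_ge0 => //; exact: MS.
have GT0 := G_gt0 MT; have GB0 := G_gt0 MB.
have rd : a - q <= d' -> ((count (fun B' => `[< box q th B' `&` V !=set0 >]) S)%:R <=
    packing_const * d' ^+ 2).
  move=> gd'; apply: le_trans (packing_const_ge gd').
  exact: (boxes_meeting_count q_gt0 qa a_le1 th_lt uniqS rowS sepS (ltW d'0) Vd').
have d'2 : d' ^+ 2 <= kappa * (size S)%:R * d ^+ 2.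
  by rewrite /d' exprMn ler_pM2r// exprn_gt0.
have [dg|dg] := ltP d (a - q); last first.
  rewrite {2}/potential VU ltNge dg/= mulr1.
  have -> : (size S)%:R = \sum_(B' <- S) 1 :> R.
    by rewrite big_const_seq count_predT iter_addr_0.
  rewrite big_seq [leRHS]big_seq; apply: ler_sum => B' B'S.
  rewrite /potential; case: ifP => // _; rewrite ifN// -leNgt.
  apply: le_trans dg _; rewrite /d' ler_peMl//; first exact: ltW.
  by rewrite mulr_ege1// -[leLHS](expR0) ler_expR ltW.
rewrite {2}/potential VU dg.
(* A set that is still small at this level had an inverse diameter beyond the current position. *)
have TB : B.1 <= T.
  rewrite -(ler_pM2l gam_gt0); apply: le_trans Td _.
  rewrite mulrC ler_pM2r; first exact: ltW.
  by apply: lt_le_trans MT; exact: lt_le_trans M_ge1.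
have GTB : G B.1 <= G T by exact: G_le.
have step1 : kappa * packing_const * d' ^+ 2 * (G T / (kappa * G B.1)) <=
    (size S)%:R * (kappa * packing_const * d ^+ 2 * (G T / G B.1)).
  have -> : kappa * packing_const * d' ^+ 2 * (G T / (kappa * G B.1)) =
    packing_const * (G T / G B.1) * d' ^+ 2.
    by field; rewrite !gt_eqF.
  have -> : (size S)%:R * (kappa * packing_const * d ^+ 2 * (G T / G B.1)) =
    packing_const * (G T / G B.1) * (kappa * (size S)%:R * d ^+ 2) by ring.
  apply: ler_wpM2l => //.
  by apply: mulr_ge0 => //; apply: divr_ge0; exact: ltW.
have [d'g|d'g] := ltP d' (a - q).
  apply: le_trans step1; apply: sum_single_le => //.
  - apply: mulr_ge0; first exact: pc_ge0.
    apply: divr_ge0; first exact: ltW.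
    by apply: mulr_ge0; exact: ltW.
  - move=> B' B'S; rewrite PS//= /potential d'g; case: ifP => _; last first.
      apply: mulr_ge0; first exact: pc_ge0.
      apply: divr_ge0; first exact: ltW.
    by apply: mulr_ge0; exact: ltW.
    apply: ler_wpM2l; first exact: pc_ge0.
    apply: ler_wpM2l; first exact: ltW.
    have kG : 0 < kappa * G B.1 by rewrite mulr_gt0.
    by rewrite lef_pV2 ?posrE ?GS//; apply: lt_le_trans (GS _ B'S).
  - move=> B1 B2 B1S B2S; rewrite /potential.
    case: ifP => [m1 _|]; last by rewrite eqxx.
    case: ifP => [m2 _|]; last by rewrite eqxx.
    exact: (boxes_meeting_small q_gt0 a_le1 th_lt rowS sepS Vd' d'g B1S B2S m1 m2).
apply: (@le_trans _ _ (count (fun B' => `[< box q th B' `&` V !=set0 >]) S)%:R).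
  rewrite -sum1_count natr_sum [leRHS]big_mkcond/=; apply: ler_sum => B' _.
  by rewrite /potential; case: ifP => // _; rewrite ifN// -leNgt.
apply: le_trans (rd d'g) _.
apply: (@le_trans _ _ ((size S)%:R * (kappa * packing_const * d ^+ 2 * 1))).
  have -> : (size S)%:R * (kappa * packing_const * d ^+ 2 * 1) =
    packing_const * (kappa * (size S)%:R * d ^+ 2) by ring.
  exact: ler_wpM2l.
apply: ler_wpM2l => //; apply: ler_wpM2l.
  exact: pc_ge0.
by rewrite ler_pdivlMr// mul1r.
Qed.

End Step.
End Potential.

(** * Descent through boxes that avoids a cover *)

Section Avoid.
Variables (R : realType) (lam : R[i]) (al q a th M kappa delta : R) (G : R -> R).
Hypotheses (q_gt0 : 0 < q) (qa : q < a) (a_le1 : a <= 1).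
Hypotheses (th_gt0 : 0 < th) (th_lt : th < pi / 2).
Hypotheses (M_ge1 : 1 <= M) (kappa_gt0 : 0 < kappa) (lam_neq0 : lam != 0).
Hypothesis Re_lam : complex.Re lam = normc lam * cos al.
Hypothesis Im_lam : complex.Im lam = normc lam * sin al.
Hypothesis G_gt0 : forall x, M <= x -> 0 < G x.
Hypothesis G_le : forall x y, M <= x -> x <= y -> G x <= G y.
Hypothesis G_step : forall x y, M <= x ->
  delta * (normc lam * expR x) <= y -> M <= y /\ kappa * G x <= G y.
Hypothesis growth : forall x y, M <= x ->
  delta * (normc lam * expR x) <= y -> x + 1 <= y.
Hypothesis M_large : forall x, M <= x -> 2 <= normc lam * expR x.
Hypothesis children : forall x, M <= x -> let r := normc lam * expR x in
  exists S : seq (R * R), [/\ uniq S,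
      forall B, B \in S -> [/\ cos (B.2 + al) = 1, delta * r <= B.1 &
        forall w, box q th B w -> [/\ 0 < complex.Re w,
          `|complex.Im w| * cos th <= complex.Re w * sin th &
          r <= normc w <= r * expR q]],
      forall B B', B \in S -> B' \in S -> B.2 = B'.2 -> B.1 != B'.1 ->
        a <= `|B.1 - B'.1| &
      (expR q * r) ^+ 2 <= kappa * (size S)%:R].

Variable T : nat -> R.

Let P B U d k := potential q a th kappa G B (U k) (d k) (T k).
(** The state consists of the current box, the images of the sets of the cover and bounds for their
    diameters; T never changes. *)
Let Inv (s : (R * R) * (nat -> set R[i]) * (nat -> R)) : Prop :=
  let: (B, U, d) := s in
  [/\ M <= B.1 /\ cos (B.2 + al) = 1,
      forall k u v, U k u -> U k v -> normc (u - v) <= d k,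
      forall k, 0 < d k,
      forall k, M <= T k /\ (a - q) * B.1 <= T k * d k &
      (\sum_(k <oo) (P B U d k)%:E < 1%:E)%E].
Let Step (s s' : (R * R) * (nat -> set R[i]) * (nat -> R)) : Prop :=
  let: (B, U, d) := s in let: (B', U', d') := s' in
  [/\ box q th B' `<=` cE lam @` box q th B, B.1 + 1 <= B'.1,
     forall k, U' k = cE lam @` (U k `&` box q th B) &
     forall k, 2 * d k <= d' k].

Let step_exists s : Inv s -> exists s', Inv s' /\ Step s s'.
Proof.
case: s => [[B U] d] [[MB rB] Ud d0 TI sum1].
pose r := normc lam * expR B.1.
have [S [uS hS sepS szS]] := children MB.
rewrite -/r in hS szS.
have r2 : 2 <= r := M_large MB.
have r1 : 1 <= r by lra.
have rowS B' : B' \in S -> cos (B'.2 + al) = 1 by move=> /hS[].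
have delS B' : B' \in S -> delta * r <= B'.1 by move=> /hS[].
pose d' k := expR q * r * d k.
pose V k := cE lam @` (U k `&` box q th B).
have step k : (forall u v, V k u -> V k v -> normc (u - v) <= d' k) /\
    \sum_(B' <- S) P B' V d' k <= (size S)%:R * P B U d k.
  exact: (potential_step q_gt0 qa a_le1 th_lt M_ge1 kappa_gt0 lam_neq0
    G_gt0 G_le G_step MB r1 uS rowS delS sepS szS (Ud k) (d0 k)
    (TI k).1 (TI k).2).
have MS B' : B' \in S -> M <= B'.1.
  by move=> B'S; case: (G_step MB (delS _ B'S)).
have P0 B' k : B' \in S -> 0 <= P B' V d' k.
  move=> B'S; apply: (potential_ge0 _ _ _ kappa_gt0 G_gt0); first exact: MS.
  by case: (TI k).
have P0B k : 0 <= P B U d k by apply: (potential_ge0 _ _ _ kappa_gt0 G_gt0) => //; case: (TI k).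
have S0 : 0 < (size S)%:R :> R.
  rewrite -(pmulr_rgt0 _ kappa_gt0); apply: lt_le_trans szS.
  by rewrite exprn_gt0// mulr_gt0 ?expR_gt0//; lra.
(* If every child had total potential at least 1, the sum over S would be at least |S|, against
   [step] summed over k. *)
have [B' [B'S lt1]] : exists B', B' \in S /\ (\sum_(k <oo) (P B' V d' k)%:E < 1%:E)%E.
  apply/not_existsP => noB'.
  have ge1 B' : B' \in S -> (1%:E <= \sum_(k <oo) (P B' V d' k)%:E)%E.
    by move=> B'S; rewrite leNgt; apply/negP => lt1; exact: (noB' B').
  have : ((size S)%:R%:E <= \sum_(B' <- S | B' \in S) \sum_(k <oo) (P B' V d' k)%:E)%E.
    have -> : (size S)%:R%:E = (\sum_(B' <- S) (1 : R)%:E)%E.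
      by rewrite sumEFin big_const_seq count_predT iter_addr_0.
    rewrite [leLHS]big_seq.
    exact: lee_sum.
  rewrite -nneseries_sum; last by move=> B' k B'S; rewrite lee_fin P0.
  apply/negP; rewrite -ltNge.
  apply: (@le_lt_trans _ _ (\sum_(k <oo) ((size S)%:R%:E * (P B U d k)%:E))%E).
    apply: lee_nneseries => [k _ _|k _].
      by apply: sume_ge0 => B' B'S; rewrite lee_fin P0.
    by rewrite -big_seq sumEFin -EFinM lee_fin; case: (step k).
  rewrite nneseriesZl; last by move=> k _; rewrite lee_fin.
  by rewrite -[ltRHS]mule1 lte_pmul2l.
have boxB' : box q th B' `<=` cE lam @` box q th B.
  move=> w Bw; have [_ _ /(_ _ Bw)[w1 w2 w3]] := hS _ B'S.
  have [|z Bz <-] := cE_box_onto lam_neq0 Re_lam Im_lam th_gt0 th_lt rB w1 w2 (q := q).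
    by rewrite expRD mulrA.
  by exists z.
(* The position and the diameters both grow by at most, respectively exactly, the factor r e^q, so
   the bound of (a - q) B.1 by T d persists. *)
have B'1 : B'.1 <= r * expR q.
  have Bw : box q th B' (Complex B'.1 B'.2).
    by split => /=; [rewrite lexx lerDl ltW|rewrite subrr normr0 ltW].
  have [_ _ /(_ _ Bw)[_ _ /andP[_ h]]] := hS _ B'S.
  apply: le_trans h; apply: le_trans (normc_Re _); exact: ler_norm.
have e1 : 1 <= expR q by rewrite -[leLHS](expR0) ler_expR ltW.
exists (B', V, d'); split; split => //.
- by split; [exact: MS|exact: rowS].
- by move=> k; case: (step k).
- by move=> k; rewrite mulr_gt0// mulr_gt0 ?expR_gt0//; lra.
- move=> k; have [TM Td] := TI k; split => //.
  have Td' : (a - q) * 1 <= T k * d k.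
    apply: le_trans Td; rewrite ler_pM2l ?subr_gt0//; exact: le_trans MB.
  apply: (@le_trans _ _ ((a - q) * (r * expR q))).
    by rewrite ler_pM2l// subr_gt0.
  rewrite mulr1 in Td'.
  have -> : T k * d' k = (T k * d k) * (r * expR q) by rewrite /d'; ring.
  by rewrite ler_wpM2r// mulr_ge0 ?expR_ge0//; lra.
- exact: growth (delS _ B'S).
- move=> k; rewrite /d' ler_pM2r// -[leLHS]mul1r; apply: ler_pM => //.
Qed.

(** The diameter bounds at least double at each step. If z were in U k, the image of U k would meet
    the current box at every level, and once its bound reaches a - q its potential alone would be 1.
    The orbit escapes because the positions increase by at least 1 each time. *)
Lemma avoid_cover (B : R * R) (U : nat -> set R[i]) (d : nat -> R) :
  M <= B.1 -> cos (B.2 + al) = 1 ->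
  (forall k u v, U k u -> U k v -> normc (u - v) <= d k) ->
  (forall k, 0 < d k) ->
  (forall k, M <= T k /\ (a - q) * B.1 <= T k * d k) ->
  (\sum_(k <oo) (potential q a th kappa G B (U k) (d k) (T k))%:E < 1%:E)%E ->
  exists2 z, escaping_set lam z & forall k, ~ U k z.
Proof.
move=> MB rB Ud d0 TI sum1.
have /choice[f hf] s : exists s', Inv s -> Inv s' /\ Step s s'.
  have [/step_exists[s' hs']|ns] := pselect (Inv s); first by exists s'.
  by exists s.
pose c n := iter n f (B, U, d).
have cI n : Inv (c n).
  by elim: n => [|n ih]; [split|rewrite /c iterS; case: (hf _ ih)].
have cS n : Step (c n) (c n.+1) by rewrite /c iterS; case: (hf _ (cI n)).
pose Bn n := (c n).1.1; pose Un n := (c n).1.2; pose dn n := (c n).2.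
have Bbox n : box q th (Bn n.+1) `<=` cE lam @` box q th (Bn n).
  by have := cS n; rewrite /Bn; case: (c n) (c n.+1) => [[? ?] ?] [[? ?] ?] [].
have Bgrow n : (Bn n).1 + 1 <= (Bn n.+1).1.
  by have := cS n; rewrite /Bn; case: (c n) (c n.+1) => [[? ?] ?] [[? ?] ?] [].
have Ustep n k : Un n.+1 k = cE lam @` (Un n k `&` box q th (Bn n)).
  by have := cS n; rewrite /Un /Bn; case: (c n) (c n.+1) => [[? ?] ?] [[? ?] ?] [].
have dstep n k : 2 * dn n k <= dn n.+1 k.
  by have := cS n; rewrite /dn; case: (c n) (c n.+1) => [[? ?] ?] [[? ?] ?] [].
have Plt n : (\sum_(k <oo) (P (Bn n) (Un n) (dn n) k)%:E < 1%:E)%E.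
  by have := cI n; rewrite /Bn /Un /dn; case: (c n) => [[? ?] ?] [].
have P0 n k : 0 <= P (Bn n) (Un n) (dn n) k.
  have := cI n; rewrite /Bn /Un /dn; case: (c n) => [[? ?] ?] [[? ?] _ _ Tk _].
  by apply: (potential_ge0 _ _ _ kappa_gt0 G_gt0) => //; case: (Tk k).
have [z zB] := box_chain_point Re_lam Im_lam th_gt0 (ltW q_gt0) Bbox.
have Bn_ge n : n%:R <= (Bn n).1.
  elim: n => [|n ih]; first by apply: le_trans MB; apply: le_trans M_ge1.
  by rewrite -natr1; apply: le_trans (Bgrow n); rewrite lerD2r.
exists z.
  rewrite /escaping_set/=; apply/cvgryPge => A; near=> n.
  apply: le_trans (normc_Re _); apply: le_trans (ler_norm _).
  have [/andP[+ _] _] := zB n; apply: le_trans; apply: le_trans (Bn_ge n).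
  by near: n; exact: nbhs_infty_ger.
move=> k Uz.
have Unz n : Un n k (iter n (cE lam) z).
  elim: n => [//|n ih]; rewrite Ustep; exists (iter n (cE lam) z) => //.
have dn_ge n : 2 ^+ n * d k <= dn n k.
  elim: n => [|n ih]; first by rewrite mul1r.
  apply: le_trans (dstep n k); rewrite exprS -mulrA ler_pM2l//.
have [n hn] : exists n, a - q <= dn n k.
  exists (Num.truncn ((a - q) / d k)).+1.
  apply: le_trans (dn_ge _); rewrite -ler_pdivrMr//.
  apply: le_trans (ltW (truncnS_gt _)) _.
  by rewrite -natrX ler_nat ltnW// ltn_expl.
have := Plt n; apply/negP; rewrite -leNgt.
apply: (@le_trans _ _ (\sum_(0 <= j < k.+1) (P (Bn n) (Un n) (dn n) j)%:E)%E); last first.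
  by apply: nneseries_lim_ge => j _ _; rewrite lee_fin.
rewrite big_nat_recr//= -[leLHS]add0e leeD//.
  by apply: sume_ge0 => j _; rewrite lee_fin.
rewrite lee_fin /P /potential; case: asboolP => [_|].
  by rewrite ltNge hn.
by case; exists (iter n (cE lam) z).
Unshelve. all: by end_near. Qed.

End Avoid.

Lemma near_pinftyP (R : realType) (Q : R -> Prop) :
  (\forall x \near +oo, Q x) -> exists M, forall x, M <= x -> Q x.
Proof.
move=> [M [_ hM]]; exists (M + 1) => x Mx; apply: hM.
by apply: lt_le_trans Mx; rewrite ltrDl.
Qed.

Lemma near_expR_ge (R : realType) (K c : R) : 0 < c ->
  \forall x \near +oo, K <= c * expR x.
Proof.
move=> c0; near=> x; rewrite mulrC -ler_pdivrMr//.
apply: le_trans (expR_ge1Dx x); apply: ler_wpDl; first exact: ler01.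
by near: x; exact: nbhs_pinfty_le_real.
Unshelve. all: by end_near. Qed.

Lemma escaping_set_large (R : realType) (lam0 b s : R) (Phi : R -> R)
    (lam : R[i]) :
  0 < lam0 -> 1 < b -> rE lam0 b = b -> koenigs_extension lam0 b Phi ->
  lam != 0 -> 0 < s -> 2 < b `^ s ->
  exists c t0, [/\ 0 < c, 0 < t0 & forall (U : nat -> set R[i]) (d : nat -> R),
    (forall k u v, U k u -> U k v -> normc (u - v) <= d k) ->
    (forall k, 0 < d k < t0) ->
    (\sum_(k <oo) (d k ^+ 2 * Phi (d k)^-1 `^ s)%:E < c%:E)%E ->
    ~ escaping_set lam `<=` \bigcup_k U k].
Proof.
move=> l0 b1 fixb PhiK lamn0 s0 bs2.
have [al [al1 al2 Re_lam Im_lam]] := polar_decomposition lamn0.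
have L0 := normc_gt0 lamn0; set L := normc lam in L0 Re_lam Im_lam.
have [q [a [th [delta [q0 qa a1 /andP[th0 th1] [de0 chS]]]]]] := sector_children bs2.
have [M1 hM1] := near_pinftyP (chS _ al1 al2).
have dL0 : 0 < delta * L by rewrite mulr_gt0.
(* This shift gives E_lam0 (x - C0) = delta L e^x / 2. The other half of delta L e^x dominates C0,
   so a child at y >= delta L e^x satisfies y - C0 >= E_lam0 (x - C0), which is [G_step] with kappa
   = b^s. *)
pose C0 := ln (2 * lam0 / (delta * L)).
have C0E : lam0 * expR (- C0) = delta * L / 2.
  rewrite expRN lnK ?posrE ?divr_gt0 ?mulr_gt0//.
  by field; rewrite !gt_eqF.
have Phi_le := koenigs_le l0 b1 fixb PhiK.
have Phi_gt0 := koenigs_gt0 l0 b1 fixb PhiK.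
have : \forall x \near +oo, [/\ 1 <= x /\ b + C0 + 1 <= x,
    x + 1 <= delta * (L * expR x), C0 <= delta * L / 2 * expR x,
    2 <= L * expR x & M1 <= L * expR x].
  near=> x.
  have x1 : 1 <= x by near: x; exact: nbhs_pinfty_le_real.
  have sup : 2 / (delta * L) * x <= expR x by near: x; exact: expR_superlinear.
  split.
  - by split=> //; near: x; exact: nbhs_pinfty_le_real.
  - apply: (@le_trans _ _ (2 * x)); first by lra.
    by move: sup; rewrite mulrAC ler_pdivrMr// => h; rewrite mulrA [leRHS]mulrC.
  - by near: x; apply: near_expR_ge; rewrite divr_gt0.
  - by near: x; exact: near_expR_ge.
  - by near: x; exact: near_expR_ge.
move=> /near_pinftyP[M hM].
have [[M1' _] _ _ _ _] := hM _ (lexx M).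
pose G x := Phi (x - C0) `^ s.
have Mb x : M <= x -> b < x - C0 by move=> /hM[[_ h] _ _ _ _]; lra.
have G_gt0 x : M <= x -> 0 < G x.
  by move=> Mx; apply: powR_gt0; apply: Phi_gt0; exact: Mb.
have Phi_ge0 x : b <= x -> 0 <= Phi x by exact: (koenigs_ge0 l0 b1 fixb PhiK).
have pow_le x y : b <= x -> x <= y -> Phi x `^ s <= Phi y `^ s.
  move=> bx xy; have by_ : b <= y by exact: le_trans xy.
  apply: ge0_ler_powR; rewrite ?nnegrE; [exact: ltW|exact: Phi_ge0|exact: Phi_ge0|exact: Phi_le].
have G_le x y : M <= x -> x <= y -> G x <= G y.
  by move=> Mx xy; apply: pow_le; [exact/ltW/Mb|rewrite lerD2r].
have PhiE x : b <= x -> Phi (rE lam0 x) `^ s = b `^ s * Phi x `^ s.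
  by move=> bx; rewrite PhiK.2// powRM ?Phi_ge0//; lra.
have G_step x y : M <= x -> delta * (L * expR x) <= y ->
    M <= y /\ b `^ s * G x <= G y.
  move=> Mx xy; have [_ h1 h2 _ _] := hM _ Mx.
  split; first by clear -h1 xy Mx; lra.
  have bx : b <= x - C0 by exact/ltW/Mb.
  rewrite -PhiE//; apply: pow_le; first exact: rE_ge.
  rewrite /rE expRD mulrCA C0E.
  by apply: (@le_trans _ _ (delta * (L * expR x) - C0)); clear -h1 h2 xy; lra.
have growth x y : M <= x -> delta * (L * expR x) <= y -> x + 1 <= y.
  by move=> /hM[_ h _ _ _] xy; exact: le_trans xy.
have M_large x : M <= x -> 2 <= L * expR x by move=> /hM[].
have kap0 : 0 < b `^ s by exact: lt_trans bs2.
pose A := b `^ s * packing_const q a.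
have gam0 : 0 < a - q by rewrite subr_gt0.
have A0 : 0 < A.
  rewrite mulr_gt0// exprn_gt0// addr_gt0 ?invr_gt0//.
  by apply: divr_gt0; [rewrite mulr_gt0// addr_gt0// divr_gt0|exact: lt_trans qa].
have GM0 := G_gt0 _ (lexx M).
(* The initial T is a multiple of 1 / d. One application of E_lam0 to 1 / d exceeds it, so G T is at
   most b^s Phi (1 / d)^s. *)
have [M2 hM2] : exists M2, forall t, M2 <= t -> (a - q) * M * t - C0 <= rE lam0 t.
  apply: near_pinftyP; near=> t.
  have h1 : (2 * ((a - q) * M)) / lam0 * t <= expR t.
    by near: t; exact: expR_superlinear.
  have h2 : - C0 <= lam0 / 2 * expR t.
    by near: t; apply: near_expR_ge; rewrite divr_gt0.
  have : 2 * ((a - q) * M) * t <= lam0 * expR t.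
    by move: h1; rewrite mulrAC ler_pdivrMr// => h; rewrite [leRHS]mulrC.
  by rewrite /rE; clear -h2; lra.
pose m := Num.max M2 b.
have b0 : 0 < b by exact: lt_trans b1.
have m0 : 0 < m by rewrite lt_max b0 orbT.
(* The inverse of the constant by which the sum of d^2 Phi (1 / d)^s bounds the total potential of
   the initial box. *)
exists (G M / (A * b `^ s)), (Num.min (a - q) m^-1); split.
- by rewrite divr_gt0// mulr_gt0.
- by rewrite lt_min gam0 invr_gt0.
move=> U d Ud d0 sumlt cover.
pose T k := (a - q) * M / d k.
have dk0 k : 0 < d k by case/andP: (d0 k).
have dkg k : d k < a - q by have /andP[_] := d0 k; rewrite lt_min => /andP[].
have dkm k : m <= (d k)^-1.
  have /andP[_] := d0 k; rewrite lt_min => /andP[_ h].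
  by rewrite -[m]invrK lef_pV2 ?posrE ?invr_gt0// ltW.
have M0 : 0 < M by exact: lt_le_trans M1'.
have TM k : M <= T k.
  by rewrite /T ler_pdivlMr// mulrC ler_pM2r// ltW.
have Td k : M <= T k /\ (a - q) * (M, row_height al (true, 0%N)).1 <= T k * d k.
  by split=> //=; rewrite /T divfK// gt_eqF.
have chM x (Mx : M <= x) := hM1 _ (let: And5 _ _ _ _ h := hM x Mx in h).
have [|z Iz nU] := avoid_cover (B := (M, row_height al (true, 0%N)))
  q0 qa a1 th0 th1 M1' kap0 lamn0 Re_lam Im_lam
  G_gt0 G_le G_step growth M_large chM (lexx M) (cos_rowE al (true, 0%N)) Ud
  dk0 Td; last by have [k _ /nU] := cover _ Iz.
apply: (@le_lt_trans _ _ (\sum_(k <oo) ((A * b `^ s / G M)%:E *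
    (d k ^+ 2 * Phi (d k)^-1 `^ s)%:E))%E).
  apply: lee_nneseries => [k _ _|k _].
    by rewrite lee_fin; apply: (potential_ge0 _ _ _ kap0 G_gt0).
  rewrite -EFinM lee_fin /potential.
  have mb : b <= (d k)^-1 by apply: le_trans (dkm k); rewrite le_max lexx orbT.
  have rhs0 : 0 <= A * b `^ s / G M * (d k ^+ 2 * Phi (d k)^-1 `^ s).
    apply: mulr_ge0; last by rewrite mulr_ge0 ?sqr_ge0 ?powR_ge0.
    by apply: divr_ge0; [apply: mulr_ge0|]; exact: ltW.
  case: ifP => // _; rewrite dkg /=.
  have -> : A * b `^ s / G M * (d k ^+ 2 * Phi (d k)^-1 `^ s) =
     b `^ s * packing_const q a * d k ^+ 2 * (b `^ s * Phi (d k)^-1 `^ s / G M).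
    by rewrite /A; ring.
  apply: ler_wpM2l.
    by rewrite mulr_ge0 ?sqr_ge0// ltW.
  rewrite ler_pM2r ?invr_gt0// -PhiE//; apply: pow_le; first exact/ltW/Mb/TM.
  by apply: hM2; apply: le_trans (dkm k); rewrite le_max lexx.
rewrite nneseriesZl; last first.
  by move=> k _; rewrite lee_fin mulr_ge0 ?sqr_ge0 ?powR_ge0.
have K0 : 0 < A * b `^ s / G M by rewrite divr_gt0// mulr_gt0.
rewrite (_ : 1%:E = (A * b `^ s / G M)%:E * (G M / (A * b `^ s))%:E)%E.
  by rewrite lte_pmul2l.
by rewrite -EFinM; congr EFin; field; rewrite !gt_eqF.
Unshelve. all: by end_near. Qed.

(** * Covers of half annuli *)

Lemma cos_ge0_near_row (R : realType) (al t : R) : 0 <= cos (t + al) ->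
  exists x, `|t - row_height al x| <= pi / 2.
Proof.
move=> ct; have pi0 := pi_gt0 R; have p2 : 0 < 2 * pi :> R by lra.
have [x hx] : exists x, `|t - row_height al x| <= pi.
  have [h|h] := leP (- pi) (t + al).
    have h0 : 0 <= (t + al + pi) / (2 * pi) by apply: divr_ge0; [lra|exact: ltW].
    have /andP[h1 h2] := truncn_itv h0.
    exists (true, Num.truncn ((t + al + pi) / (2 * pi))).
    move: h1 h2; rewrite ler_pdivlMr// ltr_pdivrMr// -(natr1 (Num.truncn _)).
    by rewrite /row_height/= ler_norml => *; apply/andP; split; lra.
  have h0 : 0 <= (- (t + al) - pi) / (2 * pi) by apply: divr_ge0; [lra|exact: ltW].
  have /andP[h1 h2] := truncn_itv h0.
  exists (false, Num.truncn ((- (t + al) - pi) / (2 * pi))).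
  move: h1 h2; rewrite ler_pdivlMr// ltr_pdivrMr// -(natr1 (Num.truncn _)).
  by rewrite /row_height/= ler_norml => *; apply/andP; split; lra.
exists x; rewrite leNgt; apply/negP => hx2.
have : cos `|t - row_height al x| < cos (pi / 2).
  have h1 : `|t - row_height al x| \in `[0, pi] by rewrite in_itv/= normr_ge0.
  have h2 : (pi : R) / 2 \in `[0, pi] by rewrite in_itv/=; lra.
  by rewrite ltr_cos.
by rewrite cos_pihalf cos_norm -(cos_row _ (cos_rowE al x)) ltNge ct.
Qed.

(* One half of the rows, of heights p + 2 pi i: those below 49 r / 50 are summed by
   asin_sum_le, and the few remaining ones have length at most r / 2. *)
Lemma row_lengths_le (R : realType) (r p a : R) (n1 n : nat) (L : nat -> nat) :
  0 <= p <= 2 * pi -> 1 / 11 <= a -> 50 * 60 <= r ->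
  n1 = Num.truncn (49 / 50 * r / (2 * pi)) ->
  n = (Num.truncn ((11 / 10 * r + 2) / (2 * pi))).+1 ->
  (forall i, (i < n1)%N -> (L i)%:R <=
     (21 / 100 * r + 8) / (2 * Num.sqrt (1 - ((p + i%:R * (2 * pi) + 2) / r) ^+ 2)) / a + 1) ->
  (forall i, (n1 <= i)%N -> (L i)%:R <= r / 2 / a + 1) ->
  (\sum_(0 <= i < n) L i)%N%:R <= 93 / 200 * r ^+ 2.
Proof.
move=> /andP[p0 p1] a11 r1 n1E nE L1 L2.
have pi0 := pi_gt0 R; have pi2 := pi_ge2 R; have ph := pihalf_lt2 R.
have r0 : 0 < r by lra.
have a0 : 0 < a by lra.
have tp : 0 < 2 * pi :> R by lra.
have ai : a^-1 <= 11 by rewrite -[leRHS]invrK lef_pV2 ?posrE ?invr_gt0//; lra.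
have ai0 : 0 < a^-1 by rewrite invr_gt0.
have x10 : 0 <= 49 / 50 * r / (2 * pi) by apply: divr_ge0; lra.
have x20 : 0 <= (11 / 10 * r + 2) / (2 * pi) by apply: divr_ge0; lra.
have n1l : n1%:R * (2 * pi) <= 49 / 50 * r.
  by rewrite -ler_pdivlMr// n1E truncn_le.
have n1u : 49 / 50 * r < (n1%:R + 1) * (2 * pi).
  by rewrite -ltr_pdivrMr// natr1 n1E truncnS_gt.
have nu : (n%:R - 1) * (2 * pi) <= 11 / 10 * r + 2.
  by rewrite -ler_pdivlMr// nE -natr1 addrK truncn_le.
have n1n : (n1 <= n)%N.
  rewrite -ltnS -(ltr_nat R) -natr1 -(ltr_pM2r tp).
  have : 11 / 10 * r + 2 < n%:R * (2 * pi).
    by rewrite -ltr_pdivrMr// nE truncnS_gt.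
  rewrite mulrDl mul1r; lra.
have n1r : n1%:R <= r.
  have : n1%:R * 1 <= n1%:R * (2 * pi) :> R by rewrite ler_wpM2l//; lra.
  lra.
(* 11/10 - 49/50 = 12/100 and 2 pi >= 4; the truncations contribute two more rows. *)
have nn : n%:R - n1%:R <= 3 / 100 * r + 5 / 2.
  have h : (n%:R - n1%:R - 2) * (2 * pi) <= 12 / 100 * r + 2 by lra.
  have [h0|h0] := leP 0 (n%:R - n1%:R - 2 : R); last by lra.
  have : (n%:R - n1%:R - 2) * 4 <= (n%:R - n1%:R - 2) * (2 * pi) :> R.
    by rewrite ler_wpM2l//; lra.
  lra.
clear n1u nu x10 x20.
pose u i := (p + i%:R * (2 * pi) + 2) / r.
have uE i : u i = (p + 2) / r + i%:R * (2 * pi / r).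
  by rewrite /u; field; rewrite gt_eqF.
have u0 i : 0 <= u i.
  apply: divr_ge0; last exact: ltW.
  have : 0 <= i%:R * (2 * pi) :> R by apply: mulr_ge0 => //; exact: ltW.
  lra.
have un1 : u n1 < 1 by rewrite ltr_pdivrMr//; lra.
have sum1 : \sum_(0 <= i < n1) (Num.sqrt (1 - u i ^+ 2))^-1 <= r / 4.
  have -> : \sum_(0 <= i < n1) (Num.sqrt (1 - u i ^+ 2))^-1 =
    (r / (2 * pi)) * \sum_(0 <= i < n1) (2 * pi / r) /
      Num.sqrt (1 - ((p + 2) / r + i%:R * (2 * pi / r)) ^+ 2).
    rewrite big_distrr/=; apply: eq_bigr => i _; rewrite -uE.
    have -> : r / (2 * pi) * (2 * pi / r / Num.sqrt (1 - u i ^+ 2)) =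
      r / (2 * pi) * (2 * pi / r) / Num.sqrt (1 - u i ^+ 2) by rewrite mulrA.
    have -> : r / (2 * pi) * (2 * pi / r) = 1.
      by rewrite mulrA divfK ?gt_eqF// divff// gt_eqF.
    by rewrite mul1r.
  have -> : r / 4 = r / (2 * pi) * (pi / 2).
    move: (@pi R) pi0 {tp pi2 ph n1l p1 u uE u0 un1 n1E nE L1} => P P0.
    by field; rewrite gt_eqF.
  rewrite ler_pM2l ?divr_gt0//.
  have pr0 : 0 <= (p + 2) / r by apply: divr_ge0; lra.
  apply: le_trans (asin_sum_le _ _ _) _ => //.
  - by apply: divr_ge0; exact: ltW.
  - by rewrite -uE.
  rewrite -uE; have : asin (u n1) <= pi / 2.
    by apply: asin_lepi2; have := u0 n1; lra.
  have : 0 <= asin ((p + 2) / r).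
    apply: asin_ge; rewrite ?sin0//; first lra.
    by have := un1; rewrite uE; have : 0 <= n1%:R * (2 * pi / r) :> R
      by [apply: mulr_ge0 => //; apply: divr_ge0; exact: ltW]; lra.
  lra.
rewrite natr_sum (@big_cat_nat _ _ _ n1)//=.
have s1 : \sum_(0 <= i < n1) (L i)%:R <= (21 / 100 * r + 8) / 2 / a * (r / 4) + r :> R.
  apply: (@le_trans _ _ (\sum_(0 <= i < n1)
     ((21 / 100 * r + 8) / 2 / a * (Num.sqrt (1 - u i ^+ 2))^-1 + 1))).
    rewrite big_nat [leRHS]big_nat; apply: ler_sum => i /andP[_ iN].
    apply: le_trans (L1 i iN) _; rewrite -/(u i) lerD2r invfM mulrA.
    by rewrite mulrAC.
  rewrite big_split/= -big_distrr/= sumr_const_nat subn0 lerD//.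
  apply: ler_wpM2l => //; apply: mulr_ge0; last exact: ltW.
  by clear -r0; lra.
have s2 : \sum_(n1 <= i < n) (L i)%:R <= (3 / 100 * r + 5 / 2) * (r / 2 / a + 1) :> R.
  apply: (@le_trans _ _ (\sum_(n1 <= i < n) (r / 2 / a + 1))).
    rewrite big_nat [leRHS]big_nat; apply: ler_sum => i /andP[iN _]; exact: L2.
  rewrite sumr_const_nat -[leLHS]mulr_natl natrB//; apply: ler_wpM2r => //.
  by apply: addr_ge0 => //; apply: divr_ge0; clear -r0 a0; lra.
(* With 1 / a <= 11 the quadratic coefficients are 21/200 * 11/4 and 3/100 * 11/2, together below
   0.454. The gap to 93/200 absorbs the linear terms once r >= 3000. *)
apply: le_trans (lerD s1 s2) _.
clear -r0 r1 a0 ai ai0.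
have b1 : (21 / 100 * r + 8) / 2 / a * (r / 4) <= (21 / 100 * r + 8) / 2 * 11 * (r / 4).
  rewrite ler_pM2r; last lra.
  by rewrite ler_pM2l; lra.
have b2 : (3 / 100 * r + 5 / 2) * (r / 2 / a + 1) <=
    (3 / 100 * r + 5 / 2) * (r / 2 * 11 + 1).
  rewrite ler_pM2l; last lra.
  by rewrite lerD2r ler_pM2l; lra.
apply: le_trans (lerD (lerD b1 (lexx r)) b2) _.
have : 50 * 60 * r <= r * r by rewrite ler_pM2r.
rewrite expr2; clear -r1; lra.
Qed.

Lemma grid_cover (R : realType) (x0 len a t : R) : 0 < a -> x0 <= t ->
  t <= x0 + len ->
  exists2 k, (k < (Num.truncn (len / a)).+1)%N &
    x0 + k%:R * a <= t <= x0 + k%:R * a + a.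
Proof.
move=> a0 x0t tl.
have h0 : 0 <= (t - x0) / a by apply: divr_ge0; [lra|exact: ltW].
have /andP[h1 h2] := truncn_itv h0.
exists (Num.truncn ((t - x0) / a)).
  rewrite ltnS le_truncn// ler_pM2r ?invr_gt0//; lra.
move: h1 h2; rewrite ler_pdivlMr// ltr_pdivrMr// -(natr1 (Num.truncn _)).
by move=> *; apply/andP; split; lra.
Qed.

(** c belongs to the height y + 2, which bounds the whole row, so r c <= u everywhere. The length
    comes from u^2 - (r c)^2 <= 21/100 r^2 + 8 r divided by u + r c >= 2 r c, where 21/100 =
    (11/10)^2 - 1 and the linear term comes from (y + 2)^2 - (y - 2)^2. *)
Lemma low_row_cover (R : realType) (r y u v : R) :
  100 <= r -> 0 <= y -> y <= 49 / 50 * r -> (y + 2) / r < 1 ->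
  0 <= u -> r <= normc (Complex u v) -> normc (Complex u v) <= 11 / 10 * r ->
  `| `|v| - y | <= 2 ->
  let c := Num.sqrt (1 - ((y + 2) / r) ^+ 2) in
  r * c <= u /\ u <= r * c + (21 / 100 * r + 8) / (2 * c).
Proof.
move=> r100 y0 yr yr1 u0 n1 n2 vy c.
have r0 : 0 < r by lra.
have nE : normc (Complex u v) ^+ 2 = u ^+ 2 + `|v| ^+ 2.
  by rewrite sqr_normcE /= real_normK ?num_real.
have v0 := normr_ge0 v; set w := `|v| in v0 vy nE.
have /andP[v1 v2] : y - 2 <= w <= y + 2.
  by move: vy; rewrite ler_norml => /andP[]; lra.
have m0 := normc_ge0 (Complex u v); set m := normc _ in n1 n2 nE m0.
have m1 : r ^+ 2 <= m ^+ 2 by rewrite ler_sqr ?nnegrE// ltW.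
have m2 : m ^+ 2 <= (11 / 10 * r) ^+ 2.
  by rewrite ler_sqr ?nnegrE//; exact: le_trans n2.
have y20 : 0 <= y + 2 by rewrite addr_ge0.
have yr0 : 0 <= (y + 2) / r by rewrite divr_ge0// ltW.
have c0 : 0 < c by rewrite sqrtr_gt0 subr_gt0 expr_lt1.
have c2 : (r * c) ^+ 2 = r ^+ 2 - (y + 2) ^+ 2.
  rewrite exprMn sqr_sqrtr; last by rewrite subr_ge0 expr_le1// ltW.
  by field; rewrite gt_eqF.
have w2 : w ^+ 2 <= (y + 2) ^+ 2 by rewrite ler_sqr ?nnegrE.
have w3 : y ^+ 2 - 4 * y <= w ^+ 2.
  have [h|h] := leP 2 y; last first.
    by have := sqr_ge0 w; clear -h y0; nra.
  have : (y - 2) ^+ 2 <= w ^+ 2 by rewrite ler_sqr ?nnegrE// subr_ge0.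
  by clear; lra.
have rc0 : 0 < r * c by rewrite mulr_gt0.
have h1 : r * c <= u.
  by rewrite -ler_sqr ?nnegrE ?(ltW rc0)//; rewrite c2; clear -m1 nE w2; lra.
split=> //.
rewrite addrC -lerBlDr ler_pdivlMr ?mulr_gt0//.
have h2 : (u - r * c) * (u + r * c) <= 21 / 100 * r ^+ 2 + 8 * r.
  have -> : (u - r * c) * (u + r * c) = u ^+ 2 - (r * c) ^+ 2 by ring.
  by rewrite c2; clear -m2 nE w3 yr r100; lra.
have h3 : (u - r * c) * (2 * (r * c)) <= (u - r * c) * (u + r * c).
  by apply: ler_wpM2l; clear -h1; lra.
by rewrite -(ler_pM2l r0); clear -h2 h3; lra.
Qed.

(** The threshold 49/50 is chosen for (11/10)^2 - (49/50)^2 = 0.2496 < 1/4; so small a gap requires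
    the large lower bound on r. *)
Lemma high_row_cover (R : realType) (r y u v : R) :
  50 * 50 * 40 <= r -> 49 / 50 * r - 8 <= y ->
  0 <= u -> normc (Complex u v) <= 11 / 10 * r ->
  `| `|v| - y | <= 2 -> u <= r / 2.
Proof.
move=> r1 yr u0 n2 vy; have r0 : 0 < r by lra.
have nE : normc (Complex u v) ^+ 2 = u ^+ 2 + `|v| ^+ 2.
  by rewrite sqr_normcE /= real_normK ?num_real.
have v0 := normr_ge0 v; set w := `|v| in v0 vy nE.
have v1 : 49 / 50 * r - 10 <= w.
  by move: vy; rewrite ler_norml => /andP[]; lra.
set m := normc _ in n2 nE.
have m2 : m ^+ 2 <= (11 / 10 * r) ^+ 2.
  by rewrite ler_sqr ?nnegrE ?normc_ge0//; lra.
have w2 : (49 / 50 * r - 10) ^+ 2 <= w ^+ 2 by rewrite ler_sqr ?nnegrE; lra.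
rewrite -ler_sqr ?nnegrE//; last by lra.
have : 50 * 50 * 40 * r <= r * r by rewrite ler_pM2r.
lra.
Qed.

Lemma half_annulus_cover (R : realType) (al : R) :
  - (pi *+ 2) <= al -> al <= 0 -> \forall r \near +oo,
  exists S : seq (R * R), [/\
    forall B, B \in S -> cos (B.2 + al) = 1 /\ B.1 <= 11 / 10 * r,
    forall w, r <= normc w <= 11 / 10 * r -> 0 <= complex.Re w ->
      0 <= cos (complex.Im w + al) ->
      exists2 B, B \in S & box (ln (11 / 10)) (pi / 2) B w &
    (size S)%:R <= 93 / 100 * r ^+ 2].
Proof.
move=> al1 al2; near=> r.
have r1 : 50 * 50 * 40 <= r by near: r; exact: nbhs_pinfty_le_real.
set a := ln (11 / 10).
have a11 : 1 / 11 <= a.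
  have := @ln_sublinear R (10 / 11) (ltac:(lra)).
  have h := expR_ge1Dx (- a).
  rewrite expRN lnK ?posrE in h; last lra.
  have -> : 10 / 11 = (11 / 10)^-1 :> R by field.
  move: h; have -> : (11 / 10)^-1 = 10 / 11 :> R by field.
  by clear; lra.
have a0 : 0 < a by apply: lt_le_trans a11; clear; lra.
have ph : pi / 2 <= 2 :> R by apply: ltW; exact: pihalf_lt2.
have [r0 r3 r100] : [/\ 0 < r, 50 * 60 <= r & 100 <= r].
  by move: r1; clear; split; lra.
have tp : 0 < 2 * pi :> R by rewrite mulr_gt0 ?pi_gt0.
have tp8 : 2 * pi <= 8 :> R by move: ph; clear; lra.
pose n1 := Num.truncn (49 / 50 * r / (2 * pi)).
pose n := (Num.truncn ((11 / 10 * r + 2) / (2 * pi))).+1.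
pose y (x : bool * nat) : R := `|row_height al x|.
pose c x := Num.sqrt (1 - ((y x + 2) / r) ^+ 2).
pose len x := if (x.2 < n1)%N then (21 / 100 * r + 8) / (2 * c x) else r / 2.
pose L x := (Num.truncn (len x / a)).+1.
pose X x (k : nat) := (if (x.2 < n1)%N then r * c x else 0) + k%:R * a.
have yE s i : y (s, i) = row_offset al s + i%:R * (2 * pi) by exact: norm_row.
have offI := row_offset_itv al1 al2.
have n1l : n1%:R * (2 * pi) <= 49 / 50 * r.
  rewrite -ler_pdivlMr// truncn_le; apply: divr_ge0; last exact: ltW.
  by move: r0; clear; lra.
have n1u : 49 / 50 * r < (n1%:R + 1) * (2 * pi).
  by rewrite -ltr_pdivrMr// natr1 truncnS_gt.
have y0 x : 0 <= y x by exact: normr_ge0.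
have ylow x : (x.2 < n1)%N -> y x <= 49 / 50 * r.
  case: x => s i /= iN; rewrite yE; apply: le_trans n1l.
  have : (i%:R + 1) * (2 * pi) <= n1%:R * (2 * pi) :> R.
    by rewrite ler_pM2r// natr1 ler_nat.
  by have := offI s; clear; lra.
have yhigh x : (n1 <= x.2)%N -> 49 / 50 * r - 8 <= y x.
  case: x => s i /= iN; rewrite yE.
  have : n1%:R * (2 * pi) <= i%:R * (2 * pi) :> R.
    by rewrite ler_pM2r// ler_nat.
  by move: (offI s) n1u tp8; clear; lra.
have yl1 x : (x.2 < n1)%N -> (y x + 2) / r < 1.
  by move=> /ylow h; rewrite ltr_pdivrMr//; move: (y x) h r3 => z; clear; lra.
(* Boxes starting beyond 11 r / 10 contain no point of the annulus. Without them the positions are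
   bounded, which later bounds the inverse diameters. *)
exists [seq B <- row_boxes L X (row_height al) (row_indices n) | B.1 <= 11 / 10 * r].
split.
- move=> B; rewrite mem_filter => /andP[B1 /row_boxesP[x [k [_ _ BE]]]].
  by split => //; rewrite BE; exact: cos_rowE.
- case=> u v /andP[w1 w2] u0 /cos_ge0_near_row[x hx]; rewrite /= in u0 hx.
  have vy : `| `|v| - y x | <= 2.
    by apply: le_trans (ler_dist_dist _ _) _; exact: le_trans ph.
  have xI : x \in row_indices n.
    have ixn : (x.2 < n)%N.
      have : y x <= 11 / 10 * r + 2.
        have h : `|v| <= normc (Complex u v) := normc_Im (Complex u v).
        by move: vy h w2; rewrite ler_norml => /andP[]; move: (y x) (normc _) => z m; clear; lra.
      case: x {hx vy} => s i /=; rewrite yE => yi.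
      rewrite /n ltnS truncn_ge_nat.
        rewrite ler_pdivlMr//; move: yi (offI s); clear; lra.
      by apply: divr_ge0; [move: r0; clear; lra|exact: ltW].
    case: x {hx vy} ixn => -[] i iN; rewrite mem_cat; apply/orP; [left|right];
      by apply/mapP; exists i => //; rewrite mem_iota.
  have [X1 X2] : (if (x.2 < n1)%N then r * c x else 0) <= u /\
      u <= (if (x.2 < n1)%N then r * c x else 0) + len x.
    rewrite /len; case: ifPn => xn1.
      exact: (low_row_cover r100 (y0 x) (ylow _ xn1) (yl1 _ xn1) u0 w1 w2 vy).
    split=> //; rewrite add0r; apply: (high_row_cover r1 _ u0 w2 vy).
    by apply: yhigh; rewrite leqNgt.
  have [k kL hk] := grid_cover a0 X1 X2.
  exists (X x k, row_height al x); last by split.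
  rewrite mem_filter; apply/andP; split.
    have /andP[h _] := hk; apply: le_trans h _; apply: le_trans w2.
    by apply: le_trans (normc_Re (Complex u v)); exact: ler_norm.
  by apply/row_boxesP; exists x, k.
- have Lsum s : (\sum_(0 <= i < n) L (s, i))%N%:R <= 93 / 200 * r ^+ 2.
    have trL t : 0 <= t -> ((Num.truncn t).+1)%:R <= t + 1 :> R.
      by move=> t0; rewrite -(natr1 (Num.truncn _)) lerD2r truncn_le.
    apply: (@row_lengths_le _ r (row_offset al s) a n1 n) => //.
    + move=> i iN; rewrite /L /len /= iN -yE; apply: trL.
      apply: divr_ge0; last exact: ltW.
      by apply: divr_ge0; [move: r0; clear; lra|rewrite mulr_ge0// sqrtr_ge0].
    + move=> i iN; rewrite /L /len /= ltnNge iN /=; apply: trL.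
      by apply: divr_ge0; [move: r0; clear; lra|exact: ltW].
  apply: (@le_trans _ _ (size (row_boxes L X (row_height al) (row_indices n)))%:R).
    by rewrite ler_nat size_filter count_size.
  rewrite size_row_boxes sum_rows natrD.
  by have := Lsum true; have := Lsum false; clear; lra.
Unshelve. all: by end_near. Qed.

(** * Covers of the points that stay to the right *)

Lemma ler_dist_center (R : realDomainType) (c e x y : R) :
  `|x - c| <= e -> `|y - c| <= e -> `|x - y| <= e + e.
Proof.
by move=> xc yc; apply: le_trans (ler_distD c x y) _; rewrite lerD// distrC.
Qed.

(** * Lipschitz bounds for inverse branches, and covers of level n *)

Section InverseLipschitz.
Variables (R : realType) (lam u v : R[i]) (X : R).
Hypotheses (lam_neq0 : lam != 0) (uX : X <= complex.Re u) (vX : X <= complex.Re v).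
Hypothesis uv : `|complex.Im u - complex.Im v| <= pi.
Let r := normc lam * expR X.
Let N := normc (cE lam u - cE lam v).
Let t := `|complex.Im u - complex.Im v| / 2.

Let r_gt0 : 0 < r. Proof. by rewrite mulr_gt0 ?normc_gt0 ?expR_gt0. Qed.

Let t_itv : 0 <= t <= pi / 2.
Proof. by rewrite divr_ge0//= ler_pM2r. Qed.

Let dist c : 1 <= c -> t <= c * sin t -> normc (u - v) <= c / r * N.
Proof.
move=> c1 tc; have /andP[t0 t1] := t_itv.
have s0 : 0 <= sin t by apply: sin_ge0_pi; have := pi_ge0 R; lra.
rewrite mulrAC ler_pdivlMr// -ler_sqr ?nnegrE; last 2 first.
- by rewrite mulr_ge0 ?normc_ge0// ltW.
- by rewrite mulr_ge0 ?normc_ge0//; lra.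
have h := cE_dist_ge lam uX vX.
rewrite exprMn [leRHS]exprMn sqr_normcE !raddfB/=.
apply: (@le_trans _ _ (c ^+ 2 * (r ^+ 2 *
   ((complex.Re u - complex.Re v) ^+ 2 + (2 * sin t) ^+ 2)))); last first.
  by rewrite ler_wpM2l ?sqr_ge0.
rewrite [leRHS]mulrCA [leLHS]mulrC ler_wpM2l ?sqr_ge0// mulrDr lerD//.
  by rewrite ler_peMl ?sqr_ge0// exprn_ege1.
have -> : (complex.Im u - complex.Im v) ^+ 2 = (2 * t) ^+ 2.
  by rewrite /t mulrC divfK// real_normK// num_real.
rewrite -exprMn ler_sqr ?nnegrE ?mulr_ge0//; last by lra.
by rewrite [leRHS]mulrCA ler_pM2l.
Qed.

Lemma cE_inverse_lipschitz : normc (u - v) <= 2 / r * N.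
Proof.
have /andP[t0 t1] := t_itv.
by apply: dist; [lra|have := sin_ge_half t0 t1; lra].
Qed.

(** The factor 2 of [cE_inverse_lipschitz], squared at every level, would destroy a contraction by
    93/100; images small compared with r allow a factor close to 1. *)
Lemma cE_inverse_lipschitz_near e : 0 < e -> N <= e / (1 + e) * r ->
  normc (u - v) <= (1 + e) / r * N.
Proof.
move=> e0 Ne; have /andP[t0 t1] := t_itv.
apply: dist; first by lra.
apply: sin_ge_near0 => //.
have s0 : 0 <= sin t by apply: sin_ge0_pi; have := pi_ge0 R; lra.
have h := cE_dist_ge lam uX vX.
have N0 : 0 <= N by exact: normc_ge0.
apply: (@le_trans _ _ (N / r)); last by rewrite ler_pdivrMr.
rewrite ler_pdivlMr// -ler_sqr ?nnegrE//; last first.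
  by apply: mulr_ge0; [apply: mulr_ge0|exact: ltW].
apply: le_trans h; rewrite exprMn mulrC ler_wpM2l ?sqr_ge0//.
by rewrite lerDr sqr_ge0.
Qed.

End InverseLipschitz.

Lemma iter_rE_le (R : realType) (lam0 : R) n x y :
  0 < lam0 -> x <= y -> iter n (rE lam0) x <= iter n (rE lam0) y.
Proof.
move=> l0; elim: n x y => [//|n ih] x y xy; rewrite !iterSr; apply: ih.
by rewrite /rE ler_pM2l// ler_expR.
Qed.

(** By induction from e^((r - 1) x) >= 1 + (r - 1) x >= r, valid as x >= b > 1. It moves the factor
    lost in a pullback inside the iterate. *)
Lemma iter_rE_mul (R : realType) (lam0 b r : R) n x :
  0 < lam0 -> 1 < b -> rE lam0 b = b -> 1 <= r -> b <= x ->
  r * iter n (rE lam0) x <= iter n (rE lam0) (r * x).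
Proof.
move=> l0 b1 fixb r1; elim: n x => [//|n ih] x bx; rewrite !iterSr.
apply: le_trans (ih _ (rE_ge b1 fixb bx)) _.
apply: iter_rE_le => //; rewrite /rE mulrCA ler_pM2l//.
have -> : r * x = x + (r - 1) * x by ring.
rewrite expRD mulrC ler_pM2l ?expR_gt0//.
apply: le_trans (expR_ge1Dx _); nra.
Qed.

Section LevelCovers.
Variables (R : realType) (lam : R[i]) (al lam0 b : R).
Hypotheses (lam0_gt0 : 0 < lam0) (b_gt1 : 1 < b) (fixb : rE lam0 b = b).
Hypothesis lam_neq0 : lam != 0.
Hypothesis Re_lam : complex.Re lam = normc lam * cos al.
Hypothesis Im_lam : complex.Im lam = normc lam * sin al.

Definition stays_right (M : R) : set R[i] :=
  [set z | forall k, M <= complex.Re (iter k (cE lam) z)].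

Let a : R := ln (11 / 10).

Variable M : R.
Hypothesis M_gt0 : 0 < M.
Hypothesis cover_step : forall x, M <= x -> let r := normc lam * expR x in
  exists S : seq (R * R), [/\
    forall B, B \in S -> cos (B.2 + al) = 1 /\ B.1 <= 11 / 10 * r,
    forall w, r <= normc w <= 11 / 10 * r -> 0 <= complex.Re w ->
      0 <= cos (complex.Im w + al) ->
      exists2 B, B \in S & box a (pi / 2) B w &
    (size S)%:R <= 93 / 100 * r ^+ 2].
Hypothesis M_large : forall x, M <= x -> let r := normc lam * expR x in
  [/\ 255 <= r, M <= r & r * (3 * (11 / 10 * r) + b) <= rE lam0 (3 * x + b)].

(** Induction on n: the image of the box is covered by children, each child by sets of level n, and
    these are pulled back into the box. Inverse diameters are bounded by an orbit of E_lam0 so that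
    Phi of them is at most a constant times b^n. *)
Lemma level_cover n x y : M <= x -> cos (y + al) = 1 ->
  exists s : seq (set R[i] * R), [/\
    forall z, stays_right M z -> box a (pi / 2) (x, y) z ->
      exists2 p, p \in s & p.1 z,
    forall p, p \in s -> [/\ 0 < p.2, p.2 <= 5 * (1 / 2) ^+ n,
      p.2^-1 <= iter n (rE lam0) (3 * x + b) &
      forall u v, p.1 u -> p.1 v -> normc (u - v) <= p.2] &
    \sum_(p <- s) p.2 ^+ 2 <= 25 * (97 / 100) ^+ n].
Proof.
have pi4 : pi <= 4 :> R by have := pihalf_lt2 R; lra.
have a1 : a <= 1.
  have h := expR_ge1Dx a; rewrite /a lnK ?posrE in h; last lra.
  by rewrite /a; lra.
elim: n x y => [|n ih] x y Mx rowy.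
  (* The sides are at most 1 and 4, so the diameter is at most sqrt 17 < 5. *)
  exists [:: (box a (pi / 2) (x, y), 5)]; split.
  - by move=> z _ Bz; exists (box a (pi / 2) (x, y), 5) => //; rewrite inE.
  - move=> p; rewrite inE => /eqP-> /=; split=> //.
    + by rewrite mulr1.
    + apply: (@le_trans _ _ 1); first by lra.
      by move: M_gt0 b_gt1 Mx; lra.
    + move=> u v [/andP[u1 u2] u3] [/andP[v1 v2] v3].
      rewrite -ler_sqr ?nnegrE ?normc_ge0// sqr_normcE !raddfB/=.
      have h1 : `|complex.Re u - complex.Re v| <= 1.
        by rewrite ler_norml; apply/andP; split; move: u1 u2 v1 v2 => /=; lra.
      have h2 : `|complex.Im u - complex.Im v| <= 4.
        by apply: le_trans (ler_dist_center u3 v3) _; rewrite -splitr.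
      rewrite -[X in X + _]real_normK ?num_real// -[X in _ + X]real_normK ?num_real//.
      move: (normr_ge0 (complex.Re u - complex.Re v)) h1.
      move: (normr_ge0 (complex.Im u - complex.Im v)) h2.
      by move: `|_| `|_| => s t; nra.
  - by rewrite big_seq1 /=; lra.
set r := normc lam * expR x.
have [r255 Mr rC] := M_large Mx; rewrite -/r in r255 Mr rC.
have [S [S1 S2 S3]] := cover_step Mx; rewrite -/r in S1 S2 S3.
have r0 : 0 < r by lra.
(* The induction hypothesis needs boxes starting at M or later. Moving a child to the right loses no
   point of [stays_right M]. *)
pose mx (B : R * R) : R := Num.max B.1 M.
have /choice[f hf] (B : R * R) : exists s : seq (set R[i] * R), B \in S -> [/\
    forall z, stays_right M z -> box a (pi / 2) (mx B, B.2) z ->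
      exists2 p, p \in s & p.1 z,
    forall p, p \in s -> [/\ 0 < p.2, p.2 <= 5 * (1 / 2) ^+ n,
      p.2^-1 <= iter n (rE lam0) (3 * mx B + b) &
      forall u v, p.1 u -> p.1 v -> normc (u - v) <= p.2] &
    \sum_(p <- s) p.2 ^+ 2 <= 25 * (97 / 100) ^+ n].
  have [BS|BS] := boolP (B \in S); last by exists [::].
  have [rB _] := S1 _ BS.
  by have [s hs] := ih (mx B) B.2 (ltac:(by rewrite le_max lexx orbT)) rB; exists s.
(* 93/100 (51/50)^2 < 97/100, and sets of diameter at most 5 are small enough when r >= 5 * 51 =
   255. *)
pose e : R := 1 / 50.
have e0 : 0 < e by rewrite /e; lra.
have e5 : 5 <= e / (1 + e) * r.
  have -> : e / (1 + e) = 1 / 51 by rewrite /e; field.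
  lra.
have e10 : 0 < 1 + e by rewrite addr_gt0.
have er : (1 + e) / r <= 1 / 2 by rewrite ler_pdivrMr// /e; lra.
have er0 : 0 < (1 + e) / r by exact: divr_gt0.
have e11 : 1 <= 1 + e by rewrite lerDl ltW.
pose pull (p : set R[i] * R) : set R[i] * R :=
  ([set z | box a (pi / 2) (x, y) z /\ p.1 (cE lam z)], (1 + e) / r * p.2).
exists (flatten [seq [seq pull p | p <- f B] | B <- S]); split.
- move=> z Jz Bz; pose w := cE lam z.
  have [/andP[/= z1 z2] z3] := Bz.
  have w1 : M <= complex.Re w by have := Jz 1%N.
  have Jw : stays_right M w by move=> k; have := Jz k.+1; rewrite iterSr.
  have wr : r <= normc w <= 11 / 10 * r.
    rewrite normc_cE /r; apply/andP; split.
      by rewrite ler_pM2l ?normc_gt0// ler_expR.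
    rewrite mulrCA ler_pM2l ?normc_gt0//.
    have -> : 11 / 10 * expR x = expR (x + a).
      by rewrite expRD /a lnK ?posrE; [ring|lra].
    by rewrite ler_expR.
  have cw : 0 <= cos (complex.Im w + al).
    have := Jw 1%N; rewrite /= (Re_cE Re_lam Im_lam).
    move=> /(lt_le_trans M_gt0); rewrite pmulr_rgt0; first exact: ltW.
    by rewrite mulr_gt0 ?normc_gt0 ?expR_gt0.
  have [B BS [Bw1 Bw2]] := S2 w wr (le_trans (ltW M_gt0) w1) cw.
  have [fB1 _ _] := hf _ BS.
  have [p pf pw] : exists2 p, p \in f B & p.1 w.
    apply: fB1 => //; split=> //=; have /andP[h1 h2] := Bw1.
    by rewrite ge_max h1 w1/=; apply: le_trans h2 _; rewrite lerD2r le_max lexx.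
  exists (pull p); last by split.
  by apply/flattenP; exists [seq pull p | p <- f B]; apply: map_f.
- move=> _ /flattenP[_ /mapP[B BS ->] /mapP[p pf ->]] /=.
  have [_ /(_ _ pf)[p0 p5 pinv pdiam] _] := hf _ BS.
  have p5' : p.2 <= 5.
    apply: le_trans p5 _; rewrite ler_piMr//.
    by rewrite exprn_ile1//; lra.
  split.
  + by rewrite mulr_gt0.
  + rewrite exprS mulrCA; apply: ler_pM => //; exact: ltW.
  (* The pullback multiplies the inverse diameter by at most r, which goes inside the iterate. There
     [rC] absorbs it into one more step of E_lam0: this is the purpose of 3 in 3 x + b, since e^(3x)
     beats a quadratic expression in r. *)
  + rewrite invfM invf_div.
    have m1 : mx B <= 11 / 10 * r.
      by rewrite ge_max; have [_ ->] := S1 _ BS => /=; lra.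
    have m2 : 0 <= mx B by rewrite le_max (ltW M_gt0) orbT.
    apply: (@le_trans _ _ (r * iter n (rE lam0) (3 * mx B + b))).
      apply: ler_pM => //; first by apply: divr_ge0; exact: ltW.
        by rewrite invr_ge0 ltW.
      by rewrite ler_pdivrMr// ler_peMr// ltW.
    apply: le_trans (iter_rE_mul _ lam0_gt0 b_gt1 fixb _ _) _.
    * lra.
    * lra.
    rewrite -iterS iterSr; apply: iter_rE_le => //; apply: le_trans rC.
    by rewrite ler_pM2l//; lra.
  + move=> u v [Bu pu] [Bv pv].
    have [/andP[/= u1 _] u3] := Bu; have [/andP[/= v1 _] v3] := Bv.
    apply: le_trans (cE_inverse_lipschitz_near lam_neq0 u1 v1 _ _ _) _.
    * by rewrite [leRHS]splitr; exact: ler_dist_center u3 v3.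
    * exact: e0.
    * apply: le_trans (pdiam _ _ pu pv) _; apply: le_trans p5' _.
      exact: e5.
    * by rewrite -/r ler_pM2l// pdiam.
- rewrite big_flatten big_map /=.
  apply: (@le_trans _ _ (\sum_(B <- S) (((1 + e) / r) ^+ 2 * (25 * (97 / 100) ^+ n)))).
    rewrite big_seq [leRHS]big_seq; apply: ler_sum => B BS.
    have [_ _ h] := hf _ BS; rewrite big_map/=.
    under eq_bigr do rewrite exprMn.
    by rewrite -big_distrr/= ler_wpM2l// sqr_ge0.
  rewrite big_const_seq count_predT iter_addr_0 -[_ *+ size S]mulr_natl.
  have n0 : 0 <= (97 / 100) ^+ n :> R by rewrite exprn_ge0//; lra.
  have h : (size S)%:R * ((1 + e) / r) ^+ 2 <= 97 / 100.
    rewrite expr_div_n mulrA ler_pdivrMr ?exprn_gt0//.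
    apply: (@le_trans _ _ (93 / 100 * r ^+ 2 * (1 + e) ^+ 2)).
      by rewrite ler_wpM2r// sqr_ge0.
    have := sqr_ge0 r; rewrite /e; lra.
  apply: (@le_trans _ _ (97 / 100 * (25 * (97 / 100) ^+ n))).
    by rewrite [leLHS]mulrA; apply: ler_wpM2r => //; apply: mulr_ge0.
  by rewrite exprS mulrCA.
Qed.

End LevelCovers.

(** * Null sets of a gauge *)

Lemma nneseries_pairing (R : realType) : exists e : nat -> nat * nat,
  (forall p, exists k, e k = p) /\
  forall w : nat * nat -> \bar R, (forall p, (0 <= w p)%E) ->
    (\sum_(k <oo) w (e k) = \sum_(i <oo) \sum_(j <oo) w (i, j))%E.
Proof.
have : ([set: nat] #= [set: nat * nat])%card.
  by rewrite card_eq_sym; exact: card_nat2.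
move=> /card_set_bijP[e eb]; exists e; split.
  by move=> p; have [_ _ /(_ p I)[k _ <-]] := eb; exists k.
move=> w w0.
rewrite nneseries_esumT; last by move=> k; exact: w0.
rewrite -(reindex_esum [set: nat] [set: nat * nat] e w eb).
have -> : [set: nat * nat] = [set: nat] `*`` (fun=> [set: nat]).
  by apply/seteqP; split.
transitivity (\esum_(k in [set: nat] `*`` (fun=> [set: nat])) w (k.1, k.2))%E.
  by apply: eq_esum => -[].
rewrite -(@esum_esum R _ _ _ _ (fun i j => w (i, j))); last by [].
rewrite nneseries_esumT; last first.
  by move=> i; apply: nneseries_ge0 => j _ _; exact: w0.
by apply: eq_esum => i _; rewrite nneseries_esumT.
Qed.

Section GaugeNull.
Variables (R : realType) (f : R -> R).
Hypothesis f_ge0 : forall t, 0 <= f t.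
Hypothesis f0 : f 0 = 0.

(** Zero Hausdorff measure for f, with upper bounds d i in place of the diameters: f is then
    evaluated at convenient numbers and monotonicity of f never enters. *)
Definition gauge_null (A : set R[i]) : Prop := forall e delta, 0 < e -> 0 < delta ->
  exists (F : nat -> set R[i]) (d : nat -> R), [/\ A `<=` \bigcup_i F i,
    forall i, 0 <= d i < delta,
    forall i u v, F i u -> F i v -> normc (u - v) <= d i &
    (\sum_(i <oo) (f (d i))%:E <= e%:E)%E].

Lemma gauge_null_sub A B : A `<=` B -> gauge_null B -> gauge_null A.
Proof.
move=> AB nB e delta e0 d0; have [F [d [BF h1 h2 h3]]] := nB e delta e0 d0.
by exists F, d; split => //; exact: subset_trans BF.
Qed.

Lemma gauge_null_bigcup (A : nat -> set R[i]) :
  (forall n, gauge_null (A n)) -> gauge_null (\bigcup_n A n).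
Proof.
move=> nA e delta e0 d0.
have en n : 0 < e / (2 ^ n.+1)%:R by rewrite divr_gt0// ltr0n expn_gt0.
have /choice[F hF] n : exists Fd : (nat -> set R[i]) * (nat -> R),
   [/\ A n `<=` \bigcup_i Fd.1 i, forall i, 0 <= Fd.2 i < delta,
    forall i u v, Fd.1 i u -> Fd.1 i v -> normc (u - v) <= Fd.2 i &
    (\sum_(i <oo) (f (Fd.2 i))%:E <= (e / (2 ^ n.+1)%:R)%:E)%E].
  by have [F [d h]] := nA n _ delta (en n) d0; exists (F, d).
have [p [psurj psum]] := nneseries_pairing R.
exists (fun k => (F (p k).1).1 (p k).2), (fun k => (F (p k).1).2 (p k).2); split.
- move=> z [n _ Az]; have [/(_ _ Az)[i _ Fz] _ _ _] := hF n.
  by have [k pk] := psurj (n, i); exists k => //; rewrite pk.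
- by move=> k; have [_ h _ _] := hF (p k).1; exact: h.
- by move=> k; have [_ _ h _] := hF (p k).1; exact: h.
- rewrite (psum (fun q => (f ((F q.1).2 q.2))%:E)); last first.
    by move=> q; rewrite lee_fin.
  apply: le_trans (epsilon_trick0 xpredT (ltW e0)).
  apply: lee_nneseries => [n _ _|n _].
    by apply: nneseries_ge0 => j _ _; rewrite lee_fin.
  by have [_ _ _ h] := hF n.
Qed.

Lemma gauge_null0 : gauge_null set0.
Proof.
move=> e delta e0 d0; exists (fun=> set0), (fun=> 0); split => //.
- by move=> i; rewrite lexx.
- by rewrite eseries0 ?lee_fin ?ltW// => i _ _; rewrite f0.
Qed.

Lemma gauge_null_countable (I : countType) (A : I -> set R[i]) :
  (forall i, gauge_null (A i)) -> gauge_null (\bigcup_i A i).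
Proof.
move=> nA; pose B n := if unpickle n is Some i then A i else set0.
apply: (@gauge_null_sub _ (\bigcup_n B n)).
  by move=> z [i _ Az]; exists (pickle i) => //; rewrite /B pickleK.
apply: gauge_null_bigcup => n; rewrite /B; case: unpickle => [i|] //.
exact: gauge_null0.
Qed.

Lemma gauge_null_finite (A : set R[i]) :
  (forall e delta, 0 < e -> 0 < delta -> exists s : seq (set R[i] * R),
    [/\ forall z, A z -> exists2 p, p \in s & p.1 z,
      forall p, p \in s -> 0 <= p.2 < delta /\
        forall u v, p.1 u -> p.1 v -> normc (u - v) <= p.2 &
      \sum_(p <- s) f p.2 <= e]) ->
  gauge_null A.
Proof.
move=> h e delta e0 d0; have [s [h1 h2 h3]] := h e delta e0 d0.
pose q i := nth (set0, 0) s i.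
have qs i : (i < size s)%N -> q i \in s by move=> iN; exact: mem_nth.
have qd i : (size s <= i)%N -> q i = (set0, 0) by move=> iN; exact: nth_default.
exists (fun i => (q i).1), (fun i => (q i).2); split.
- move=> z /h1[p ps pz]; exists (index p s) => //.
  by rewrite /q nth_index.
- move=> i; case: (ltnP i (size s)) => [/qs/h2[]//|/qd->/=].
  by rewrite lexx.
- move=> i u v; case: (ltnP i (size s)) => [/qs/h2[_ h4]|/qd->//]; exact: h4.
- rewrite (nneseries_split _ (size s)); last by move=> k _; rewrite lee_fin.
  rewrite [X in (_ + X)%E]eseries0 ?adde0; last first.
    by move=> i iN _; rewrite qd ?f0// -[size s]add0n.
  rewrite add0n sumEFin lee_fin.
  by rewrite (big_nth (set0, 0)) in h3.
Qed.

End GaugeNull.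

Lemma natr_near (R : realType) (t : R) :
  exists i j : nat, `|t - (i%:R - j%:R)| <= 1 / 2.
Proof.
have key (s : R) : 0 <= s -> exists i : nat, `|s - i%:R| <= 1 / 2.
  move=> s0; have s0' : 0 <= s + 1 / 2 by lra.
  exists (Num.truncn (s + 1 / 2)); have /andP[] := truncn_itv s0'.
  rewrite -(natr1 (Num.truncn _)) ler_norml.
  by move=> *; apply/andP; split; lra.
have [t0|t0] := leP 0 t.
  by have [i hi] := key _ t0; exists i, 0%N; rewrite subr0.
have [j hj] := key (- t) (ltac:(lra)).
by exists 0%N, j; rewrite sub0r opprK -normrN opprD.
Qed.

Section PowerGauge.
Variables (R : realType) (b K : R) (Phi : R -> R) (lam : R[i]).
Hypotheses (b_gt0 : 0 < b) (K_ge0 : 0 <= K) (lam_neq0 : lam != 0).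
Hypothesis Phi_ge0 : forall x, b <= x -> 0 <= Phi x.
Hypothesis Phi_le : forall x y, b <= x -> x <= y -> Phi x <= Phi y.

Definition power_gauge (t : R) : R := t ^+ 2 * Phi t^-1 `^ K.

Lemma power_gauge_ge0 t : 0 <= power_gauge t.
Proof. by apply: mulr_ge0; [exact: sqr_ge0|exact: powR_ge0]. Qed.

Lemma power_gauge0 : power_gauge 0 = 0.
Proof. by rewrite /power_gauge expr0n/= mul0r. Qed.

Lemma power_gauge_scale c t : 1 <= c -> 0 <= t -> c * t < b^-1 ->
  power_gauge (c * t) <= c ^+ 2 * power_gauge t.
Proof.
move=> c1; rewrite le_eqVlt => /orP[/eqP<-|t0 ct].
  by rewrite mulr0 power_gauge0 mulr0.
have ct0 : 0 < c * t by rewrite mulr_gt0//; lra.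
rewrite /power_gauge exprMn -mulrA ler_wpM2l ?sqr_ge0// ler_wpM2l ?sqr_ge0//.
have b1 : b <= (c * t)^-1.
  by rewrite -[b]invrK lef_pV2 ?posrE ?invr_gt0// ltW.
have b2 : (c * t)^-1 <= t^-1.
  by rewrite lef_pV2 ?posrE// ler_peMl// ltW.
apply: ge0_ler_powR; rewrite ?nnegrE //; [exact: Phi_ge0| |exact: Phi_le].
by apply: Phi_ge0; exact: le_trans b2.
Qed.

(** The plane is cut into countably many half strips of height pi with Re z >= -n. On each of them
    E_lam is injective with a Lipschitz inverse, and a Lipschitz factor c costs at most c^2 in the
    gauge. *)
Lemma gauge_null_preimage A :
  gauge_null power_gauge A -> gauge_null power_gauge (cE lam @^-1` A).
Proof.
move=> nA; have L0 := normc_gt0 lam_neq0; have pi0 := pi_gt0 R.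
pose P (x : nat * (nat * nat)) : set R[i] :=
  [set z | - x.1%:R <= complex.Re z /\
     `|complex.Im z - (x.2.1%:R - x.2.2%:R) * pi| <= pi / 2].
apply: (@gauge_null_sub _ _ _ (\bigcup_x (P x `&` cE lam @^-1` A))).
  move=> z Az; have [i [j hij]] := natr_near (complex.Im z / pi).
  exists ((Num.truncn (- complex.Re z)).+1, (i, j)) => //; split=> //; split => /=.
    by rewrite lerNl ltW// truncnS_gt.
  have -> : complex.Im z - (i%:R - j%:R) * pi = (complex.Im z / pi - (i%:R - j%:R)) * pi.
    by rewrite [RHS]mulrBl divfK// gt_eqF.
  by rewrite normrM (gtr0_norm pi0); move: hij; rewrite -(ler_pM2r pi0); lra.
apply: gauge_null_countable; first exact: power_gauge_ge0.
  exact: power_gauge0.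
move=> x; pose r := normc lam * expR (- x.1%:R).
have r0 : 0 < r by rewrite mulr_gt0 ?expR_gt0.
pose c := Num.max 1 (2 / r).
have c1 : 1 <= c by rewrite le_max lexx.
have c0 : 0 < c by lra.
move=> e delta e0 d0.
pose delta' := Num.min delta b^-1 / c.
have d'0 : 0 < delta' by rewrite divr_gt0// lt_min d0 invr_gt0.
have e'0 : 0 < e / c ^+ 2 by rewrite divr_gt0// exprn_gt0.
have [F [d [AF Fd Fdiam Fsum]]] := nA _ _ e'0 d'0.
have cd i : 0 <= d i /\ c * d i < Num.min delta b^-1.
  have /andP[h1 h2] := Fd i; split=> //.
  by move: h2; rewrite ltr_pdivlMr// mulrC.
exists (fun i => P x `&` cE lam @^-1` (F i)), (fun i => c * d i); split.
- by move=> z [Pz /= /AF[i _ Fz]]; exists i.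
- move=> i; have [h1 h2] := cd i; rewrite mulr_ge0 ?(ltW c0)//=.
  by move: h2; rewrite lt_min => /andP[].
- move=> i u v [[u1 u2] Fu] [[v1 v2] Fv].
  apply: le_trans (cE_inverse_lipschitz lam_neq0 u1 v1 _) _.
    by rewrite [leRHS]splitr; exact: ler_dist_center u2 v2.
  rewrite -/r; apply: (@le_trans _ _ (c * normc (cE lam u - cE lam v))).
    by rewrite ler_wpM2r ?normc_ge0// le_max lexx orbT.
  by rewrite ler_pM2l//; exact: Fdiam.
- apply: (@le_trans _ _ (\sum_(i <oo) (c ^+ 2)%:E * (power_gauge (d i))%:E)%E).
    apply: lee_nneseries => [i _ _|i _]; first by rewrite lee_fin power_gauge_ge0.
    rewrite -EFinM lee_fin; have [h1 h2] := cd i; apply: power_gauge_scale => //.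
    by move: h2; rewrite lt_min => /andP[].
  rewrite nneseriesZl; last by move=> i _; rewrite lee_fin power_gauge_ge0.
  have -> : e%:E = ((c ^+ 2)%:E * (e / c ^+ 2)%:E)%E.
    rewrite -EFinM; congr EFin.
    by rewrite [RHS]mulrC divfK// sqrf_eq0 gt_eqF.
  by rewrite lee_pmul2l// lte_fin exprn_gt0.
Qed.

End PowerGauge.

Lemma escaping_set_null (R : realType) (lam0 b : R) (Phi : R -> R) (lam : R[i]) :
  0 < lam0 -> 1 < b -> rE lam0 b = b -> koenigs_extension lam0 b Phi ->
  lam != 0 ->
  exists2 K, 0 < K & gauge_null (power_gauge K Phi) (escaping_set lam).
Proof.
move=> l0 b1 fixb PhiK lamn0.
have [al [al1 al2 Re_lam Im_lam]] := polar_decomposition lamn0.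
have L0 := normc_gt0 lamn0; set L := normc lam in L0 Re_lam Im_lam.
have Phi_le := koenigs_le l0 b1 fixb PhiK.
have Phi_ge0 := koenigs_ge0 l0 b1 fixb PhiK.
have b0 : 0 < b by lra.
have lb : 0 < ln b by exact: ln_gt0.
pose kap : R := 97 / 100.
have kap01 : 0 < kap < 1 by rewrite /kap; apply/andP; split; lra.
(* This makes b^K * 97/100 the square root of 97/100. *)
pose K := - ln kap / (2 * ln b).
have lk : ln kap < 0 by apply: ln_lt0.
have K0 : 0 < K by rewrite divr_gt0 ?oppr_gt0// mulr_gt0.
pose rho := b `^ K * kap.
have rhoE : rho = expR (ln kap / 2).
  have kE : kap = expR (ln kap) by rewrite lnK ?posrE//; case/andP: kap01.
  rewrite /rho /powR gt_eqF// [X in _ * X]kE.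
  by rewrite -expRD; congr expR; rewrite /K; field; rewrite gt_eqF.
have rho01 : 0 < rho < 1.
  by rewrite rhoE expR_gt0/= -[ltRHS]expR0 ltr_expR; lra.
exists K => //.
have [M1 hM1] := near_pinftyP (half_annulus_cover al1 al2).
have : \forall x \near +oo, [/\ 1 <= x, M1 <= L * expR x, 255 <= L * expR x,
    x <= L * expR x & (L * expR x) * (3 * (11 / 10 * (L * expR x)) + b)
       <= rE lam0 (3 * x + b)].
  near=> x.
  have x1 : 1 <= x by near: x; exact: nbhs_pinfty_le_real.
  have sup : L^-1 * x <= expR x by near: x; exact: expR_superlinear.
  have h : L * (33 / 10 * L + b) <= lam0 * expR b * expR x.
    by near: x; apply: near_expR_ge; rewrite mulr_gt0 ?expR_gt0.
  split=> //.
  - by near: x; exact: near_expR_ge.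
  - by near: x; exact: near_expR_ge.
  - by move: sup; rewrite mulrC ler_pdivrMr// mulrC.
  - have e1 : 1 <= expR x by rewrite -[leLHS]expR0 ler_expR; lra.
    have -> : rE lam0 (3 * x + b) = lam0 * expR b * expR x * (expR x * expR x).
      rewrite /rE (_ : 3 * x + b = b + x + (x + x)); last by ring.
      by rewrite !expRD; ring.
    apply: (@le_trans _ _ (L * (33 / 10 * L + b) * (expR x * expR x))); last first.
      by rewrite ler_wpM2r// mulr_ge0// expR_ge0.
    have e0 := expR_gt0 x.
    have : b * expR x <= b * (expR x * expR x) by rewrite ler_pM2l// ler_peMl// ltW.
    move=> /(ler_wpM2l (ltW L0)); lra.
move=> /near_pinftyP[M hM].
have M0 : 0 < M by have [h _ _ _ _] := hM _ (lexx M); lra.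
pose J := stays_right lam M.
have nJbox x y : M <= x -> cos (y + al) = 1 ->
    gauge_null (power_gauge K Phi) (J `&` box (ln (11 / 10)) (pi / 2) (x, y)).
  move=> Mx rowy; apply: gauge_null_finite.
  - exact: power_gauge_ge0.
  - exact: power_gauge0.
  move=> e delta e0 d0.
  pose c := Phi (3 * x + b) `^ K * 25.
  have [n [n1 n2]] : exists n, c * rho ^+ n <= e /\
      5 * (1 / 2) ^+ n < Num.min delta b^-1.
    have c1 : c * rho ^+ n @[n --> \oo] --> 0.
      rewrite -[X in _ --> X](mulr0 c); apply: cvgM; first exact: cvg_cst.
      by apply: cvg_expr; rewrite ger0_norm; lra.
    have c2 : 5 * (1 / 2) ^+ n @[n --> \oo] --> (0 : R).
      rewrite -[X in _ --> X](mulr0 (5 : R)); apply: cvgM; first exact: cvg_cst.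
      by apply: cvg_expr; rewrite ger0_norm; lra.
    have m0 : 0 < Num.min delta b^-1 by rewrite lt_min d0 invr_gt0.
    have : \forall n \near \oo, c * rho ^+ n <= e /\
      5 * (1 / 2) ^+ n < Num.min delta b^-1.
      near=> n; split.
        have : `|0 - c * rho ^+ n| <= e.
          by near: n; move/cvgrPdist_le: c1; exact.
        by rewrite sub0r normrN; apply: le_trans; exact: ler_norm.
      have : `|0 - 5 * (1 / 2) ^+ n| < Num.min delta b^-1.
        by near: n; move/cvgrPdist_lt: c2; exact.
      by rewrite sub0r normrN; apply: le_lt_trans; exact: ler_norm.
    by move=> /filter_ex.
  have [s [s1 s2 s3]] := level_cover l0 b1 fixb lamn0 Re_lam Im_lam M0
    (fun x Mx => hM1 _ (let: And5 _ h _ _ _ := hM x Mx in h))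
    (fun x (Mx : M <= x) => let: And5 _ _ h1 h2 h3 := hM x Mx in
       And3 h1 (le_trans Mx h2) h3) n Mx rowy.
  exists s; split.
  - by move=> z [Jz Bz]; exact: s1.
  - move=> p /s2[p0 p1 _ p3]; split=> //; rewrite ltW//=.
    by move: (le_lt_trans p1 n2); rewrite lt_min => /andP[].
  - have bq : b <= 3 * x + b by lra.
    apply: (@le_trans _ _ (\sum_(p <- s) (p.2 ^+ 2 *
        ((b `^ K) ^+ n * Phi (3 * x + b) `^ K)))).
      rewrite big_seq [leRHS]big_seq; apply: ler_sum => p /s2[p0 p1 p2 _].
      rewrite /power_gauge ler_wpM2l ?sqr_ge0//.
      have pb : b <= (p.2)^-1.
        move: (le_lt_trans p1 n2); rewrite lt_min => /andP[_ h].
        by rewrite -[b]invrK lef_pV2 ?posrE ?invr_gt0// ltW.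
      have -> : (b `^ K) ^+ n * Phi (3 * x + b) `^ K =
          Phi (iter n (rE lam0) (3 * x + b)) `^ K.
        rewrite (koenigs_iter b1 fixb PhiK)// powRM ?Phi_ge0 ?exprn_ge0 ?(ltW b0)//.
        congr (_ * _); rewrite -(powR_mulrn n (ltW b0)).
        by rewrite -(powR_mulrn n (powR_ge0 b K)) powRAC.
      have pi' := le_trans pb p2.
      by apply: ge0_ler_powR; rewrite ?nnegrE ?Phi_ge0 ?Phi_le// ltW.
    rewrite -big_distrl/=.
    apply: le_trans n1; rewrite /c /rho exprMn.
    have -> : Phi (3 * x + b) `^ K * 25 * ((b `^ K) ^+ n * kap ^+ n) =
      25 * kap ^+ n * ((b `^ K) ^+ n * Phi (3 * x + b) `^ K) by ring.
    by rewrite ler_wpM2r// mulr_ge0 ?exprn_ge0 ?powR_ge0.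
have nJ : gauge_null (power_gauge K Phi) J.
  (* E_lam z also has positive real part, so z is within pi / 2 of a row; countably many boxes
     suffice. *)
  apply: (@gauge_null_sub _ _ _ (\bigcup_(i : nat * (bool * nat)) (J `&`
     box (ln (11 / 10)) (pi / 2) (M + i.1%:R * ln (11 / 10), row_height al i.2)))).
    move=> z Jz; have z0 : M <= complex.Re z := Jz 0%N.
    have cz : 0 <= cos (complex.Im z + al).
      have := Jz 1%N; rewrite /= (Re_cE Re_lam Im_lam).
      move=> /(lt_le_trans M0); rewrite pmulr_rgt0; first exact: ltW.
      by rewrite mulr_gt0 ?expR_gt0.
    have [x hx] := cos_ge0_near_row cz.
    have a0 : 0 < ln (11 / 10) :> R by apply: ln_gt0; lra.
    have zl : complex.Re z <= M + (complex.Re z - M) by lra.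
    have [k _ hk] := grid_cover a0 z0 zl.
    by exists (k, x).
  apply: gauge_null_countable.
  - exact: power_gauge_ge0.
  - exact: power_gauge0.
  move=> [i x] /=; apply: nJbox; last exact: cos_rowE.
  by rewrite lerDl mulr_ge0// ln_ge0//; lra.
have nJn n : gauge_null (power_gauge K Phi) (iter n (cE lam) @^-1` J).
  elim: n => [//|n ih].
  have -> : iter n.+1 (cE lam) @^-1` J = cE lam @^-1` (iter n (cE lam) @^-1` J).
    by apply/seteqP; split => z; rewrite /preimage/= -iterSr.
  exact: (gauge_null_preimage b0 (ltW K0) lamn0 Phi_ge0 Phi_le).
apply: (gauge_null_sub (B := \bigcup_n iter n (cE lam) @^-1` J)); last first.
  by apply: gauge_null_bigcup => //; exact: power_gauge_ge0.
(* The modulus of E_lam z depends only on Re z, so a modulus at least |lam| e^M means Re z >= M one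
   step earlier. *)
move=> z; rewrite /escaping_set/= => /cvgryPge/(_ (L * expR M))[N _ hN].
exists N => // k /=; rewrite -iterD.
have := hN (k + N).+1; rewrite /= normc_cE ler_pM2l// ler_expR; apply.
by rewrite ltnW// ltnS leq_addl.
Unshelve. all: by end_near. Qed.

(** * Hausdorff measures *)

Lemma at_right0P (R : realType) (P : R -> Prop) :
  (\forall t \near (0 : R)^'+, P t) ->
  exists2 tau, 0 < tau & forall t, 0 < t -> t < tau -> P t.
Proof.
move=> [tau /= tau0 h]; exists tau => // t t0 tt; apply: h => //=.
by rewrite sub0r normrN gtr0_norm.
Qed.

Lemma limf_einf_gt (R : realType) (T : choiceType) (X : filteredType T)
    (f : X -> \bar R) (F : set (set X)) (K : R) : Filter F ->
  (K%:E < limf_einf f F)%E -> exists2 s, K < s & F [set x | (s%:E <= f x)%E].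
Proof.
move=> FF; rewrite limf_einfE => /ereal_sup_gt[_ [V FV <-] KV].
have [s Ks sV] : exists2 s, K < s & (s%:E <= ereal_inf (f @` V))%E.
  case: (ereal_inf _) KV => [s| |] // Ks; first by exists s.
  by exists (K + 1); rewrite ?ltrDl ?leey.
exists s => //; apply: filterS FV => x Vx; apply: le_trans sV _.
by apply: ereal_inf_lbound; exists x.
Qed.

Lemma limf_esup_lt (R : realType) (T : choiceType) (X : filteredType T)
    (f : X -> \bar R) (F : set (set X)) (K : R) : Filter F ->
  (limf_esup f F < K%:E)%E -> F [set x | (f x < K%:E)%E].
Proof.
move=> FF; rewrite limf_esupE => /ereal_inf_lt[_ [V FV <-] KV].
apply: filterS FV => x Vx; apply: le_lt_trans KV.
by apply: ereal_sup_ubound; exists x.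
Qed.

Section HausdorffMeasure.
Variable R : realType.
Implicit Types (A : set R[i]) (h : R -> R).

Lemma diam_ge0 A : (0 <= diam A)%E.
Proof. by rewrite /diam le_max lexx. Qed.

Lemma diam_le A d : 0 <= d -> (forall u v, A u -> A v -> normc (u - v) <= d) ->
  (diam A <= d%:E)%E.
Proof.
move=> d0 Ad; rewrite /diam ge_max lee_fin d0/=; apply: ge_ereal_sup.
by move=> _ [[u v] [/= Au Av] <-]; rewrite lee_fin Ad.
Qed.

Lemma dist_le_diam A (r : R) u v : (diam A < r%:E)%E -> A u -> A v ->
  normc (u - v) <= fine (diam A).
Proof.
move=> Ar Au Av.
have fA : diam A \is a fin_num.
  by rewrite ge0_fin_numE ?diam_ge0//; apply: lt_trans Ar _; exact: ltry.
rewrite -lee_fin fineK// /diam le_max; apply/orP; right.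
by apply: ereal_sup_ubound; exists (u, v).
Qed.

Lemma fine_diam_itv A (r : R) : (diam A < r%:E)%E -> 0 <= fine (diam A) < r.
Proof.
move=> Ar; rewrite fine_ge0 ?diam_ge0//=.
have fA : diam A \is a fin_num.
  by rewrite ge0_fin_numE ?diam_ge0//; apply: lt_trans Ar _; exact: ltry.
by rewrite -lte_fin fineK.
Qed.

Lemma hausdorff_content_le h A (d1 d2 : R) : d1 <= d2 ->
  (hausdorff_content h d2 A <= hausdorff_content h d1 A)%E.
Proof.
move=> d12; apply: le_ereal_inf_tmp => _ [F [AF Fd] <-].
apply: ereal_inf_lbound; exists F => //; split=> // i.
by apply: lt_le_trans (Fd i) _; rewrite lee_fin.
Qed.

(** The content is nonincreasing in delta, so its limit at 0 from the right is a supremum. *)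
Lemma hausdorff_content_le_measure h A (d : R) : 0 < d ->
  (hausdorff_content h d A <= hausdorff_measure h A)%E.
Proof.
move=> d0; rewrite /hausdorff_measure.
have /cvg_lim -> // := @nonincreasing_at_right_cvge R
  (fun d => hausdorff_content h d A) 0 (BInfty _ false) (ltac:(by []))
  (fun x y _ _ xy => hausdorff_content_le h A xy).
by apply: ereal_sup_ubound; exists d => //=; rewrite in_itv/= d0.
Qed.

Lemma hausdorff_measure_null (eps : R) h f A :
  gauge_function eps h -> f 0 = 0 ->
  (\forall t \near (0 : R)^'+, h t <= f t) -> gauge_null f A ->
  hausdorff_measure h A = 0%E.
Proof.
move=> [eps0 h0 hge0 hmono _] f0 /at_right0P[tau tau0 hf] nA.
apply/lim_near_cst => //; near=> delta.
have d0 : 0 < delta by near: delta; exact: nbhs_right_gt.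
have de : delta < eps by near: delta; exact: nbhs_right_lt.
have dt : delta < tau by near: delta; exact: nbhs_right_lt.
apply/eqP; rewrite eq_le; apply/andP; split; last first.
  apply: le_ereal_inf_tmp => _ [F [_ Fd] <-].
  apply: nneseries_ge0 => i _ _; rewrite lee_fin; apply: hge0.
  by have /andP[-> h2] := fine_diam_itv (Fd i); exact: lt_trans de.
apply/lee_addgt0Pr => e e0; rewrite add0e.
have [F [d [AF Fd Fdiam Fsum]]] := nA _ _ e0 d0.
have Fdi i : (diam (F i) <= (d i)%:E)%E.
  by apply: diam_le; [case/andP: (Fd i)|exact: Fdiam].
have Fdlt i : (diam (F i) < delta%:E)%E.
  by apply: le_lt_trans (Fdi i) _; rewrite lte_fin; case/andP: (Fd i).
apply: le_trans Fsum.
apply: (@le_trans _ _ (\sum_(i <oo) (h (fine (diam (F i))))%:E)%E).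
  by apply: ereal_inf_lbound; exists F.
apply: lee_nneseries => [i _ _|i _].
  rewrite lee_fin; apply: hge0.
  by have /andP[-> h2] := fine_diam_itv (Fdlt i); exact: lt_trans de.
have /andP[di0 did] := Fd i.
have /andP[fd0 fd1] := fine_diam_itv (Fdlt i).
rewrite lee_fin; apply: (@le_trans _ _ (h (d i))).
  apply: hmono => //; last by apply: lt_trans de.
  by rewrite -lee_fin fineK// ge0_fin_numE ?diam_ge0//; apply: lt_trans (ltry delta).
move: di0; rewrite le_eqVlt => /orP[/eqP<-|di0]; first by rewrite h0 f0.
by apply: hf => //; exact: lt_trans dt.
Unshelve. all: by end_near. Qed.

(* As f = o(h) at 0, a piece of finite measure for h has covers with arbitrarily
   small sums of f, and so has a countable union of such pieces. *)
Lemma not_hausdorff_sigma_finite (eps c t0 : R) h f A :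
  gauge_function eps h -> 0 < c -> 0 < t0 -> (forall t, 0 <= f t) ->
  (forall om, 0 < om -> \forall t \near (0 : R)^'+, f t <= om * h t) ->
  (forall (U : nat -> set R[i]) (d : nat -> R),
    (forall k u v, U k u -> U k v -> normc (u - v) <= d k) ->
    (forall k, 0 < d k < t0) ->
    (\sum_(k <oo) (f (d k))%:E < c%:E)%E -> ~ A `<=` \bigcup_k U k) ->
  ~ hausdorff_sigma_finite h A.
Proof.
move=> [eps0 h0 hge0 hmono hcont] c0 t00 fge0 fh large [F [AF Ffin]].
have /choice[M hM] i : exists M : R, 0 <= M /\
    forall d, 0 < d -> (hausdorff_content h d (F i) <= M%:E)%E.
  have := Ffin i; have := fun d => @hausdorff_content_le_measure h (F i) d.
  case: (hausdorff_measure h (F i)) => [m hm _|//|hm _].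
    exists (Num.max 0 m); split; first by rewrite le_max lexx.
    by move=> d /hm /le_trans; apply; rewrite lee_fin le_max lexx orbT.
  exists 0; split=> // d /hm /le_trans; apply; exact: leNye.
(* The piece i may contribute c / 2^(i + 2). Its h-sums are at most M i + 1, and the enlarged
   diameters below add at most 1. *)
pose om i := c / 2 / (2 ^ i.+1)%:R / (M i + 2).
have M2 i : 0 < M i + 2 by have [M0 _] := hM i; lra.
have om0 i : 0 < om i by rewrite !divr_gt0// ltr0n expn_gt0.
have /choice[delta hdelta] i : exists delta : R, [/\ 0 < delta, delta < eps,
    delta < t0 & forall t, 0 < t -> t < delta -> f t <= om i * h t].
  have [tau tau0 htau] := at_right0P (fh _ (om0 i)).
  pose m := Num.min tau (Num.min eps t0).
  have m0 : 0 < m by rewrite !lt_min tau0 eps0.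
  have [m1 m2 m3] : [/\ m <= tau, m <= eps & m <= t0].
    by rewrite /m !ge_min !lexx !orbT.
  exists (m / 2); split; try lra.
  by move=> t tt0 tm; apply: htau => //; lra.
have /choice[G hG] i : exists G : nat -> set R[i], [/\ F i `<=` \bigcup_j G j,
    forall j, (diam (G j) < (delta i)%:E)%E &
    (\sum_(j <oo) (h (fine (diam (G j))))%:E <= (M i + 1)%:E)%E].
  have [d0 _ _ _] := hdelta i; have [_ /(_ _ d0) hc] := hM i.
  have : (hausdorff_content h (delta i) (F i) < (M i + 1)%:E)%E.
    by apply: le_lt_trans hc _; rewrite lte_fin ltrDl.
  move=> /ereal_inf_lt[_ [G [FG Gd] <-] Glt]; exists G; split=> //; exact: ltW.
(* Sets of the cover may have diameter 0, whereas [large] asks for positive d. Diameters are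
   therefore raised to some t > 0 with summable h t, which exists because h is right continuous at 0
   with value 0. *)
have tiny i j : exists t : R, [/\ 0 < t, t < delta i & h t <= 1 / (2 ^ j.+1)%:R].
  have [d0 _ _ _] := hdelta i.
  have e0 : 0 < 1 / (2 ^ j.+1)%:R :> R by rewrite divr_gt0// ltr0n expn_gt0.
  have := hcont 0; rewrite lexx eps0 h0 => /(_ isT)/cvgrPdist_le/(_ _ e0).
  move=> /at_right0P[tau tau0 htau].
  pose m := Num.min tau (delta i).
  have m0 : 0 < m by rewrite lt_min tau0.
  have [m1 m2] : m <= tau /\ m <= delta i by rewrite /m !ge_min !lexx orbT.
  exists (m / 2); split; try lra.
  have := htau (m / 2) (ltac:(lra)) (ltac:(lra)).
  by rewrite sub0r normrN; apply: le_trans; exact: ler_norm.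
have /choice[t ht] (p : nat * nat) : exists t : R,
    [/\ 0 < t, t < delta p.1 & h t <= 1 / (2 ^ p.2.+1)%:R] by exact: tiny.
pose dd (p : nat * nat) := Num.max (fine (diam (G p.1 p.2))) (t p).
have dGI p : 0 <= fine (diam (G p.1 p.2)) < delta p.1.
  by have [_ Gd _] := hG p.1; exact: fine_diam_itv.
have ddI p : 0 < dd p < delta p.1.
  have [tp0 td _] := ht p; have /andP[_ Gd] := dGI p.
  by rewrite /dd lt_max tp0 orbT gt_max td Gd.
have [e [esurj esum]] := nneseries_pairing R.
apply: (large (fun k => G (e k).1 (e k).2) (fun k => dd (e k))).
- move=> k u v Gu Gv; have [_ Gd _] := hG (e k).1.
  by apply: le_trans (dist_le_diam (Gd _) Gu Gv) _; rewrite le_max lexx.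
- move=> k; have /andP[-> h1] := ddI (e k); have [_ _ h2 _] := hdelta (e k).1.
  exact: lt_trans h2.
- rewrite (esum (fun p => (f (dd p))%:E)); last by move=> p; rewrite lee_fin.
  apply: (@le_lt_trans _ _ (c / 2)%:E); last by rewrite lte_fin; lra.
  have c20 : 0 <= c / 2 by lra.
  apply: le_trans (epsilon_trick0 xpredT c20).
  apply: lee_nneseries => [i _ _|i _].
    by apply: nneseries_ge0 => j _ _; rewrite lee_fin.
  have [d0 deps _ fom] := hdelta i.
  have hG0 j : 0 <= h (fine (diam (G i j))).
    apply: hge0; have /andP[-> h2] := dGI (i, j); exact: lt_trans deps.
  have ht0 j : 0 <= h (t (i, j)).
    apply: hge0; have [h1 h2 _] := ht (i, j); rewrite (ltW h1)/=.
    exact: lt_trans deps.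
  apply: (@le_trans _ _ (\sum_(j <oo) ((om i)%:E * ((h (fine (diam (G i j))))%:E +
     (1 / (2 ^ j.+1)%:R)%:E)))%E).
    apply: lee_nneseries => [j _ _|j _]; first by rewrite lee_fin.
    rewrite -EFinD -EFinM lee_fin.
    have /andP[dd0 dd1] := ddI (i, j).
    apply: le_trans (fom _ dd0 dd1) _; rewrite ler_pM2l//.
    have [_ _ h1] := ht (i, j); have := hG0 j; have := ht0 j.
    by rewrite /dd /=; have [_|_] := leP (fine (diam (G i j))) (t (i, j)); lra.
  rewrite nneseriesZl; last first.
    by move=> j _; rewrite -EFinD lee_fin addr_ge0// divr_ge0// ler0n.
  rewrite nneseriesD; last 2 first.
  - by move=> j _ _; rewrite lee_fin.
  - by move=> j _ _; rewrite lee_fin divr_ge0// ler0n.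
  have -> : (c / 2 / (2 ^ i.+1)%:R)%:E = ((om i)%:E * ((M i + 1)%:E + 1%:E))%E.
    rewrite -EFinD -EFinM; congr EFin; rewrite /om.
    have -> : M i + 1 + 1 = M i + 2 by ring.
    by rewrite divfK// gt_eqF.
  rewrite lee_pmul2l// ?lte_fin// leeD//; first by have [] := hG i.
  exact: (epsilon_trick0 xpredT ler01).
- rewrite AF => z [i _ Fz]; have [/(_ _ Fz)[j _ Gz] _ _] := hG i.
  by have [k ek] := esurj (i, j); exists k => //; rewrite ek.
Qed.

End HausdorffMeasure.

(** * Comparison of h with powers of Phi *)

Lemma near_at_right0_inv (R : realType) (P : R -> Prop) :
  (\forall x \near +oo, P x) -> \forall t \near (0 : R)^'+, P t^-1.
Proof.
move=> /near_pinftyP[M hM]; pose m := Num.max 1 M.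
have m0 : 0 < m by rewrite lt_max ltr01.
near=> t; apply: hM; apply: (@le_trans _ _ m); first by rewrite le_max lexx orbT.
have t0 : 0 < t by near: t; exact: nbhs_right_gt.
rewrite -[m]invrK lef_pV2 ?posrE ?invr_gt0//.
by near: t; apply: nbhs_right_le; rewrite invr_gt0.
Unshelve. all: by end_near. Qed.

Theorem theorem5p4 (R : realType) (lam0 beta : R) (Phi : R -> R) (lam : R[i])
  (lam0_gt0 : 0 < lam0) (lam0_lt : lam0 < (expR 1)^-1)
  (beta_fix : larger_fixed_point lam0 beta)
  (Phi_koenigs : koenigs_extension lam0 beta Phi)
  (lam_neq0 : lam != 0) :
  exists K1 K2 : R,
    [/\ 0 < K1, 0 < K2, K1 = ln 2 / ln beta &
      forall (eps : R) (h g : R -> R),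
        gauge_function eps h ->
        (forall t, 0 <= t < eps -> h t = t ^+ 2 * g t) ->
        ((K1%:E < limf_einf (log_ratio g Phi) (0 : R)^'+)%E ->
           hausdorff_measure h (escaping_set lam) = +oo%E /\
           ~ hausdorff_sigma_finite h (escaping_set lam)) /\
        ((limf_esup (log_ratio g Phi) (0 : R)^'+ < K2%:E)%E ->
           hausdorff_measure h (escaping_set lam) = 0%E)].
Proof.
have b1 := larger_fixed_point_gt1 lam0_gt0 lam0_lt beta_fix.
have fixb : rE lam0 beta = beta by have [a [_ h]] := beta_fix; apply/h; right.
have lnb : 0 < ln beta := ln_gt0 b1.
have ln2 : 0 < ln 2 :> R by apply: ln_gt0; rewrite ltr1n.
have [K2 K20 null] := escaping_set_null lam0_gt0 b1 fixb Phi_koenigs lam_neq0.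
have Phi_large A : \forall t \near (0 : R)^'+, A <= Phi t^-1.
  apply: (@near_at_right0_inv _ (fun x => A <= Phi x)).
  exact: (koenigs_cvgy lam0_gt0 b1 fixb Phi_koenigs).
exists (ln 2 / ln beta), K2; split => //; first exact: divr_gt0.
move=> eps h g gh hg; have [eps0 h0 hge0 _ _] := gh.
have near_eps : \forall t \near (0 : R)^'+, 0 < t < eps.
  near=> t; apply/andP; split; first by near: t; exact: nbhs_right_gt.
  by near: t; exact: nbhs_right_lt.
split=> [/limf_einf_gt[s0 s0K near_s0]|/limf_esup_lt near_K2].
  have not_sf : ~ hausdorff_sigma_finite h (escaping_set lam).
    (* Strictly above K1, so that beta^s > 2, and strictly below s0, so that the gauge with exponent
       s is o(h). *)
    pose s := (ln 2 / ln beta + s0) / 2.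
    have sK : ln 2 / ln beta < s by rewrite /s; lra.
    have ss0 : s < s0 by rewrite /s; lra.
    have s_gt0 : 0 < s by apply: lt_trans sK; exact: divr_gt0.
    have bs2 : 2 < beta `^ s.
      rewrite -ltr_ln ?posrE ?powR_gt0//; last by lra.
      by rewrite ln_powR -ltr_pdivrMr.
    have [c [t0 [c0 t00 large]]] :=
      escaping_set_large lam0_gt0 b1 fixb Phi_koenigs lam_neq0 s_gt0 bs2.
    apply: (not_hausdorff_sigma_finite (f := power_gauge s Phi) gh c0 t00) => //.
      exact: power_gauge_ge0.
    move=> om om0; near=> t.
    have /andP[tt0 te] : 0 < t < eps by near: t.
    have P2 : 2 <= Phi t^-1 by near: t; exact: Phi_large.
    have Pom : om^-1 `^ (s0 - s)^-1 <= Phi t^-1 by near: t; exact: Phi_large.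
    have rat : (s0%:E <= log_ratio g Phi t)%E by near: t.
    have lnP : 0 < ln (Phi t^-1) by apply: ln_gt0; lra.
    move: rat; rewrite lee_fin ler_pdivlMr// => rat.
    (* [ln] vanishes at nonpositive arguments, and then the ratio would be 0 < s0. *)
    have g0 : 0 < g t.
      rewrite ltNge; apply/negP => /ln0 gE; move: rat; rewrite gE leNgt.
      by rewrite mulr_gt0//; exact: lt_trans ss0.
    have gP : Phi t^-1 `^ s0 <= g t.
      rewrite -ler_ln ?posrE ?powR_gt0//; last by lra.
      by rewrite ln_powR.
    rewrite (hg t); last by rewrite ltW.
    rewrite /power_gauge mulrCA ler_wpM2l ?sqr_ge0//.
    apply: (@le_trans _ _ (om * Phi t^-1 `^ s0)); last by rewrite ler_pM2l.
    have -> : s0 = (s0 - s) + s by ring.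
    rewrite powRD; last by apply/implyP => _; rewrite gt_eqF//; lra.
    rewrite mulrA ler_peMl ?powR_ge0//.
    have s0s : 0 < s0 - s by rewrite subr_gt0.
    have : (om^-1 `^ (s0 - s)^-1) `^ (s0 - s) <= Phi t^-1 `^ (s0 - s).
      apply: ge0_ler_powR; rewrite ?nnegrE ?powR_ge0//; [exact: ltW|lra].
    rewrite -powRrM mulVf ?gt_eqF// powRr1 ?invr_ge0 ?(ltW om0)// => Ps.
    by rewrite -(mulfV (lt0r_neq0 om0)) ler_pM2l.
  (* A set of finite measure is sigma-finite through the constant sequence. *)
  split=> //; apply/eqP; rewrite -[_ == _]negbK -ltey; apply/negP => fin.
  apply: not_sf; exists (fun=> escaping_set lam); split=> //.
  by apply/seteqP; split=> [z Iz|z [_ _ Iz]] //; exists 0%N.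
apply: (hausdorff_measure_null gh _ _ null); first exact: power_gauge0.
near=> t.
have /andP[t0 te] : 0 < t < eps by near: t.
have P2 : 2 <= Phi t^-1 by near: t; exact: Phi_large.
have rat : (log_ratio g Phi t < K2%:E)%E by near: t.
have lnP : 0 < ln (Phi t^-1) by apply: ln_gt0; lra.
move: rat; rewrite lte_fin ltr_pdivrMr// => rat.
have tI : 0 <= t < eps by rewrite (ltW t0).
rewrite (hg t)// /power_gauge ler_wpM2l ?sqr_ge0//.
have [g0|g0] := leP (g t) 0; first by apply: le_trans g0 _; exact: powR_ge0.
rewrite -ler_ln ?posrE ?powR_gt0//; last by lra.
by rewrite ln_powR ltW.
Unshelve. all: by end_near. Qed.
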